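(* Let $G$ be an algebraic subgroup of $\mathrm{Aut}\,\mathbf A^n$ such that $G^0$ is a torus. (i) If $\dim G=n$ or $n-1$, then there is an element $g\in\mathrm{Aut}\,\mathbf A^n$ such that $gGg^{-1}\subset\mathrm{GL}_n$ and $gG^0g^{-1}\subset D_n$. (ii) If $G\subset\mathrm{Aut}^*\mathbf A^n$ and $\dim G=n-1$, then there is an element $g\in\mathrm{Aut}^*\mathbf A^n$ such that $gGg^{-1}\subset\mathrm{SL}_n$ and $gG^0g^{-1}=D_n^*$.
   Context: $k$ is an algebraically closed field of characteristic $0$; $\mathbf A^n$ is affine space over $k$ with standard coordinate functions $x_1,\ldots,x_n$. $\mathrm{Aut}\,\mathbf A^n$ is the group of polynomial automorphisms of $\mathbf A^n$, an element $g$ being written $(g_1,\ldots,g_n)$ with $g_i=g^*(x_i)$. $\mathrm{Jac}(g)=\det(\partial g_i/\partial x_j)\in k\setminus\{0\}$ and $\mathrm{Aut}^*\mathbf A^n=\{g\in\mathrm{Aut}\,\mathbf A^n\mid\mathrm{Jac}(g)=1\}$. A subgroup of $\mathrm{Aut}\,\mathbf A^n$ is called algebraic if it is the image of an algebraic group under a homomorphism to $\mathrm{Aut}\,\mathbf A^n$ for which the action map on $\mathbf A^n$ is a morphism. $G^0$ is the identity component of $G$. $\mathrm{GL}_n\subset\mathrm{Aut}\,\mathbf A^n$ is the subgroup of linear transformations, $\mathrm{SL}_n=\mathrm{GL}_n\cap\mathrm{Aut}^*\mathbf A^n$, $D_n=\{(t_1x_1,\ldots,t_nx_n)\mid t_1,\ldots,t_n\in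 k\setminus\{0\}\}$ is the diagonal torus of $\mathrm{GL}_n$, and $D_n^*=D_n\cap\mathrm{Aut}^*\mathbf A^n=\{(t_1x_1,\ldots,t_nx_n)\mid t_1\cdots t_n=1\}$. *)

(* Defs.v *)
From HB Require Import structures.
From mathcomp Require Import all_boot all_order all_algebra.
From mathcomp Require Import boolp classical_sets topology.
From mathcomp Require Import mpoly.

Set Implicit Arguments.
Unset Strict Implicit.
Unset Printing Implicit Defensive.

Import GRing.Theory.

Local Open Scope classical_set_scope.
Local Open Scope ring_scope.

(* The tuple [g] stands for the polynomial map [(g_1, ..., g_n)] with
   [g_i = g^* x_i]; hence [(g \o h)_i = g_i (h_1, ..., h_n)]. *)
Definition polyend (k : fieldType) (n : nat) := n.-tuple {mpoly k[n]}.

Definition polyend_comp (k : fieldType) (n : nat) (g h : polyend k n) :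
  polyend k n := [tuple tnth g i \mPo h | i < n].

Definition polyend_id (k : fieldType) (n : nat) : polyend k n :=
  [tuple 'X_i | i < n].
Arguments polyend_id {k n}.

Definition inverse_pair (k : fieldType) (n : nat)
    (p : polyend k n * polyend k n) : bool :=
  (polyend_comp p.1 p.2 == polyend_id) &&
  (polyend_comp p.2 p.1 == polyend_id).

(* An automorphism is stored together with its (unique) inverse. *)
Record polyaut (k : fieldType) (n : nat) : Type := Polyaut {
  polyaut_pair : polyend k n * polyend k n;
  _ : inverse_pair polyaut_pair
}.

HB.instance Definition _ (k : fieldType) (n : nat) :=
  [isSub for @polyaut_pair k n].
HB.instance Definition _ (k : fieldType) (n : nat) :=
  [Choice of polyaut k n by <:].

Definition polyaut_map (k : fieldType) (n : nat) (g : polyaut k n) :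
  polyend k n := (val g).1.

Lemma comp_mpolyA (k : fieldType) (n : nat) (p : {mpoly k[n]})
    (g h : polyend k n) :
  (p \mPo g) \mPo h = p \mPo (polyend_comp g h).
Proof.
rewrite (comp_mpolyEX p g) (comp_mpolyEX p) raddf_sum /=; apply: eq_bigr => m _.
rewrite !comp_mpolyZ !comp_mpolyX rmorph_prod /=; congr (_ *: _).
by apply: eq_bigr => i _; rewrite rmorphXn /= tnth_mktuple.
Qed.

Lemma polyend_compA (k : fieldType) (n : nat) :
  associative (@polyend_comp k n).
Proof.
move=> f g h; apply: eq_from_tnth => i.
by rewrite !tnth_mktuple comp_mpolyA.
Qed.

Lemma polyend_comp1 (k : fieldType) (n : nat) :
  right_id polyend_id (@polyend_comp k n).
Proof.
by move=> f; apply: eq_from_tnth => i; rewrite tnth_mktuple comp_mpoly_id.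
Qed.

Lemma polyend_1comp (k : fieldType) (n : nat) :
  left_id polyend_id (@polyend_comp k n).
Proof.
move=> f; apply: eq_from_tnth => i.
by rewrite !tnth_mktuple comp_mpolyXU -tnth_nth.
Qed.

Section PolyautGroup.
Context (k : fieldType) (n : nat).
Local Notation "f \; g" := (@polyend_comp k n f g).
Local Notation idp := (@polyend_id k n).

Lemma polyaut_one_proof : inverse_pair (idp, idp).
Proof. by rewrite /inverse_pair /= polyend_comp1 eqxx. Qed.

Lemma polyaut_inv_proof (g : polyaut k n) :
  inverse_pair ((val g).2, (val g).1).
Proof. by case: g => [[g h]] /=; rewrite /inverse_pair /= andbC. Qed.

Lemma polyaut_mul_proof (f g : polyaut k n) :
  inverse_pair ((val f).1 \; (val g).1, (val g).2 \; (val f).2).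
Proof.
case: f g => [[f f'] /= /andP[/eqP /= ff' /eqP /= f'f]].
case=> [[g g'] /= /andP[/eqP /= gg' /eqP /= g'g]].
rewrite /inverse_pair /=; apply/andP; split; apply/eqP.
  by rewrite -polyend_compA (polyend_compA g) gg' polyend_1comp.
by rewrite -polyend_compA (polyend_compA f') f'f polyend_1comp.
Qed.

Definition polyaut_one : polyaut k n := Sub (idp, idp) polyaut_one_proof.
Definition polyaut_inv (g : polyaut k n) : polyaut k n :=
  Sub _ (polyaut_inv_proof g).
Definition polyaut_mul (f g : polyaut k n) : polyaut k n :=
  Sub _ (polyaut_mul_proof f g).

Lemma polyaut_mulA : associative polyaut_mul.
Proof. by move=> f g h; apply: val_inj; rewrite /= !polyend_compA. Qed.

Lemma polyaut_mul1 : right_id polyaut_one polyaut_mul.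
Proof.
move=> f; apply: val_inj; rewrite /= polyend_comp1 polyend_1comp.
by case: (\val f).
Qed.

Lemma polyaut_1mul : left_id polyaut_one polyaut_mul.
Proof.
move=> f; apply: val_inj; rewrite /= polyend_comp1 polyend_1comp.
by case: (\val f).
Qed.

Lemma polyaut_mulV : right_inverse polyaut_one polyaut_inv polyaut_mul.
Proof.
by move=> f; apply: val_inj => /=; case: f => [[f f'] /= /andP[/eqP /= -> _]].
Qed.

Lemma polyaut_mulVl : left_inverse polyaut_one polyaut_inv polyaut_mul.
Proof.
by move=> f; apply: val_inj => /=; case: f => [[f f'] /= /andP[_ /eqP /= ->]].
Qed.

HB.instance Definition _ := isGroup.Build (polyaut k n)
  polyaut_mulA polyaut_1mul polyaut_mul1 polyaut_mulVl polyaut_mulV.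

End PolyautGroup.

Definition polyaut_jac (k : fieldType) (n : nat) (g : polyaut k n) :
  {mpoly k[n]} := \det (\matrix_(i, j) (tnth (polyaut_map g) i)^`M(j)).

Definition polyaut_star (k : fieldType) (n : nat) : set (polyaut k n) :=
  [set g | polyaut_jac g = 1].
Arguments polyaut_star {k n}.

Definition GL_aut (k : fieldType) (n : nat) : set (polyaut k n) :=
  [set g | exists2 A : 'M[k]_n, A \in unitmx &
    forall i, tnth (polyaut_map g) i = \sum_j A i j *: 'X_j].
Arguments GL_aut {k n}.

Definition SL_aut (k : fieldType) (n : nat) : set (polyaut k n) :=
  GL_aut `&` polyaut_star.
Arguments SL_aut {k n}.

Definition diag_aut (k : fieldType) (n : nat) : set (polyaut k n) :=
  [set g | exists2 t : 'I_n -> k, (forall i, t i != 0) &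
    forall i, tnth (polyaut_map g) i = t i *: 'X_i].
Arguments diag_aut {k n}.

Definition diag_aut_star (k : fieldType) (n : nat) : set (polyaut k n) :=
  diag_aut `&` polyaut_star.
Arguments diag_aut_star {k n}.

(* A space with functions: the structure sheaf is given through its germs, that
   is, [regular_at x f] means that [f] is regular on a neighbourhood of [x], and
   the values of [f] away from [x] are irrelevant. The remaining properties of
   sheaves of [k]-algebras hold for varieties, which are locally affine. *)
HB.mixin Record hasRegular (k : fieldType) T & Topological T := {
  regular_at : T -> set (T -> k);
  regular_at_local : forall (x : T) (f g : T -> k),
    (\forall y \near x, f y = g y) -> regular_at x f -> regular_at x g
}.

#[short(type="spaceType")]
HB.structure Definition Space (k : fieldType) :=
  {T of Topological T & hasRegular k T}.

Definition is_morphism (k : fieldType) (X Y : spaceType k) (f : X -> Y) : Prop :=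
  continuous f /\
  forall (x : X) (s : Y -> k), regular_at (f x) s -> regular_at x (s \o f).

Definition is_isomorphism (k : fieldType) (X Y : spaceType k) (f : X -> Y) :
    Prop :=
  is_morphism f /\
  exists g : Y -> X, [/\ cancel f g, cancel g f & is_morphism g].

(* Affine space: the Zariski topology is generated by the principal open sets,
   and the regular functions are locally quotients of polynomials. *)
Definition affine (k : fieldType) (n : nat) : Type := 'I_n -> k.

HB.instance Definition _ (k : fieldType) (n : nat) := Choice.on (affine k n).
HB.instance Definition _ (k : fieldType) (n : nat) :=
  @isSubBaseTopological.Build (affine k n) (set (affine k n))
    [set [set x : affine k n | p.@[x] != 0] | p in [set: {mpoly k[n]}]] id.

Definition affine_regular_at (k : fieldType) (n : nat) (x : affine k n) :
    set (affine k n -> k) :=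
  [set f | exists p q : {mpoly k[n]},
    q.@[x] != 0 /\ \forall y \near x, f y = p.@[y] / q.@[y]].

Lemma affine_regular_at_local (k : fieldType) (n : nat) (x : affine k n)
    (f g : affine k n -> k) :
  (\forall y \near x, f y = g y) ->
  affine_regular_at x f -> affine_regular_at x g.
Proof.
move=> fg [p [q [qx fpq]]]; exists p, q; split=> //.
by apply: filterS2 fg fpq => y <-.
Qed.

HB.instance Definition _ (k : fieldType) (n : nat) :=
  hasRegular.Build k (affine k n) (@affine_regular_at_local k n).

(* A subset with the induced structure; its topology is the one that the
   library puts on [set_type A]. *)
Definition sub_regular_at (k : fieldType) (X : spaceType k) (A : set X)
    (x : A) : set (A -> k) :=
  [set f | exists2 g : X -> k, regular_at (val x) g &
    \forall y \near x, f y = g (val y)].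

Lemma sub_regular_at_local (k : fieldType) (X : spaceType k) (A : set X)
    (x : A) (f g : A -> k) :
  (\forall y \near x, f y = g y) -> sub_regular_at x f -> sub_regular_at x g.
Proof.
move=> fg [h hx fh]; exists h => //.
by apply: filterS2 fg fh => y <-.
Qed.

HB.instance Definition _ (k : fieldType) (X : spaceType k) (A : set X) :=
  hasRegular.Build k (set_type A) (@sub_regular_at_local k X A).

(* The product in the category of spaces with functions. Its topology is finer
   than the product topology in general, so that it cannot be put on [X * Y]. *)
Definition vprod (X Y : Type) : Type := (X * Y)%type.

Definition sum_tensor (k : fieldType) (X Y : Type) (r : nat)
    (f : 'I_r -> X -> k) (g : 'I_r -> Y -> k) (z : vprod X Y) : k :=
  \sum_(i < r) f i z.1 * g i z.2.

Definition vprod_subbase (k : fieldType) (X Y : spaceType k) :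
    set (set (vprod X Y)) :=
  [set W | exists (U : set X) (V : set Y) (r : nat)
      (f : 'I_r -> X -> k) (g : 'I_r -> Y -> k),
    [/\ open U, open V,
        forall i x, U x -> regular_at x (f i),
        forall i y, V y -> regular_at y (g i) &
        W = [set z | [/\ U z.1, V z.2 & sum_tensor f g z != 0]]]].

HB.instance Definition _ (k : fieldType) (X Y : spaceType k) :=
  Choice.copy (vprod X Y) (X * Y)%type.
HB.instance Definition _ (k : fieldType) (X Y : spaceType k) :=
  @isSubBaseTopological.Build (vprod X Y) (set (vprod X Y))
    (@vprod_subbase k X Y) id.

Definition vprod_regular_at (k : fieldType) (X Y : spaceType k)
    (z : vprod X Y) : set (vprod X Y -> k) :=
  [set h | exists (r s : nat) (f : 'I_r -> X -> k) (g : 'I_r -> Y -> k)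
      (f' : 'I_s -> X -> k) (g' : 'I_s -> Y -> k),
    [/\ forall i, regular_at z.1 (f i) /\ regular_at z.2 (g i),
        forall j, regular_at z.1 (f' j) /\ regular_at z.2 (g' j),
        sum_tensor f' g' z != 0 &
        \forall w \near z, h w = sum_tensor f g w / sum_tensor f' g' w]].

Lemma vprod_regular_at_local (k : fieldType) (X Y : spaceType k)
    (z : vprod X Y) (f g : vprod X Y -> k) :
  (\forall w \near z, f w = g w) ->
  vprod_regular_at z f -> vprod_regular_at z g.
Proof.
move=> fg [r [s [f1 [g1 [f2 [g2 [R1 R2 nz fE]]]]]]].
exists r, s, f1, g1, f2, g2; split=> //.
by apply: filterS2 fg fE => w <-.
Qed.

HB.instance Definition _ (k : fieldType) (X Y : spaceType k) :=
  hasRegular.Build k (vprod X Y) (@vprod_regular_at_local k X Y).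

Definition is_affine_variety (k : fieldType) (X : spaceType k) : Prop :=
  exists (m : nat) (Z : set (affine k m)),
    closed Z /\ exists f : X -> Z, is_isomorphism f.

(* A finite cover by open affine subvarieties, and separatedness. Neither
   affineness nor irreducibility is required of an algebraic group. *)
Definition is_variety (k : fieldType) (X : spaceType k) : Prop :=
  (exists (r : nat) (U : 'I_r -> set X),
    [/\ forall i, open (U i),
        \bigcup_i U i = setT &
        forall i, is_affine_variety (U i : spaceType k)]) /\
  closed [set z : vprod X X | z.1 = z.2].

HB.mixin Record isAlgGroup (k : fieldType) T & Space k T & Group T := {
  alg_group_variety : is_variety (T : spaceType k);
  alg_group_mulM : is_morphism (fun z : vprod T T => (z.1 * z.2)%g : T);
  alg_group_invM : is_morphism (fun x : T => (x^-1)%g)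
}.

#[short(type="algGroupType")]
HB.structure Definition AlgGroup (k : fieldType) :=
  {T of Space k T & Group T & isAlgGroup k T}.

Definition polyaut_act (k : fieldType) (n : nat) (g : polyaut k n)
  (a : affine k n) : affine k n := fun i => (tnth (polyaut_map g) i).@[a].

Record algSubgroup (k : fieldType) (n : nat) := AlgSubgroup {
  alg_source : algGroupType k;
  alg_hom : {multiplicative alg_source -> polyaut k n};
  alg_actionM : is_morphism
    (fun z : vprod alg_source (affine k n) =>
       polyaut_act (alg_hom z.1) z.2 : affine k n)
}.

Definition alg_image (k : fieldType) (n : nat) (G : algSubgroup k n) :
  set (polyaut k n) := range (alg_hom G).

(* The image [G] of [H -> Aut A^n] as an algebraic group in its own right: it is
   the quotient of [H] by the kernel, hence it has the quotient topology, and its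
   regular functions are those that become regular on [H]. *)
Record algpt (k : fieldType) (n : nat) (G : algSubgroup k n) := AlgPt {
  algpt_val : polyaut k n;
  _ : algpt_val \in alg_image G
}.

HB.instance Definition _ (k : fieldType) (n : nat) (G : algSubgroup k n) :=
  [isSub for @algpt_val k n G].
HB.instance Definition _ (k : fieldType) (n : nat) (G : algSubgroup k n) :=
  [Choice of algpt G by <:].

Section AlgSubgroup.
Context (k : fieldType) (n : nat) (G : algSubgroup k n).

Lemma alg_image_group_closed : group_closed [pred g | g \in alg_image G].
Proof.
have h1 : alg_hom G 1%g = 1%g.
  by apply: (mulgI (alg_hom G 1%g)); rewrite -gmulfM !mulg1.
have hV x : alg_hom G (x^-1)%g = ((alg_hom G x)^-1)%g.
  by apply: (mulgI (alg_hom G x)); rewrite -gmulfM !mulgV.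
have memE g : (g \in [pred g | g \in alg_image G]) = (g \in alg_image G) by [].
split=> [|x y]; rewrite !memE; first by apply/mem_set; exists 1%g.
move=> /set_mem[a _ <-] /set_mem[b _ <-]; apply/mem_set.
by exists (a * b^-1)%g => //; rewrite gmulfM hV.
Qed.

HB.instance Definition _ := SubChoice_isSubGroup.Build (polyaut k n) _ (algpt G)
  alg_image_group_closed.

Definition alg_proj (x : alg_source G) : algpt G :=
  AlgPt (mem_set (imageT (alg_hom G) x)).

Definition algpt_open : set (set (algpt G)) :=
  [set U | open (alg_proj @^-1` U)].

Lemma algpt_openT : algpt_open setT.
Proof. exact: openT. Qed.

Lemma algpt_openI : setI_closed algpt_open.
Proof. by move=> U V; exact: openI. Qed.

Lemma algpt_open_bigU (I : Type) (U : I -> set (algpt G)) :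
  (forall i, algpt_open (U i)) -> algpt_open (\bigcup_i U i).
Proof. by move=> Uo; apply: bigcup_open => i _; exact: Uo. Qed.

HB.instance Definition _ := isOpenTopological.Build (algpt G)
  algpt_openT algpt_openI algpt_open_bigU.

Lemma alg_proj_continuous : continuous alg_proj.
Proof. by apply/continuousP. Qed.

Definition algpt_regular_at (y : algpt G) : set (algpt G -> k) :=
  [set f : algpt G -> k | \forall z \near y,
    forall x, alg_proj x = z -> regular_at x (f \o alg_proj)].

Lemma algpt_regular_at_local (y : algpt G) (f g : algpt G -> k) :
  (\forall z \near y, f z = g z) -> algpt_regular_at y f ->
  algpt_regular_at y g.
Proof.
move=> /near_join fg fy; apply: filterS2 fg fy => z fgz freg x xz.
apply: regular_at_local (freg x xz).
by rewrite -xz in fgz; exact: (alg_proj_continuous fgz).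
Qed.

HB.instance Definition _ :=
  hasRegular.Build k (algpt G) algpt_regular_at_local.

End AlgSubgroup.

Definition irreducible (X : topologicalType) (A : set X) : Prop :=
  A !=set0 /\
  forall B C : set X, closed B -> closed C ->
    A `<=` B `|` C -> A `<=` B \/ A `<=` C.

Definition has_chain (X : topologicalType) (d : nat) : Prop :=
  exists Z : nat -> set X,
    (forall i, (i <= d)%N -> closed (Z i) /\ irreducible (Z i)) /\
    (forall i, (i < d)%N -> Z i `<` Z i.+1).

Definition has_krull_dim (X : topologicalType) (d : nat) : Prop :=
  has_chain X d /\ ~ has_chain X d.+1.

Definition id_component (k : fieldType) (n : nat) (G : algSubgroup k n) :
  set (algpt G) := connected_component setT (1%g : algpt G).
Arguments id_component {k n} G _.

Definition id_component_image (k : fieldType) (n : nat)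
  (G : algSubgroup k n) : set (polyaut k n) := val @` id_component G.

Definition Gm_set (k : fieldType) (r : nat) : set (affine k r) :=
  [set t | forall i, t i != 0].
Arguments Gm_set k r _ : clear implicits.

(* [f] is an isomorphism of algebraic groups from the [r]-th power of the
   multiplicative group (with its coordinatewise product) onto [T]. *)
Definition is_torus (k : fieldType) (n : nat) (G : algSubgroup k n)
    (T : set (algpt G)) : Prop :=
  exists (r : nat) (f : Gm_set k r -> T), is_isomorphism f /\
    forall s t u : Gm_set k r, (forall i, val u i = val s i * val t i) ->
      val (f u) = (val (f s) * val (f t))%g.

Definition conj_by (k : fieldType) (n : nat) (g : polyaut k n)
  (A : set (polyaut k n)) : set (polyaut k n) :=
  [set (g * x * g^-1)%g | x in A].

(* Main.v *)
(* The polynomial ring [A] is graded by the characters of the torus [T = G^0]: the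
   coordinates of the action are regular functions of the group element, hence
   Laurent polynomials along each cocharacter, and near [1] their degrees as
   polynomials in the [x_i] are bounded. A dimension count gives
   [n <= rank T + 1]. It then suffices to find generators [y_1, ..., y_n] of [A]
   that are homogeneous and whose linear span is [G]-stable.
   If all invariants of [T] are constant, the homogeneous elements of non-zero
   weight vanish at one point [a], fixed by [G]. Homogeneous elements whose
   gradients at [a] form a basis generate [A] by Nakayama's lemma, and averaging
   over [G / T] makes their span [G]-stable.
   Otherwise the invariants are [k[w]] for a non-constant invariant [w] of least
   degree. At most one [w - b] is reducible: two of them would give an identity
   [p p' - q q' = 1] between homogeneous elements of non-zero weight, and the
   Koszul and de Rham complexes forbid it. After a translation [G] acts on [w] by
   scalars and only [w] itself may be reducible. Call a homogeneous irreducible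
   element special if it is associate to no [w - a] with [a <> 0]. Up to scalars
   there are at most [n] special elements, by counting monomials in them; they
   generate [A], and [G] permutes them up to scalars. *)
From HB Require Import structures.
Require Import Defs.
From mathcomp Require Import all_boot all_order all_algebra.
From mathcomp Require Import boolp classical_sets topology.
From mathcomp Require Import mpoly.
From mathcomp Require Import zify ring finmap.

Set Implicit Arguments.
Unset Strict Implicit.
Unset Printing Implicit Defensive.

Import GRing.Theory Order.TTheory Num.Theory.
Local Open Scope ring_scope.

(** * Unique factorization in polynomial rings *)

(** The dimension of [G] enters through a chain of irreducible closed sets: translated into the
    identity component it becomes a chain of prime ideals in a polynomial ring in [r] variables, so
    its length is at most the rank [r] of the torus. All dimension counts are elementary: a
    polynomial with [msize] at most [D] is determined by its values at [D ^ n] grid points. The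
    bound [n <= r + 1] matters because [r] independent weights use up [r] of the [n] dimensions; the
    little room left makes two homogeneous elements of equal weight proportional over the ring of
    invariants. The identity excluded by the de Rham argument would give a generic one-parameter
    subgroup of the torus without fixed point: its vector field [E] would satisfy
    [\sum a * E g = 1]. In the unimodular case, the characters of the torus on the new coordinates
    have product 1, because the Jacobian is 1. All but the first of them already separate the points
    of the torus, so they form an isogeny onto a torus of rank [n - 1], which is surjective over a
    closed field; hence the equality with the diagonal group. *)

Section Divisibility.
Context {R : idomainType}.
Implicit Types a b c p : R.

Definition dvdr a b := exists c, b = c * a.
Definition irred a := [/\ a != 0, a \isn't a GRing.unit &
  forall b c, a = b * c -> b \is a GRing.unit \/ c \is a GRing.unit].
Definition primer a := [/\ a != 0, a \isn't a GRing.unit &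
  forall b c, dvdr a (b * c) -> dvdr a b \/ dvdr a c].

Lemma dvdr_refl a : dvdr a a. Proof. by exists 1; rewrite mul1r. Qed.
Lemma dvdr0 a : dvdr a 0. Proof. by exists 0; rewrite mul0r. Qed.
Lemma dvdr_trans b a c : dvdr a b -> dvdr b c -> dvdr a c.
Proof. by case=> x -> [y ->]; exists (y * x); rewrite mulrA. Qed.
Lemma dvdr_mull a b c : dvdr a b -> dvdr a (c * b).
Proof. by case=> x ->; exists (c * x); rewrite mulrA. Qed.
Lemma dvdr_mulr a b c : dvdr a b -> dvdr a (b * c).
Proof. by rewrite mulrC; exact: dvdr_mull. Qed.
Lemma dvdr_add a b c : dvdr a b -> dvdr a c -> dvdr a (b + c).
Proof. by case=> x -> [y ->]; exists (x + y); rewrite mulrDl. Qed.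
Lemma dvdr_sub a b c : dvdr a b -> dvdr a c -> dvdr a (b - c).
Proof. by case=> x -> [y ->]; exists (x - y); rewrite mulrBl. Qed.
Lemma dvdr_sum (I : Type) (s : seq I) (P : pred I) (F : I -> R) a :
  (forall i, P i -> dvdr a (F i)) -> dvdr a (\sum_(i <- s | P i) F i).
Proof. by move=> h; elim/big_ind: _ => //; [exact: dvdr0|exact: dvdr_add]. Qed.

Lemma irred_dvdr a b : irred a -> irred b -> dvdr a b -> dvdr b a.
Proof.
case=> _ na _ [_ _ hb] [c bE]; case: (hb _ _ bE) => [uc|ua].
  by exists c^-1; rewrite bE mulKr.
by rewrite ua in na.
Qed.

Lemma primer_prod a (I : Type) (s : seq I) (P : pred I) (F : I -> R) :
  primer a -> dvdr a (\prod_(i <- s | P i) F i) -> exists2 i, P i & dvdr a (F i).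
Proof.
case=> a0 na pa; elim: s => [|i s IH].
  rewrite big_nil => -[c /esym ca1]; case/negP: na.
  by apply/unitrP; exists c; rewrite [a * c]mulrC ca1.
rewrite big_cons; case: ifP => [Pi /pa[h|/IH//]|_ /IH//].
by exists i.
Qed.

Lemma primerX a b (m : nat) : primer a -> dvdr a (b ^+ m) -> dvdr a b.
Proof.
move=> pa; rewrite -[m]card_ord -prodr_const => /(primer_prod pa)[].
by [].
Qed.

End Divisibility.

(** This property and the next one together are unique factorization. They are kept apart because
    they are reached differently: this one by induction on the degree, the other by Gauss's lemma,
    one variable at a time. *)
Definition atomic (R : idomainType) := forall a : R, a != 0 ->
  exists (u : R) (s : seq R),
    [/\ u \is a GRing.unit, {in s, forall p, irred p} & a = u * \prod_(p <- s) p].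
Definition gauss_dom (R : idomainType) := forall a : R, irred a -> primer a.

Lemma gauss_dom_iso (R S : idomainType) (f : {rmorphism R -> S})
    (g : {rmorphism S -> R}) :
  cancel f g -> cancel g f -> gauss_dom S -> gauss_dom R.
Proof.
move=> fK gK gS a [a0 na ha].
have fu x : (f x \is a GRing.unit) = (x \is a GRing.unit).
  apply/idP/idP => [/(rmorph_unit g)|/(rmorph_unit f)//]; by rewrite fK.
have /gS[_ _ pfa] : irred (f a).
  split; rewrite ?fu //; first by rewrite -(rmorph0 f) (inj_eq (can_inj fK)).
  move=> b c fE; have /ha : a = g b * g c by rewrite -rmorphM -fE fK.
  by rewrite -!fu !gK.
split=> // b c [d bcE].
have /pfa[] : dvdr (f a) (f b * f c) by exists (f d); rewrite -!rmorphM bcE.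
  by case=> e fbE; left; exists (g e); apply: (can_inj fK); rewrite rmorphM gK.
by case=> e fbE; right; exists (g e); apply: (can_inj fK); rewrite rmorphM gK.
Qed.

(** * Gauss's lemma for polynomials in one variable *)

Section Gauss.
Context {R : idomainType}.
Implicit Types (p : R) (f g h : {poly R}).

(** The induction on [size f + size g] works since [p] divides one of the two leading coefficients,
    and the leading term of that factor can then be removed. *)
Lemma primer_polyC p : primer p -> primer p%:P.
Proof.
case=> p0 np pp; split; first by rewrite polyC_eq0.
  by rewrite poly_unitE size_polyC p0 coefC eqxx.
move=> f g; have [N] := ubnP (size f + size g).
elim: N f g => // N IH f g; rewrite ltnS => szN [q fgE].
have [->|f0] := eqVneq f 0; first by left; exact: dvdr0.
have [->|g0] := eqVneq g 0; first by right; exact: dvdr0.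
have wlg (u v : {poly R}) : (size u + size v <= N)%N -> u != 0 ->
    dvdr p%:P (u * v) -> dvdr p (lead_coef u) -> dvdr p%:P u \/ dvdr p%:P v.
  move=> uvN u0 [w uvE] [c lcE].
  have dvl : dvdr p%:P ((lead_coef u)%:P * 'X^((size u).-1)).
    by exists (c%:P * 'X^((size u).-1)); rewrite lcE polyCM mulrAC.
  set u' := u - (lead_coef u)%:P * 'X^((size u).-1).
  have szu' : (size u' < size u)%N.
    rewrite -(prednK (n := size u)) ?size_poly_gt0 // ltnS.
    apply/leq_sizeP => j; rewrite leq_eqVlt => /predU1P[<-|jlt].
      by rewrite coefB coefCM coefXn eqxx mulr1 subrr.
    rewrite coefB coefCM coefXn gtn_eqF // mulr0 subr0 nth_default //.
    by rewrite -(prednK (n := size u)) ?size_poly_gt0.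
  have uE : u = u' + (lead_coef u)%:P * 'X^((size u).-1) by rewrite subrK.
  have : dvdr p%:P (u' * v).
    rewrite mulrBl; apply: dvdr_sub; first by exists w.
    exact: dvdr_mulr.
  case/IH; [by apply: leq_trans uvN; rewrite ltn_add2r| |by right].
  by move=> du'; left; rewrite uE; exact: dvdr_add.
have : dvdr p (lead_coef f * lead_coef g).
  by rewrite -lead_coefM fgE lead_coefM lead_coefC; exists (lead_coef q).
case/pp => [|dg]; first by apply: wlg => //; exists q.
have := wlg g f; rewrite addnC => /(_ szN g0).
by case=> //; [exists q; rewrite mulrC|right|left].
Qed.

Hypotheses (Ratomic : atomic R) (Rgauss : gauss_dom R).

(** The prime factors of [c] are cancelled one at a time against [q] or [m], and [d] collects those
    taken out of [m]. This replaces contents and the passage to the fraction field. *)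
Lemma const_split (c : R) (f q m : {poly R}) : c != 0 -> c%:P * f = q * m ->
  exists (d : R) (q' m' : {poly R}), f = q' * m' /\ m = d%:P * m'.
Proof.
move=> /Ratomic[u [s [uu irs ->]]] {c}.
elim: s irs q m => [|p s IH] irs q m.
  rewrite big_nil mulr1 => E; exists 1, (u^-1%:P * q), m.
  split; last by rewrite mul1r.
  by rewrite -mulrA -E mulrA -polyCM mulVr // mul1r.
have pp : primer p%:P by apply/primer_polyC/Rgauss/irs; rewrite inE eqxx.
rewrite big_cons mulrCA polyCM => E.
have irs' : {in s, forall q : R, irred q}.
  by move=> x xs; apply: irs; rewrite inE xs orbT.
have p0 : p%:P != 0 by case: pp.
have [_ _ hp] := pp.
have /hp[[q1 qE]|[m1 mE]] : dvdr p%:P (q * m).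
  by exists ((u * \prod_(j <- s) j)%:P * f); rewrite -E -mulrA mulrC.
- apply: (IH irs' q1 m); apply: (mulfI p0).
  by rewrite mulrA E qE mulrA (mulrC q1).
- have [|d [q' [m' [-> m1E]]]] := IH irs' q m1.
    by apply: (mulfI p0); rewrite mulrA E mE [RHS]mulrC mulrA.
  by exists (p * d), q', m'; split=> //; rewrite mE m1E polyCM mulrC mulrA.
Qed.

Lemma irred_dvdr_const (c : R) f h : c != 0 -> irred f -> (1 < size f)%N ->
  dvdr f (c%:P * h) -> dvdr f h.
Proof.
move=> c0 irf szf [q E].
have [d [q' [m' [hE fE]]]] := const_split c0 E.
case: (irf) => f0 nf /(_ _ _ fE)[] um.
  by exists (q' * d%:P^-1); rewrite hE fE mulrA mulrVK.
move: szf; have : (size f <= 1)%N.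
  rewrite fE; move: um; rewrite poly_unitE => /andP[/eqP um _].
  apply: leq_trans (size_polyMleq _ _) _; rewrite um addn1.
  exact: size_polyC_leq1.
by rewrite leqNgt => /negbTE ->.
Qed.

(** Euclid's argument without fractions. An element [m] of least size in the ideal of [f] and [g]
    divides both up to constants. As [f] is irreducible, either [f] equals [m] up to constants, and
    divides [g], or [m] is constant, and [f] divides [m * h]. *)
Lemma gauss_dom_poly : gauss_dom {poly R}.
Proof.
move=> f irf; have [szf|szf] := leqP (size f) 1.
  move: irf; rewrite (size1_polyC szf); set c := f`_0 => -[c0 nc hc].
  apply/primer_polyC/Rgauss; split; first by rewrite polyC_eq0 in c0.
    move: nc; rewrite poly_unitE size_polyC -polyC_eq0 c0 /= coefC eqxx.
    by [].
  have cu (x : R) : x%:P \is a GRing.unit -> x \is a GRing.unit.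
    by rewrite poly_unitE coefC eqxx => /andP[].
  move=> a b cE; have [|/cu|/cu] := hc a%:P b%:P; last by right.
    by rewrite cE polyCM.
  by left.
have [f0 nf hf] := irf; split=> // g h [s ghE].
have [->|g0] := eqVneq g 0; first by left; exact: dvdr0.
pose P n := `[< exists a b : {poly R}, a * f + b * g != 0 /\
                  size (a * f + b * g) = n >].
have exP : exists n, P n.
  by exists (size f); apply/asboolP; exists 1, 0; rewrite mul1r mul0r addr0.
case: (ex_minnP exP) => N /asboolP[a [b [m0 mN]]] minN.
set m := _ + _ in m0 mN.
(* The remainder of the pseudo-division of [x] by [m] lies in the same ideal, so that minimality
   makes it zero. *)
have red (x : {poly R}) : (exists a b, x = a * f + b * g) ->
    exists (c : R) (q : {poly R}), c != 0 /\ c%:P * x = q * m.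
  case=> a' [b' xE]; exists (lead_coef m ^+ (scalp x m)), (x %/ m)%R.
  split; first by rewrite expf_neq0 // lead_coef_eq0.
  have E := Pdiv.Idomain.divp_eq x m; move: E.
  set c := _ ^+ _; set q := (x %/ m)%R; set r := (x %% m)%R => E.
  suff /eqP r0 : r == 0 by rewrite mul_polyC E r0 addr0.
  apply/contraT => r0; have : P (size r).
    apply/asboolP; exists (c%:P * a' - q * a), (c%:P * b' - q * b).
    suff -> : (c%:P * a' - q * a) * f + (c%:P * b' - q * b) * g = r by [].
    have -> : r = c *: x - q * m by rewrite E addrC addKr.
    rewrite -mul_polyC xE /m !mulrBl !mulrDr !mulrA opprD addrACA.
    by [].
  by move/minN; rewrite -mN leqNgt ltn_modp m0.
have [|c [q [c0 fE]]] := red f.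
  by exists 1, 0; rewrite mul1r mul0r addr0.
have [|c' [q2 [c'0 gE]]] := red g.
  by exists 0, 1; rewrite mul1r mul0r add0r.
have [d [q' [m' [fE' mE]]]] := const_split c0 fE.
case: (hf _ _ fE') => um.
  left; apply: (irred_dvdr_const c'0 irf szf); rewrite gE mE fE'.
  by exists (q2 * d%:P * q'^-1); rewrite -!mulrA mulKr.
right; have szm : (size m <= 1)%N.
  rewrite mE; move: um; rewrite poly_unitE => /andP[/eqP um _].
  apply: leq_trans (size_polyMleq _ _) _; rewrite um addn1.
  exact: size_polyC_leq1.
have mC := size1_polyC szm.
apply: (@irred_dvdr_const (m`_0)) => //.
  by apply: contraNneq m0 => E; rewrite mC E.
rewrite -mC; exists (a * h + b * s).
by rewrite /m !mulrDl -!mulrA ghE -(mulrC h f).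
Qed.

End Gauss.

(** * Factorization in several variables *)

Section MpolyUFD.
Context {k : fieldType}.

Lemma mpoly_unit_msize n (p : {mpoly k[n]}) :
  (p \is a GRing.unit) = (msize p == 1)%N.
Proof.
apply/idP/msize_poly1P => [/andP[/eqP -> uc]|[c c0 ->]].
  by exists (p@_0%MM) => //; move: uc; rewrite mpolyCK unitfE.
by apply/andP; rewrite mcoeffC eqxx mulr1 eqxx unitfE.
Qed.

Lemma mpoly_atomic n : atomic {mpoly k[n]}.
Proof.
move=> a; have [N] := ubnP (msize a).
elim: N a => // N IH a; rewrite ltnS => szN a0.
have [ua|na] := boolP (a \is a GRing.unit).
  by exists a, [::]; split=> //; rewrite big_nil mulr1.
have [ira|nira] := pselect (irred a).
  exists 1, [:: a]; split; rewrite ?unitr1 //.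
    by move=> p; rewrite inE => /eqP ->.
  by rewrite big_seq1 mul1r.
have [b [c [E nb nc]]] : exists b c, [/\ a = b * c, b \isn't a GRing.unit & c \isn't a GRing.unit].
  apply: contrapT => nex; apply/nira; split=> // b c E.
  apply: contrapT => /not_orP[/negP nb /negP nc].
  by apply: nex; exists b, c.
have b0 : b != 0 by apply: contraNneq a0 => b0; rewrite E b0 mul0r.
have c0 : c != 0 by apply: contraNneq a0 => c0; rewrite E c0 mulr0.
have gt1 (x : {mpoly k[n]}) : x != 0 -> x \isn't a GRing.unit -> (1 < msize x)%N.
  rewrite mpoly_unit_msize -msize_poly_eq0.
  by case: (msize x) => [|[|]].
have sb := gt1 _ b0 nb; have sc := gt1 _ c0 nc.
have := msizeM b0 c0; rewrite -E => szE.
have [|u [s [uu irs bE]]] := IH b _ b0.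
  by move: szN sb sc; rewrite szE; case: (msize b) (msize c) => [|x] [|y] //=; lia.
have [|u' [s' [uu' irs' cE]]] := IH c _ c0.
  by move: szN sb sc; rewrite szE; case: (msize b) (msize c) => [|x] [|y] //=; lia.
exists (u * u'), (s ++ s'); split.
- by rewrite unitrM uu.
- by move=> p; rewrite mem_cat => /orP[/irs|/irs'].
- by rewrite big_cat /= E bE cE mulrACA.
Qed.

Definition mpoly_of_poly n (p : {poly {mpoly k[n]}}) : {mpoly k[n.+1]} :=
  (map_poly (@mwiden n k) p).['X_ord_max].

HB.instance Definition _ n :=
  GRing.RMorphism.copy (@mpoly_of_poly n)
    (horner_eval ('X_ord_max : {mpoly k[n.+1]}) \o map_poly (@mwiden n k)).

Lemma mpoly_rmorph_id n (f : {rmorphism {mpoly k[n]} -> {mpoly k[n]}}) :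
  (forall c, f c%:MP = c%:MP) -> (forall i, f 'X_i = 'X_i) -> f =1 id.
Proof.
move=> fC fX; elim/mpolyind=> [|c m p _ _ IH]; first exact: rmorph0.
rewrite rmorphD IH -mul_mpolyC rmorphM fC mpolyXE_id rmorph_prod.
congr (_ * _ + _); apply: eq_bigr => i _; by rewrite rmorphXn /= fX.
Qed.

End MpolyUFD.

Section MpolyGauss.
Context {k : fieldType}.

Lemma mpoly_of_polyK n : cancel (@mpoly_of_poly k n) (@muni n k).
Proof.
have widenE (q : {mpoly k[n]}) : muni (mwiden q) = q%:P.
  elim/mpolyind: q => [|c m q _ _ IH]; first by rewrite mwiden0 muni0 polyC0.
  rewrite mwidenD muniD IH mwidenZ mwidenX muniZ polyCD; congr (_ + _).
  rewrite -mul_mpolyC polyCM mul_polyC; congr (_ *: _).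
  rewrite muniE msuppX big_seq1 mcoeffX eqxx scale1r mnmwiden_ordmax expr0.
  rewrite -mul_polyC mulr1; congr ('X_[_])%:P.
  by apply/mnmP => i; rewrite mnmE mnmwiden_widen.
have muniX : muni ('X_ord_max : {mpoly k[n.+1]}) = 'X.
  rewrite muniE msuppX big_seq1 mcoeffX eqxx scale1r mnm1E eqxx expr1.
  rewrite (_ : [multinom _ | i < n] = 0%MM) ?mpolyX0 ?scale1r //.
  apply/mnmP => i; rewrite mnmE mnm0E mnm1E -val_eqE /=.
  by rewrite gtn_eqF.
elim/poly_ind => [|p c IH]; first by rewrite !rmorph0.
rewrite rmorphD rmorphM /= /mpoly_of_poly map_polyX map_polyC hornerX hornerC.
by rewrite muniD muniM -/(mpoly_of_poly p) IH muniX widenE.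
Qed.

Lemma muniK n : cancel (@muni n k) (@mpoly_of_poly k n).
Proof.
apply: (mpoly_rmorph_id (f := @mpoly_of_poly k n \o @muni n k)) => [c|i] /=.
  by rewrite muniC /mpoly_of_poly map_polyC hornerC /= mwidenC.
rewrite /= muniE msuppX big_seq1 mcoeffX eqxx scale1r -mul_polyC.
rewrite /mpoly_of_poly rmorphM rmorphXn /= map_polyC map_polyX.
rewrite hornerM hornerXn hornerC /= mwidenX mpolyXn -mpolyXD; congr 'X_[_].
apply/mnmP => j; rewrite mnmDE mulmnE !mnm1E.
have [jlt|jge] := ltnP j n; last first.
  have -> : j = ord_max by apply/val_inj/anti_leq; rewrite jge -ltnS ltn_ord.
  by rewrite mnmwiden_ordmax add0n eqxx mul1n.
have -> : j = widen_ord (leqnSn n) (Ordinal jlt) by exact: val_inj.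
rewrite mnmwiden_widen mnmE mnm1E [ord_max == _]eq_sym.
by rewrite (negbTE (_ : widen_ord _ _ != _)) ?mul0n ?addn0 // -val_eqE /= ltn_eqF.
Qed.

Lemma mpoly_gauss n : gauss_dom {mpoly k[n]}.
Proof.
elim: n => [|n IH].
  move=> a [a0 na _]; case/negP: na; rewrite mpoly_unit_msize.
  apply/msize_poly1P; exists (a@_0%MM); last exact: nvar0_mpolyC.
  by apply: contraNneq a0 => a0; rewrite (nvar0_mpolyC a) a0.
apply: (gauss_dom_iso (@muniK n) (@mpoly_of_polyK n)).
exact: (gauss_dom_poly (@mpoly_atomic k n) IH).
Qed.

End MpolyGauss.

(** * Evaluation, interpolation and noetherianity *)

Lemma mpoly_alg_ind (R : nzRingType) n (P : {mpoly R[n]} -> Prop) :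
  (forall c, P c%:MP) -> (forall i, P 'X_i) ->
  (forall p q, P p -> P q -> P (p + q)) ->
  (forall p q, P p -> P q -> P (p * q)) -> forall p, P p.
Proof.
move=> PC PX PD PM; elim/mpolyind=> [|c m p _ _ IH]; first exact: (PC 0).
apply: (PD) => //; rewrite -mul_mpolyC; apply: (PM) => //.
rewrite mpolyXE_id; apply: big_ind => // [|i _]; first exact: (PC 1).
by elim: (m i) => [|e]; [rewrite expr0; exact: (PC 1)|rewrite exprS; exact: PM].
Qed.

Section Interpolation.
Context {k : fieldType} (char0 : [pchar k] =i pred0).

Lemma char0_natr_inj : injective (fun m : nat => m%:R : k).
Proof.
have h m d : ((m + d)%:R : k) = m%:R -> d = 0%N.
  by rewrite natrD -[RHS]addr0 => /addrI/eqP; rewrite ((pcharf0P _).1 char0) => /eqP.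
move=> a b /= ab; have [le|le] := leqP a b.
  by move: (ab); rewrite -(subnKC le) => /esym/h ->; rewrite addn0.
by move: (ab); rewrite -(subnKC (ltnW le)) => /h ->; rewrite addn0.
Qed.

(** Lagrange interpolation at the integers below [D], which are distinct in characteristic 0. *)
Lemma poly_interp D : exists L : 'I_D -> {poly k}, forall q : {poly k},
  (size q <= D)%N -> q = \sum_(c < D) q.[c%:R] *: L c.
Proof.
pose N (c : 'I_D) : {poly k} := \prod_(j < D | j != c) ('X - (j%:R)%:P).
pose L c : {poly k} := (N c).[c%:R]^-1 *: N c.
have Nn0 (c : 'I_D) : (N c).[c%:R] != 0.
  rewrite horner_prod; apply/prodf_neq0 => j jc.
  rewrite hornerXsubC subr_eq0; apply: contra jc => /eqP/char0_natr_inj/val_inj.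
  by move=> ->.
have Le (c d : 'I_D) : (L c).[d%:R] = (c == d)%:R.
  rewrite hornerZ; have [->|cd] := eqVneq c d; first by rewrite mulVf.
  rewrite [X in _ * X]horner_prod (bigD1 d) /=; last by rewrite eq_sym.
  by rewrite hornerXsubC subrr mul0r mulr0.
have szL c : (size (L c) <= D)%N.
  apply: leq_trans (size_scale_leq _ _) _.
  rewrite /N -big_filter size_prod_XsubC -[X in (_ <= X)%N](card_ord D) cardE.
  rewrite -(count_predC (pred1 c) (enum 'I_D)).
  have -> : count (pred1 c) (enum 'I_D) = 1%N.
    by rewrite count_uniq_mem ?enum_uniq ?mem_enum.
  rewrite size_filter add1n ltnS /index_enum enumT; apply: eq_leq.
  exact: eq_count.
exists L => q szq; apply/eqP; rewrite -subr_eq0; apply/eqP.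
apply: (@roots_geq_poly_eq0 _ _ [seq (i : nat)%:R | i <- iota 0 D]).
- apply/allP => x /mapP[i]; rewrite mem_iota add0n => iD ->.
  rewrite rootE hornerD hornerN horner_sum (bigD1 (Ordinal iD)) //=.
  rewrite hornerZ (Le _ (Ordinal iD)) eqxx mulr1 big1 ?addr0 ?subrr // => j jne.
  by rewrite hornerZ (Le j (Ordinal iD)) (negbTE jne) mulr0.
- by rewrite map_inj_uniq ?iota_uniq //; exact: char0_natr_inj.
- rewrite size_map size_iota; apply: leq_trans (size_polyD _ _) _.
  rewrite size_polyN geq_max szq /=; apply: leq_trans (size_sum _ _ _) _.
  by apply/bigmax_leqP => c _; apply: leq_trans (size_scale_leq _ _) _.
Qed.

(** Products of Lagrange polynomials interpolate on a grid. Besides bounding dimensions, this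
    recovers a family of polynomials of bounded degree from its values at finitely many points, as
    [torus_laurent] requires. *)
Lemma mpoly_interp n D : exists L : {ffun 'I_n -> 'I_D} -> {mpoly k[n]},
  forall p : {mpoly k[n]}, (msize p <= D)%N ->
  p = \sum_(a : {ffun 'I_n -> 'I_D}) p.@[fun i => (a i : nat)%:R] *: L a.
Proof.
have [l lP] := poly_interp D.
pose e (i : 'I_n) (q : {poly k}) : {mpoly k[n]} := (map_poly (@mpolyC n k) q).['X_i].
exists (fun a => \prod_i e i (l (a i))) => p szp.
transitivity (\sum_(a : {ffun 'I_n -> 'I_D}) \sum_(m <- msupp p) (p@_m * \prod_i ((a i : nat)%:R) ^+ m i)
   *: \prod_i e i (l (a i))); last first.
  by apply: eq_bigr => a _; rewrite mevalE scaler_suml.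
rewrite exchange_big {1}(mpolyE p) big_seq [RHS]big_seq; apply: eq_bigr => m.
move=> /msize_mdeg_lt mD.
under eq_bigr do rewrite -scalerA; rewrite -scaler_sumr; congr (_ *: _).
rewrite mpolyXE_id.
transitivity (\prod_i \sum_(c < D) (c%:R ^+ m i : k) *: e i (l c)).
  apply: eq_bigr => i _.
  have /lP : (size ('X^(m i) : {poly k}) <= D)%N.
    rewrite size_polyXn; apply: leq_trans szp; apply: leq_ltn_trans mD.
    by rewrite mdegE (bigD1 i) //= leq_addr.
  move/(congr1 (e i)); rewrite {1}/e map_polyXn hornerXn => ->.
  rewrite /e rmorph_sum horner_sum; apply: eq_bigr => c _ /=.
  by rewrite hornerXn -mul_polyC rmorphM /= map_polyC hornerM hornerC mul_mpolyC.
rewrite (bigA_distr_bigA (fun (i : 'I_n) (c : 'I_D) => (c%:R ^+ m i : k) *: e i (l c))) /=.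
by apply: eq_bigr => a _; rewrite scaler_prod.
Qed.

Lemma mpoly_eval0 n (p : {mpoly k[n]}) :
  (forall a : 'I_n -> nat, p.@[fun i => (a i)%:R] = 0) -> p = 0.
Proof.
move=> h; have [L /(_ _ (leqnn _)) ->] := mpoly_interp n (msize p).
by apply: big1 => a _; rewrite h scale0r.
Qed.

(** Evaluation on the grid embeds the polynomials with [msize] at most [D] into a space of dimension
    [D ^ n]. The bound is crude, but it has the right order of growth in [D]. *)
Lemma mpoly_dep n D (I : finType) (F : I -> {mpoly k[n]}) :
  (forall i, (msize (F i) <= D)%N) -> (D ^ n < #|I|)%N ->
  exists c : I -> k, (exists i, c i != 0) /\ \sum_i c i *: F i = 0.
Proof.
move=> szF cI; have [L LP] := mpoly_interp n D.
pose M := \matrix_(i < #|I|, a < #|{ffun 'I_n -> 'I_D}|)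
  (F (enum_val i)).@[fun j => (enum_val a j : nat)%:R].
have : kermx M != 0.
  rewrite -mxrank_eq0 mxrank_ker -lt0n subn_gt0.
  by apply: leq_ltn_trans (rank_leq_col _) _; rewrite card_ffun !card_ord.
case/rowV0Pn => v /sub_kermxP vM v0; exists (fun i => v 0 (enum_rank i)); split.
  apply: contrapT => h; case/negP: v0; apply/eqP/matrixP => z i; rewrite mxE ord1.
  apply: contrapT => /eqP vi; apply: h; exists (enum_val i); by rewrite enum_valK.
under eq_bigr do rewrite [F _]LP // scaler_sumr.
rewrite exchange_big /= big1 // => a _; under eq_bigr do rewrite scalerA.
rewrite -scaler_suml (reindex (@enum_val I predT)) /=; last first.
  exact/onW_bij/enum_val_bij.
have /matrixP/(_ 0 (enum_rank a)) := vM; rewrite !mxE => vMa.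
rewrite [X in X *: _](_ : _ = 0) ?scale0r // -[RHS]vMa.
by apply: eq_bigr => i _; rewrite mxE enum_valK enum_rankK.
Qed.

End Interpolation.

(** * Derivatives and inverses of polynomial endomorphisms *)

Section Derivatives.
Context {k : fieldType} {n : nat}.
Implicit Types (p q : {mpoly k[n]}).

Lemma mderivXU i j : ('X_i : {mpoly k[n]})^`M(j) = (i == j)%:R%:MP.
Proof.
rewrite mderivX mnm1E; have [->|_] := eqVneq i j; last by rewrite scale0r mpolyC0.
by rewrite scale1r -{1}[U_(j)%MM]add0m addmK mpolyX0.
Qed.

Lemma mderiv_comp p m (y : n.-tuple {mpoly k[m]}) j :
  (p \mPo y)^`M(j) = \sum_i (p^`M(i) \mPo y) * (tnth y i)^`M(j).
Proof.
elim/mpoly_alg_ind: p => [c|l|p q IHp IHq|p q IHp IHq].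
- rewrite comp_mpolyC mderivC big1 // => i _.
  by rewrite mderivC comp_mpoly0 mul0r.
- rewrite comp_mpolyXU -tnth_nth (bigD1 l) //= big1 ?addr0 => [|i il].
    by rewrite mderivX mnm1E eqxx scale1r -{1}[U_(l)%MM]add0m addmK mpolyX0 comp_mpoly1 mul1r.
  by rewrite mderivX mnm1E eq_sym (negbTE il) scale0r comp_mpoly0 mul0r.
- rewrite comp_mpolyD mderivD IHp IHq -big_split /=; apply: eq_bigr => i _.
  by rewrite mderivD comp_mpolyD mulrDl.
- rewrite rmorphM /= mderivM IHp IHq mulr_suml mulr_sumr -big_split /=.
  apply: eq_bigr => i _; rewrite mderivM rmorphD !rmorphM /= mulrDl.
  by rewrite mulrAC mulrA.
Qed.

Lemma msize_mderiv p i : (msize p^`M(i) <= (msize p).-1)%N.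
Proof.
rewrite msizeE; apply/bigmax_leqP_seq => m; rewrite mcoeff_msupp mcoeff_deriv.
move=> h _; have : (m + U_(i))%MM \in msupp p.
  by rewrite mcoeff_msupp; apply: contraNneq h => ->; rewrite mul0rn.
by move/msize_mdeg_lt; rewrite mdegD mdeg1; case: (msize p) => // N; lia.
Qed.

Hypothesis char0 : [pchar k] =i pred0.

Lemma mderiv_eq0 p : (forall i, p^`M(i) = 0) -> p = (p@_0%MM)%:MP.
Proof.
move=> h; apply/mpolyP => m; rewrite mcoeffC.
have [->|m0] := eqVneq m 0%MM; first by rewrite mulr1.
rewrite mulr0; have [i mi] : exists i, m i != 0%N.
  apply: contrapT => nex; case/negP: m0; apply/eqP/mnmP => i; rewrite mnm0E.
  by apply: contrapT => /eqP mi; apply: nex; exists i.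
have := h i => /(congr1 (mcoeff (m - U_(i))%MM)).
rewrite mcoeff0 mcoeff_deriv submK ?lep1mP // -mulr_natr => /eqP.
by rewrite mulf_eq0 ((pcharf0P _).1 char0) orbF => /eqP.
Qed.

(** By the chain rule the Jacobian matrix of [y] is invertible. Hence the derivatives of a
    polynomial killed by substituting [y] are killed too, and by induction on the degree the
    substitution is injective in characteristic 0. It maps [(tnth y i \mPo z) - 'X_i] to 0. *)
Lemma polyend_left_inverse (y z : polyend k n) :
  polyend_comp z y = polyend_id -> polyend_comp y z = polyend_id.
Proof.
move=> zy.
pose J : 'M[{mpoly k[n]}]_n := \matrix_(i, j) (tnth y i)^`M(j).
pose K : 'M[{mpoly k[n]}]_n := \matrix_(l, i) ((tnth z l)^`M(i) \mPo y).
have KJ : K *m J = 1%:M.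
  apply/matrixP => l j; rewrite !mxE.
  have /(congr1 (fun w => (tnth w l)^`M(j))) := zy.
  rewrite !tnth_mktuple mderiv_comp => E.
  under eq_bigr do rewrite !mxE; rewrite E mderivX mnm1E.
  have [->|lj] := eqVneq l j; first by rewrite scale1r -{1}[U_(j)%MM]add0m addmK mpolyX0.
  by rewrite scale0r.
have inj (R : {mpoly k[n]}) : R \mPo y = 0 -> R = 0.
  have [N] := ubnP (msize R); elim: N R => // N IH R; rewrite ltnS => szR Ry.
  suff dR i : R^`M(i) = 0.
    by move: Ry; rewrite (mderiv_eq0 dR) comp_mpolyC.
  have [R0|R0] := eqVneq R 0; first by rewrite R0 mderiv0.
  apply: IH.
    apply: leq_ltn_trans (msize_mderiv _ _) _; move: szR R0.
    by rewrite -msize_poly_eq0; case: (msize R).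
  pose v : 'rV[{mpoly k[n]}]_n := \row_i (R^`M(i) \mPo y).
  have vJ : v *m J = 0.
    apply/matrixP => a j; rewrite !mxE; under eq_bigr do rewrite !mxE.
    by rewrite -mderiv_comp Ry mderiv0.
  have : v = 0 by rewrite -(mulmx1 v) -(mulmx1C KJ) mulmxA vJ mul0mx.
  by move/matrixP/(_ 0 i); rewrite !mxE.
apply: eq_from_tnth => i; rewrite !tnth_mktuple; apply/eqP.
rewrite -subr_eq0; apply/eqP/inj; rewrite raddfB /= comp_mpolyA zy.
by rewrite comp_mpoly_id comp_mpolyXU -tnth_nth subrr.
Qed.

End Derivatives.

(** * The ascending chain condition *)

Section Noetherian.

Lemma nat_nondecr_subseq (g : nat -> nat) : exists s : nat -> nat,
  {homo s : i j / (i < j)%N} /\ {homo (g \o s) : i j / (i <= j)%N}.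
Proof.
(* Take for [j] a place where [g] is least among the indices beyond [i]. *)
have step i : exists j, (i < j)%N /\ forall l, (j <= l)%N -> (g j <= g l)%N.
  have exP : exists v, `[< exists j, (i < j)%N /\ g j = v >].
    by exists (g i.+1); apply/asboolP; exists i.+1.
  case: (ex_minnP exP) => v /asboolP[j [ij gj]] minv; exists j; split=> // l jl.
  rewrite gj; apply: minv; apply/asboolP; exists l; split=> //.
  exact: leq_trans jl.
have [h hP] := choice step.
pose s := fix s n := if n is m.+1 then h (s m) else h 0%N.
have sinc : {homo s : i j / (i < j)%N}.
  by apply: (homo_ltn ltn_trans) => i /=; have [] := hP (s i).
exists s; split=> //; apply: (homo_leq leqnn leq_trans) => i /=.
have le : (s i <= h (s i))%N by apply: ltnW; have [] := hP (s i).
by case: i le => [|i] le; [have [_] := hP 0%N|have [_] := hP (s i)]; exact.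
Qed.

Lemma dickson n (f : nat -> 'X_{1..n}) : exists i j, (i < j)%N /\ (f i <= f j)%MM.
Proof.
have [s [sinc smon]] : exists s : nat -> nat, {homo s : i j / (i < j)%N} /\
    forall l, {homo (fun i => f (s i) l) : i j / (i <= j)%N}.
  suff : forall ls : seq 'I_n, exists s : nat -> nat, {homo s : i j / (i < j)%N} /\
      {in ls, forall l, {homo (fun i => f (s i) l) : i j / (i <= j)%N}}.
    case/(_ (enum 'I_n)) => s [sinc smon]; exists s; split=> // l.
    by apply: smon; rewrite mem_enum.
  elim=> [|l ls [s [sinc smon]]]; first by exists id; split.
  have [t [tinc tmon]] := nat_nondecr_subseq (fun i => f (s i) l).
  exists (s \o t); split=> [i j /tinc/sinc//|l']; rewrite inE => /predU1P[->//|l's].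
  move=> i j ij; apply: (smon l' l's).
  by move: ij; rewrite leq_eqVlt => /predU1P[->//|/tinc/ltnW].
exists (s 0%N), (s 1%N); split; first exact: sinc.
by apply/mnm_lepP => l; exact: smon.
Qed.

Context {k : fieldType} {n : nat}.
Local Notation A := {mpoly k[n]}.

Definition is_ideal (I : A -> Prop) :=
  I 0 /\ forall a p q, I p -> I q -> I (a * p + q).

(** In a strictly increasing chain choose [p j] in [I j.+1] outside [I j] with least leading
    monomial. By Dickson's lemma the leading monomial of some [p i] divides that of a later [p j];
    subtracting a multiple of [p i], which is in [I j], from [p j] contradicts the choice. *)
Lemma mpoly_acc (I : nat -> A -> Prop) : (forall j, is_ideal (I j)) ->
  (forall j p, I j p -> I j.+1 p) -> exists j, forall p, I j.+1 p -> I j p.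
Proof.
move=> idI incI; apply: contrapT => nex.
have ex j : exists p, I j.+1 p /\ ~ I j p.
  apply: contrapT => h; apply: nex; exists j => p Ip.
  by apply: contrapT => nIp; apply: h; exists p.
have mono i j p : (i <= j)%N -> I i p -> I j p.
  by move=> /subnKC <-; elim: (j - i)%N => [|d IH]; rewrite ?addn0 // addnS => /IH/incI.
have exmin j : exists p, [/\ I j.+1 p, ~ I j p &
    forall q, I j.+1 q -> ~ I j q -> ~ (mlead q < mlead p)%O].
  have [p0 [Ip0 nIp0]] := ex j.
  have : exists p, [/\ I j.+1 p, ~ I j p & mlead p = mlead p0] by exists p0.
  elim/(well_founded_ind (@ltom_wf n)): (mlead p0) => m IH [p [Ip nIp pm]].
  have [h|h] := pselect (exists q, [/\ I j.+1 q, ~ I j q & (mlead q < m)%O]).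
    case: h => q [Iq nIq qm]; apply: (IH _ qm); by exists q.
  exists p; split=> // q Iq nIq; rewrite pm => qm; by apply: h; exists q.
have [p pP] := choice exmin.
have [i [j [ij le]]] := dickson (fun i => mlead (p i)).
have [Ipi nIpi _] := pP i; have [Ipj nIpj minj] := pP j.
have pi0 : p i != 0 by apply: contra_notN nIpi => /eqP ->; case: (idI i).
pose u := (mlead (p j) - mlead (p i))%MM.
pose c := (p j)@_(mlead (p j)) / (p i)@_(mlead (p i)).
pose q := p j - (c *: 'X_[u]) * p i.
have Iji : I j (p i) by apply: (mono i.+1).
have Ij0 : I j 0 by case: (idI j).
have [_ idj] := idI j; have [_ idj1] := idI j.+1.
have pjE : p j = (c *: 'X_[u]) * p i + q by rewrite addrC subrK.
have nIq : ~ I j q by move=> Iq; apply: nIpj; rewrite pjE; exact: idj.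
have pj0 : p j != 0 by apply: contra_notN nIpj => /eqP ->.
have Iq : I j.+1 q.
  rewrite /q addrC -mulNr; apply: idj1 => //; exact: incI.
apply: (minj q Iq nIq).
have q0 : q != 0 by apply: contra_notN nIq => /eqP ->.
have uE : (u + mlead (p i))%MM = mlead (p j) by rewrite submK.
have cn0 : c != 0 by rewrite mulf_neq0 ?invr_eq0 ?mleadc_eq0.
have mE : mlead (c *: 'X_[u] * p i) = mlead (p j).
  rewrite mleadM ?mleadZ ?mleadXm ?uE //.
  by rewrite scaler_eq0 negb_or cn0 -msupp_eq0 msuppX.
have le2 : (mlead q <= mlead (p j))%O.
  by apply: Order.POrderTheory.le_trans (mleadB_le _ _) _; rewrite mE joinxx.
rewrite Order.POrderTheory.lt_neqAle le2 andbT; apply/eqP => E.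
have cE : (c *: 'X_[u] * p i)@_(mlead (p j)) = (p j)@_(mlead (p j)).
  rewrite -{1}uE -scalerAl mcoeffZ ['X_[u] * _]mulrC mcoeffMX.
  by rewrite /c mulrVK // unitfE mleadc_eq0.
by have := q0; rewrite -mleadc_eq0 E mcoeffB cE subrr eqxx.
Qed.

End Noetherian.

(** * Differential forms *)

Section Forms.
Context {k : fieldType} (char0 : [pchar k] =i pred0) {n : nat}.
Local Notation A := {mpoly k[n]}.
(* The form [w] stands for the sum of the [w S dx_S]. *)
Local Notation form := {ffun {set 'I_n} -> A}.
Implicit Types (f g : A) (w v : form) (S : {set 'I_n}).

Definition fscale f w : form := [ffun S : {set 'I_n} => f * w S].
(** The number of transpositions that bring [dx_i] from the front to its place in the ordered
    product [dx_S]. *)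
Definition below (i : 'I_n) S := #|[set j in S | (j < i)%N]|.
Definition wedge_dx i w : form :=
  [ffun S : {set 'I_n} => if i \in S then (-1) ^+ below i S * w (S :\ i) else 0].
Definition contract_dx i w : form :=
  [ffun S : {set 'I_n} => if i \in S then 0 else (-1) ^+ below i S * w (i |: S)].
Definition fderiv i w : form := [ffun S : {set 'I_n} => (w S)^`M(i)].
Definition fdiff w : form := \sum_i wedge_dx i (fderiv i w).
Definition contract (E : 'I_n -> A) w : form :=
  \sum_i fscale (E i) (contract_dx i w).
Definition vfield (E : 'I_n -> A) f : A := \sum_i E i * f^`M(i).
(** With Cartan's formula as definition, the Lie derivative commutes with [fdiff] and [contract] as
    soon as both square to zero. *)
Definition lie E w := fdiff (contract E w) + contract E (fdiff w).
Definition form1 : form := [ffun S : {set 'I_n} => (S == finset.set0)%:R].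

Lemma belowD1 i j S : i != j -> j \in S -> below i S = (below i (S :\ j) + (j < i))%N.
Proof.
move=> ij jS; rewrite /below; case: ltnP => ji.
  rewrite (cardsD1 j) !inE jS ji addnC; congr (_ + _)%N.
  by apply: eq_card => l; rewrite !inE andbA.
rewrite addn0; apply: eq_card => l; rewrite !inE.
by have [->|] := eqVneq l j; rewrite //= ltnNge ji andbF.
Qed.

Lemma belowU1 i j S : i != j -> j \notin S -> below i (j |: S) = (below i S + (j < i))%N.
Proof.
move=> ij jS; rewrite (belowD1 (j := j)) ?finset.setU11 //.
by congr (below _ _ + _)%N; rewrite finset.setU1K.
Qed.

Lemma below_self i S : below i (S :\ i) = below i S.
Proof.
by apply: eq_card => l; rewrite !inE; have [->|] := eqVneq l i; rewrite //= ltnn andbF.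
Qed.
Lemma below_selfU i S : below i (i |: S) = below i S.
Proof.
by apply: eq_card => l; rewrite !inE; have [->|] := eqVneq l i; rewrite //= ltnn andbF.
Qed.

Lemma lt_ord_swap (i j : 'I_n) : i != j -> (j < i)%N = ~~ (i < j)%N.
Proof. by rewrite -val_eqE /= => ij; lia. Qed.

(** Removing [j] from [S] lowers [below i S] precisely when [j < i]. Exactly one of [j < i] and
    [i < j] holds, so the two orders differ by one sign. *)
Lemma wedge_dxC i j w : wedge_dx i (wedge_dx j w) = - wedge_dx j (wedge_dx i w).
Proof.
apply/ffunP => S; rewrite !ffunE.
have [->|ij] := eqVneq i j.
  by case: ifP => _; rewrite ?oppr0 // !inE eqxx mulr0 oppr0.
rewrite !inE ij eq_sym ij /=; have [iS|] := boolP (i \in S); last first.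
  by rewrite mulr0; case: ifP; rewrite oppr0.
have [jS|] := boolP (j \in S); last by rewrite mulr0 oppr0.
rewrite !mulrA -!exprD -mulNr finset.setDDl finset.setUC -finset.setDDl; congr (_ * _).
rewrite (belowD1 (i := i) (j := j) (S := S)) //.
rewrite (belowD1 (i := j) (j := i) (S := S)) 1?eq_sym //.
rewrite (lt_ord_swap ij); case: ltnP => _ /=; rewrite !addn0 ?addn1.
  by rewrite ?(addSn, addnS) !exprS !mulN1r ?opprK addnC.
  by rewrite ?(addSn, addnS) !exprS !mulN1r ?opprK addnC.
Qed.

Lemma contract_dxC i j w :
  contract_dx i (contract_dx j w) = - contract_dx j (contract_dx i w).
Proof.
apply/ffunP => S; rewrite !ffunE.
have [->|ij] := eqVneq i j.
  by case: ifP => _; rewrite ?oppr0 // !inE eqxx mulr0 oppr0.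
rewrite !inE (negbTE ij) eq_sym (negbTE ij) /=.
have [iS|iS] := boolP (i \in S); first by case: ifP => //; rewrite ?mulr0 oppr0.
have [jS|jS] := boolP (j \in S); first by rewrite mulr0 oppr0.
rewrite !mulrA -!exprD -mulNr finset.setUCA; congr (_ * _).
rewrite (belowU1 (i := j) (j := i) (S := S)) 1?eq_sym //.
rewrite (belowU1 (i := i) (j := j) (S := S)) //.
rewrite (lt_ord_swap ij); case: ltnP => _ /=; rewrite !addn0 ?addn1.
  by rewrite ?(addSn, addnS) !exprS !mulN1r ?opprK addnC.
  by rewrite ?(addSn, addnS) !exprS !mulN1r ?opprK addnC.
Qed.

Lemma contract_wedge i j w :
  contract_dx i (wedge_dx j w) + wedge_dx j (contract_dx i w) =
  if i == j then w else 0.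
Proof.
apply/ffunP => S; rewrite !ffunE [RHS](fun_if (fun u : form => u S)) ffunE.
have [<-|ij] := eqVneq i j.
  rewrite !inE eqxx /=; have [iS|iS] := boolP (i \in S).
    by rewrite add0r mulrA -exprD below_self finset.setD1K // addnn -mul2n exprM sqrrN expr1n expr1n mul1r.
  by rewrite addr0 mulrA -exprD below_selfU finset.setU1K // addnn -mul2n exprM sqrrN expr1n expr1n mul1r.
rewrite !inE (negbTE ij) eq_sym (negbTE ij) /=.
have [iS|iS] := boolP (i \in S); first by case: ifP => _; rewrite ?mulr0 addr0.
have [jS|jS] := boolP (j \in S); last by rewrite mulr0 addr0.
rewrite !mulrA -!exprD (_ : (i |: S) :\ j = i |: (S :\ j)); last first.
  apply/setP => l; rewrite !inE; have [->|//] := eqVneq l i.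
  by rewrite ij.
rewrite -mulrDl (belowU1 (i := j) (j := i)) 1?eq_sym // (belowD1 (i := i) (j := j)) //.
rewrite (lt_ord_swap ij); case: ltnP => _ /=; rewrite !addn0 ?addn1.
  by rewrite addnS exprS mulN1r addnC addNr mul0r.
by rewrite addSn exprS mulN1r [(below j S + _)%N]addnC addNr mul0r.
Qed.

Lemma fscaleDr f w v : fscale f (w + v) = fscale f w + fscale f v.
Proof. by apply/ffunP => S; rewrite !ffunE mulrDr. Qed.
Lemma fscaleDl f g w : fscale (f + g) w = fscale f w + fscale g w.
Proof. by apply/ffunP => S; rewrite !ffunE mulrDl. Qed.
Lemma fscaleA f g w : fscale f (fscale g w) = fscale (f * g) w.
Proof. by apply/ffunP => S; rewrite !ffunE mulrA. Qed.
Lemma fscale0r f : fscale f 0 = 0.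
Proof. by apply/ffunP => S; rewrite !ffunE mulr0. Qed.
Lemma fscale0l w : fscale 0 w = 0.
Proof. by apply/ffunP => S; rewrite !ffunE mul0r. Qed.
Lemma fscale1 w : fscale 1 w = w.
Proof. by apply/ffunP => S; rewrite !ffunE mul1r. Qed.
Lemma fscaleNr f w : fscale f (- w) = - fscale f w.
Proof. by apply/ffunP => S; rewrite !ffunE mulrN. Qed.
Lemma fscaleNl f w : fscale (- f) w = - fscale f w.
Proof. by apply/ffunP => S; rewrite !ffunE mulNr. Qed.
Lemma fscale_sumr f (I : Type) (r : seq I) (P : pred I) (F : I -> form) :
  fscale f (\sum_(i <- r | P i) F i) = \sum_(i <- r | P i) fscale f (F i).
Proof. exact: (big_morph (fscale f) (fscaleDr f) (fscale0r f)). Qed.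
Lemma fscale_suml w (I : Type) (r : seq I) (P : pred I) (F : I -> A) :
  fscale (\sum_(i <- r | P i) F i) w = \sum_(i <- r | P i) fscale (F i) w.
Proof. exact: (big_morph (fscale^~ w) (fun f g => fscaleDl f g w) (fscale0l w)). Qed.

Lemma wedge_dxD i w v : wedge_dx i (w + v) = wedge_dx i w + wedge_dx i v.
Proof. by apply/ffunP => S; rewrite !ffunE; case: ifP; rewrite ?addr0 ?mulrDr. Qed.
Lemma wedge_dx0 i : wedge_dx i 0 = 0.
Proof. by apply/ffunP => S; rewrite !ffunE; case: ifP; rewrite ?mulr0. Qed.
Lemma wedge_dx_scale i f w : wedge_dx i (fscale f w) = fscale f (wedge_dx i w).
Proof. by apply/ffunP => S; rewrite !ffunE; case: ifP; rewrite ?mulr0 // mulrCA. Qed.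
Lemma wedge_dx_sum i (I : Type) (r : seq I) (P : pred I) (F : I -> form) :
  wedge_dx i (\sum_(j <- r | P j) F j) = \sum_(j <- r | P j) wedge_dx i (F j).
Proof. exact: (big_morph (wedge_dx i) (wedge_dxD i) (wedge_dx0 i)). Qed.

Lemma contract_dxD i w v : contract_dx i (w + v) = contract_dx i w + contract_dx i v.
Proof. by apply/ffunP => S; rewrite !ffunE; case: ifP; rewrite ?addr0 ?mulrDr. Qed.
Lemma contract_dx0 i : contract_dx i 0 = 0.
Proof. by apply/ffunP => S; rewrite !ffunE; case: ifP; rewrite ?mulr0. Qed.
Lemma contract_dx_scale i f w : contract_dx i (fscale f w) = fscale f (contract_dx i w).
Proof. by apply/ffunP => S; rewrite !ffunE; case: ifP; rewrite ?mulr0 // mulrCA. Qed.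
Lemma contract_dx_sum i (I : Type) (r : seq I) (P : pred I) (F : I -> form) :
  contract_dx i (\sum_(j <- r | P j) F j) = \sum_(j <- r | P j) contract_dx i (F j).
Proof. exact: (big_morph (contract_dx i) (contract_dxD i) (contract_dx0 i)). Qed.

Lemma fderivD i w v : fderiv i (w + v) = fderiv i w + fderiv i v.
Proof. by apply/ffunP => S; rewrite !ffunE mderivD. Qed.
Lemma fderiv_scale i f w :
  fderiv i (fscale f w) = fscale f^`M(i) w + fscale f (fderiv i w).
Proof. by apply/ffunP => S; rewrite !ffunE mderivM. Qed.
Lemma fderiv_wedge i j w : fderiv i (wedge_dx j w) = wedge_dx j (fderiv i w).
Proof.
apply/ffunP => S; rewrite !ffunE; case: ifP => _; last by rewrite mderiv0.
by rewrite -signr_odd; case: odd; rewrite ?expr1 ?mulN1r ?mderivN // expr0 !mul1r.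
Qed.

Lemma fdiffD w v : fdiff (w + v) = fdiff w + fdiff v.
Proof.
by rewrite /fdiff -big_split; apply: eq_bigr => i _; rewrite fderivD wedge_dxD.
Qed.
Lemma fdiff0 : fdiff 0 = 0.
Proof. by apply: (addrI (fdiff 0)); rewrite -fdiffD !addr0. Qed.
Lemma fdiffN w : fdiff (- w) = - fdiff w.
Proof. by apply: (addrI (fdiff w)); rewrite -fdiffD !subrr fdiff0. Qed.
Lemma fdiffB w v : fdiff (w - v) = fdiff w - fdiff v.
Proof. by rewrite fdiffD fdiffN. Qed.

Lemma contractD E w v : contract E (w + v) = contract E w + contract E v.
Proof.
rewrite /contract -big_split; apply: eq_bigr => i _.
by rewrite contract_dxD fscaleDr.
Qed.
Lemma contract0 E : contract E 0 = 0.
Proof. by apply: (addrI (contract E 0)); rewrite -contractD !addr0. Qed.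
Lemma contractN E w : contract E (- w) = - contract E w.
Proof. by apply: (addrI (contract E w)); rewrite -contractD !subrr contract0. Qed.
Lemma contractB E w v : contract E (w - v) = contract E w - contract E v.
Proof. by rewrite contractD contractN. Qed.
Lemma contract_scale E f w : contract E (fscale f w) = fscale f (contract E w).
Proof.
rewrite /contract fscale_sumr; apply: eq_bigr => i _.
by rewrite contract_dx_scale !fscaleA mulrC.
Qed.

Lemma form_double0 w : w = - w -> w = 0.
Proof.
move=> /eqP; rewrite -addr_eq0 => /eqP/ffunP ww; apply/ffunP => S.
have := ww S; rewrite !ffunE -mulr2n -scaler_nat => /eqP.
by rewrite scaler_eq0 ((pcharf0P _).1 char0) => /eqP.
Qed.

(** Second derivatives are symmetric and [dx_i], [dx_j] anticommute, so that exchanging the two sums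
    gives the opposite form; 2 is invertible. *)
Lemma fdiff_fdiff w : fdiff (fdiff w) = 0.
Proof.
apply: form_double0; rewrite /fdiff.
under eq_bigr => i _.
  rewrite (big_morph (fderiv i) (fderivD i) (id1 := 0) (op1 := +%R)); last first.
    by apply/ffunP => S; rewrite !ffunE mderiv0.
  rewrite wedge_dx_sum.
  over.
rewrite {1}exchange_big -sumrN /=; apply: eq_bigr => i _; rewrite -sumrN.
apply: eq_bigr => j _; rewrite !fderiv_wedge wedge_dxC; congr (- wedge_dx _ (wedge_dx _ _)).
by apply/ffunP => S; rewrite !ffunE mderiv_comm.
Qed.

Lemma contract_contract E w : contract E (contract E w) = 0.
Proof.
apply: form_double0; rewrite /contract.
under eq_bigr => i _ do rewrite contract_dx_sum fscale_sumr.
rewrite {1}exchange_big -sumrN /=; apply: eq_bigr => i _; rewrite -sumrN.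
apply: eq_bigr => j _; rewrite !contract_dx_scale !fscaleA contract_dxC fscaleNr.
by rewrite mulrC.
Qed.

(* [fwedge f w] is [df /\ w]. *)
Definition fwedge f w := fdiff (fscale f w) - fscale f (fdiff w).

Lemma fwedgeE f w : fwedge f w = \sum_i fscale f^`M(i) (wedge_dx i w).
Proof.
rewrite /fwedge /fdiff fscale_sumr -sumrB; apply: eq_bigr => i _.
by rewrite fderiv_scale wedge_dxD !wedge_dx_scale addrK.
Qed.

Lemma fwedgeX i w : fwedge 'X_i w = wedge_dx i w.
Proof.
rewrite fwedgeE (bigD1 i) //= big1 ?addr0 => [|j ji].
  by rewrite mderivX mnm1E eqxx scale1r -{1}[U_(i)%MM]add0m addmK mpolyX0 fscale1.
by rewrite mderivX mnm1E eq_sym (negbTE ji) scale0r fscale0l.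
Qed.

Lemma contract_fwedge E f w :
  contract E (fwedge f w) + fwedge f (contract E w) = fscale (vfield E f) w.
Proof.
rewrite !fwedgeE /contract; under eq_bigr do rewrite contract_dx_sum fscale_sumr.
under [X in _ + X]eq_bigr do rewrite wedge_dx_sum fscale_sumr.
rewrite [X in _ + X]exchange_big -big_split /= fscale_suml; apply: eq_bigr => i _.
rewrite -big_split (bigD1 i) //= big1 ?addr0 => [|j ji].
  rewrite contract_dx_scale wedge_dx_scale !fscaleA mulrC -fscaleDr.
  by rewrite contract_wedge eqxx.
rewrite contract_dx_scale wedge_dx_scale !fscaleA mulrC -fscaleDr.
by rewrite contract_wedge eq_sym (negbTE ji) fscale0r.
Qed.

Lemma lieD E w v : lie E (w + v) = lie E w + lie E v.
Proof. by rewrite /lie contractD !fdiffD contractD addrACA. Qed.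
Lemma lie0 E : lie E 0 = 0.
Proof. by apply: (addrI (lie E 0)); rewrite -lieD !addr0. Qed.
Lemma lieN E w : lie E (- w) = - lie E w.
Proof. by apply: (addrI (lie E w)); rewrite -lieD !subrr lie0. Qed.
Lemma lieB E w v : lie E (w - v) = lie E w - lie E v.
Proof. by rewrite lieD lieN. Qed.
Lemma lie_sum E (I : Type) (r : seq I) (P : pred I) (F : I -> form) :
  lie E (\sum_(j <- r | P j) F j) = \sum_(j <- r | P j) lie E (F j).
Proof. exact: (big_morph (lie E) (lieD E) (lie0 E)). Qed.
Lemma lie_fdiff E w : lie E (fdiff w) = fdiff (lie E w).
Proof.
by rewrite /lie fdiffD !fdiff_fdiff contract0 addr0 add0r.
Qed.
Lemma lie_contract E w : lie E (contract E w) = contract E (lie E w).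
Proof.
by rewrite /lie contractD !contract_contract fdiff0 add0r addr0.
Qed.
Lemma lie_scale E f w :
  lie E (fscale f w) = fscale (vfield E f) w + fscale f (lie E w).
Proof.
have dE g v : fdiff (fscale g v) = fwedge g v + fscale g (fdiff v).
  by rewrite /fwedge subrK.
rewrite /lie contract_scale !dE contractD contract_scale fscaleDr addrACA.
by rewrite [X in X + _]addrC contract_fwedge.
Qed.

Definition lie_eigen E (c : k) w := lie E w = fscale c%:MP w.

Lemma lie_eigen_scale E c d f w : vfield E f = c *: f -> lie_eigen E d w ->
  lie_eigen E (c + d) (fscale f w).
Proof.
move=> fc wd; rewrite /lie_eigen lie_scale fc wd !fscaleA -fscaleDl; congr fscale.
by rewrite mpolyCD mulrDl mul_mpolyC [f * _]mulrC.
Qed.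

Lemma fdiff_cst c w : fdiff (fscale c%:MP w) = fscale c%:MP (fdiff w).
Proof.
rewrite -[LHS](subrK (fscale c%:MP (fdiff w))) -/(fwedge _ _) fwedgeE big1 ?add0r //.
by move=> i _; rewrite mderivC fscale0l.
Qed.

Lemma lie_eigen_fdiff E c w : lie_eigen E c w -> lie_eigen E c (fdiff w).
Proof. by rewrite /lie_eigen lie_fdiff => ->; rewrite fdiff_cst. Qed.

Lemma lie_eigenB E c w v : lie_eigen E c w -> lie_eigen E c v -> lie_eigen E c (w - v).
Proof. by rewrite /lie_eigen lieB => -> ->; rewrite fscaleDr fscaleNr. Qed.

Lemma lie_eigen_fwedge E c d f w : vfield E f = c *: f -> lie_eigen E d w ->
  lie_eigen E (c + d) (fwedge f w).
Proof.
move=> fc wd; apply: lie_eigenB; first exact/lie_eigen_fdiff/lie_eigen_scale.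
exact/lie_eigen_scale/lie_eigen_fdiff.
Qed.

Lemma fdiff_form1 : fdiff form1 = 0.
Proof.
rewrite /fdiff big1 // => i _; rewrite (_ : fderiv i form1 = 0) ?wedge_dx0 //.
by apply/ffunP => S; rewrite !ffunE -mpolyC_nat mderivC.
Qed.

Lemma contract_form1 E : contract E form1 = 0.
Proof.
rewrite /contract big1 // => i _; rewrite (_ : contract_dx i form1 = 0) ?fscale0r //.
apply/ffunP => S; rewrite !ffunE; case: ifP => // _.
by rewrite (_ : (_ == _) = false) ?mulr0 //; apply/negbTE/set0Pn; exists i; rewrite finset.setU11.
Qed.

Lemma lie_form1 E : lie E form1 = 0.
Proof. by rewrite /lie fdiff_form1 contract_form1 contract0 fdiff0 addr0. Qed.

(** A filtration, in which forms may have mixed degrees. Lower bounds are enough to see that a form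
    vanishes once its degree exceeds [n]. *)
Definition deg_ge p w := forall S, (#|S| < p)%N -> w S = 0.

Lemma deg_geB p w v : deg_ge p w -> deg_ge p v -> deg_ge p (w - v).
Proof. by move=> hw hv S Sp; rewrite !ffunE hw // hv // subr0. Qed.
Lemma deg_geN p w : deg_ge p w -> deg_ge p (- w).
Proof. by move=> hw S Sp; rewrite !ffunE hw // oppr0. Qed.
Lemma deg_ge_sum p (I : Type) (r : seq I) (P : pred I) (F : I -> form) :
  (forall i, P i -> deg_ge p (F i)) -> deg_ge p (\sum_(i <- r | P i) F i).
Proof.
move=> h S Sp; rewrite sum_ffunE big1 // => i Pi; exact: h.
Qed.
Lemma deg_ge_scale p f w : deg_ge p w -> deg_ge p (fscale f w).
Proof. by move=> hw S Sp; rewrite ffunE hw // mulr0. Qed.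
Lemma deg_ge_wedge p i w : deg_ge p w -> deg_ge p.+1 (wedge_dx i w).
Proof.
move=> hw S Sp; rewrite ffunE; case: ifP => // iS; rewrite hw ?mulr0 //.
by move: Sp; rewrite (cardsD1 i) iS.
Qed.
Lemma deg_ge_fdiff p w : deg_ge p w -> deg_ge p.+1 (fdiff w).
Proof.
move=> hw; apply: deg_ge_sum => i _; apply: deg_ge_wedge => S Sp.
by rewrite ffunE hw // mderiv0.
Qed.
Lemma deg_ge_fwedge p f w : deg_ge p w -> deg_ge p.+1 (fwedge f w).
Proof.
move=> hw; rewrite fwedgeE; apply: deg_ge_sum => i _.
exact/deg_ge_scale/deg_ge_wedge.
Qed.
Lemma deg_ge_contract p E w : deg_ge p.+1 w -> deg_ge p (contract E w).
Proof.
move=> hw; apply: deg_ge_sum => i _; apply: deg_ge_scale => S Sp.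
rewrite ffunE; case: ifP => // iS; rewrite hw ?mulr0 // cardsU1 iS.
by rewrite add1n ltnS.
Qed.
Lemma deg_ge_lie p E w : deg_ge p w -> deg_ge p (lie E w).
Proof.
move=> hw; case: p hw => [_ S //|p hw].
rewrite -[lie E w]opprK opprD; apply/deg_geN/deg_geB.
  exact/deg_geN/deg_ge_fdiff/deg_ge_contract.
exact/deg_ge_contract/deg_ge_fdiff.
Qed.
Lemma deg_ge_eq0 w : deg_ge n.+1 w -> w = 0.
Proof.
move=> hw; apply/ffunP => S; rewrite hw ?ffunE // ltnS.
by rewrite -[X in (_ <= X)%N](card_ord n) max_card.
Qed.

Definition basis_form S0 : form := [ffun S : {set 'I_n} => (S == S0)%:R].

Lemma form_basis w : w = \sum_S fscale (w S) (basis_form S).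
Proof.
apply/ffunP => S; rewrite sum_ffunE (bigD1 S) //= !ffunE eqxx mulr1.
by rewrite big1 ?addr0 // => T TS; rewrite !ffunE eq_sym (negbTE TS) mulr0.
Qed.

Lemma basis_form_wedge i S : i \in S ->
  basis_form S = fscale ((-1) ^+ below i S) (wedge_dx i (basis_form (S :\ i))).
Proof.
move=> iS; apply/ffunP => T; rewrite !ffunE; have [->|TS] := eqVneq T S.
  by rewrite iS eqxx mulr1 -exprD addnn -mul2n exprM sqrrN !expr1n.
case: ifP => iT; last by rewrite mulr0.
rewrite (_ : (T :\ i == _) = false) ?mulr0 //.
apply/negbTE; apply: contra TS => /eqP E.
by rewrite -(finset.setD1K iT) -(finset.setD1K iS) E.
Qed.

Lemma basis_form_ind (P : form -> Prop) : P form1 ->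
  (forall i w, P w -> P (wedge_dx i w)) ->
  (forall w, P w -> P (- w)) -> forall S, P (basis_form S).
Proof.
move=> P1 Pw PN S; have [m] := ubnP #|S|; elim: m S => // m IH S; rewrite ltnS => Sm.
have [->|[i iS]] := set_0Vmem S; first exact: P1.
rewrite (basis_form_wedge iS).
have /IH/(Pw i) : (#|S :\ i| < m)%N by move: Sm; rewrite (cardsD1 i) iS.
rewrite -signr_odd; case: odd; rewrite ?expr0 ?fscale1 // expr1 fscaleNl fscale1.
exact: PN.
Qed.

Definition euler : 'I_n -> A := fun i => 'X_i.

Lemma vfield_euler m : vfield euler 'X_[m] = (mdeg m)%:R *: 'X_[m].
Proof.
rewrite /vfield mdegE natr_sum scaler_suml; apply: eq_bigr => i _.
rewrite mderivX -scalerAr -mpolyXD.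
have [->|mi] := eqVneq (m i) 0%N; first by rewrite !scale0r.
by rewrite addmC submK // lep1mP.
Qed.

Lemma vfield_eulerX i : vfield euler 'X_i = 1 *: 'X_i.
Proof. by rewrite vfield_euler mdeg1. Qed.

Lemma lie_euler_basis S : lie_eigen euler #|S|%:R (basis_form S).
Proof.
have [m] := ubnP #|S|; elim: m S => // m IH S; rewrite ltnS => Sm.
have [->|[i iS]] := set_0Vmem S.
  by rewrite cards0 /lie_eigen (_ : basis_form _ = form1) // lie_form1 mpolyC0 fscale0l.
have /IH h : (#|S :\ i| < m)%N by move: Sm; rewrite (cardsD1 i) iS.
rewrite (basis_form_wedge iS) (cardsD1 i) iS natrD -[1%:R + _]add0r.
apply: lie_eigen_scale.
  rewrite scale0r /vfield big1 // => j _.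
  by rewrite -signr_odd; case: odd; rewrite ?expr0 ?expr1 ?mderivN -mpolyC1 mderivC ?oppr0 mulr0.
by rewrite -fwedgeX; apply: lie_eigen_fwedge => //; exact: vfield_eulerX.
Qed.

Lemma lie_euler_coeff w S m :
  ((lie euler w) S)@_m = (mdeg m + #|S|)%:R * (w S)@_m.
Proof.
rewrite {1}(form_basis w) lie_sum sum_ffunE raddf_sum /= (bigD1 S) //=.
have h T f : lie euler (fscale f (basis_form T)) =
    \sum_(l <- msupp f) fscale ((f@_l * (mdeg l + #|T|)%:R) *: 'X_[l]) (basis_form T).
  rewrite {1}[f]mpolyE fscale_suml lie_sum; apply: eq_bigr => l _.
  have E : vfield euler (f@_l *: 'X_[l]) = (mdeg l)%:R *: (f@_l *: 'X_[l]).
    rewrite scalerA mulrC -scalerA -vfield_euler /vfield scaler_sumr.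
    by apply: eq_bigr => i _; rewrite mderivZ scalerAr.
  rewrite (lie_eigen_scale E (lie_euler_basis T)) fscaleA; congr fscale.
  by rewrite mul_mpolyC scalerA -natrD mulrC.
rewrite [X in _ + X]big1 ?addr0 => [|T TS]; last first.
  rewrite h sum_ffunE raddf_sum big1 //= => l _.
  by rewrite !ffunE eq_sym (negbTE TS) mulr0 mcoeff0.
rewrite h sum_ffunE raddf_sum /=.
transitivity (\sum_(l <- msupp (w S)) ((w S)@_l * (mdeg l + #|S|)%:R) * (l == m)%:R).
  by apply: eq_bigr => l _; rewrite !ffunE eqxx mulr1 mcoeffZ mcoeffX.
have [ms|ms] := boolP (m \in msupp (w S)); last first.
  rewrite (memN_msupp_eq0 ms) mulr0 big_seq big1 // => l ls.
  by rewrite (_ : (l == m) = false) ?mulr0 //; apply: contraNF ms => /eqP <-.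
rewrite (bigD1_seq m) ?msupp_uniq //= eqxx mulr1 mulrC big1 ?addr0 // => l.
by move/negbTE ->; rewrite mulr0.
Qed.

(** The Lie derivative along the Euler field multiplies a coefficient by its total degree, which is
    positive here. Dividing by it gives [u] with [lie euler u = w]; injectivity in positive degree
    shows [u] closed, and Cartan's formula makes [contract euler u] a primitive. *)
Lemma poincare p w : deg_ge p.+1 w -> fdiff w = 0 ->
  exists2 v, deg_ge p v & fdiff v = w.
Proof.
move=> wp dw.
pose u : form := [ffun S : {set 'I_n} => \sum_(m <- msupp (w S))
   ((w S)@_m / (mdeg m + #|S|)%:R) *: 'X_[m]].
have up : deg_ge p.+1 u by move=> S Sp; rewrite ffunE wp // msupp0 big_nil.
have nz (S : {set 'I_n}) m : (0 < #|S|)%N -> ((mdeg m + #|S|)%:R != 0 :> k).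
  by move=> S0; rewrite ((pcharf0P _).1 char0) addn_eq0 negb_and -!lt0n S0 orbT.
have uE : lie euler u = w.
  apply/ffunP => S; have [S0|S0] := posnP #|S|.
    by rewrite wp ?S0 //; apply: (deg_ge_lie (p := p.+1)); rewrite ?S0.
  apply/mpolyP => m; rewrite lie_euler_coeff ffunE raddf_sum /=.
  under eq_bigr do rewrite mcoeffZ mcoeffX.
  have [ms|ms] := boolP (m \in msupp (w S)); last first.
    rewrite (memN_msupp_eq0 ms) big_seq big1 ?mulr0 // => l ls.
    by rewrite (_ : (l == m) = false) ?mulr0 //; apply: contraNF ms => /eqP <-.
  rewrite (bigD1_seq m) ?msupp_uniq //= eqxx mulr1 big1 ?addr0 => [|l]; last first.
    by move/negbTE ->; rewrite mulr0.
  by rewrite mulrC mulfVK // nz.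
have du : fdiff u = 0.
  have E : lie euler (fdiff u) = 0 by rewrite lie_fdiff uE.
  apply/ffunP => S; have [S0|S0] := posnP #|S|.
    by rewrite (deg_ge_fdiff up) ?ffunE // S0.
  apply/mpolyP => m; have := lie_euler_coeff (fdiff u) S m.
  rewrite E ffunE mcoeff0 => /esym/eqP; rewrite mulf_eq0 (negbTE (nz _ _ _ S0)).
  by move/eqP.
exists (contract euler u); first exact: deg_ge_contract.
by rewrite -[RHS]uE /lie du contract0 addr0.
Qed.

End Forms.

(** Finite sums of elements satisfying [P]; with eigenvectors for [P], this states that an operator
    is diagonalizable without naming its eigenspaces. *)
Inductive sum_of (V : zmodType) (P : V -> Prop) : V -> Prop :=
| sum_of0 : sum_of P 0
| sum_ofD x y : P x -> sum_of P y -> sum_of P (x + y).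

Lemma sum_of1 (V : zmodType) (P : V -> Prop) x : P x -> sum_of P x.
Proof. by move=> Px; rewrite -[x]addr0; apply: sum_ofD => //; exact: sum_of0. Qed.

Lemma sum_of_add (V : zmodType) (P : V -> Prop) x y :
  sum_of P x -> sum_of P y -> sum_of P (x + y).
Proof.
move=> hx hy; elim: hx => [|u v Pu _ IH]; first by rewrite add0r.
by rewrite -addrA; exact: sum_ofD.
Qed.

Lemma sum_of_sum (V : zmodType) (P : V -> Prop) (I : Type) (r : seq I)
    (Q : pred I) (F : I -> V) :
  (forall i, Q i -> sum_of P (F i)) -> sum_of P (\sum_(i <- r | Q i) F i).
Proof.
by move=> h; elim/big_ind: _ => //; [exact: sum_of0|exact: sum_of_add].
Qed.

Lemma sum_of_morph (V W : zmodType) (P : V -> Prop) (Q : W -> Prop) (f : V -> W) :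
  f 0 = 0 -> (forall x y, f (x + y) = f x + f y) ->
  (forall x, P x -> sum_of Q (f x)) -> forall x, sum_of P x -> sum_of Q (f x).
Proof.
move=> f0 fD fP x; elim=> [|u v Pu _ IH]; first by rewrite f0; exact: sum_of0.
by rewrite fD; apply: sum_of_add => //; exact: fP.
Qed.

(** * De Rham theory of a diagonalizable derivation *)

Section FixedPoint.
Context {k : fieldType} (char0 : [pchar k] =i pred0) {n : nat}.
Local Notation A := {mpoly k[n]}.
Local Notation form := {ffun {set 'I_n} -> A}.
Context (E : 'I_n -> A).
Hypothesis diagE : forall f : A,
  sum_of (fun g => exists c : k, vfield E g = c *: g) f.

Local Notation lie_diag := (sum_of (fun w : form => exists c : k, lie_eigen E c w)).

Lemma lie_diag_scale f w : lie_diag w -> lie_diag (fscale f w).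
Proof.
move=> hw; elim: (diagE f) => [|g h [c gE] _ IH].
  by rewrite fscale0l; exact: sum_of0.
rewrite fscaleDl; apply: sum_of_add => //.
apply: (sum_of_morph (P := fun w : form => exists c : k, lie_eigen E c w)) hw.
- exact: fscale0r.
- exact: fscaleDr.
- move=> x [d xE]; apply: sum_of1; exists (c + d); exact: lie_eigen_scale.
Qed.

Lemma lie_diag_fdiff w : lie_diag w -> lie_diag (fdiff w).
Proof.
apply: sum_of_morph; [exact: fdiff0|exact: fdiffD|move=> x [d xE]].
by apply: sum_of1; exists d; exact: lie_eigen_fdiff.
Qed.

Lemma lie_diagN w : lie_diag w -> lie_diag (- w).
Proof. by move=> h; rewrite -[w]fscale1 -fscaleNl; exact: lie_diag_scale. Qed.

(** The forms are generated from [form1] by [fdiff] and multiplication by functions, and both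
    operations respect sums of eigenforms. *)
Lemma lie_diag_all w : lie_diag w.
Proof.
rewrite (form_basis w); apply: sum_of_sum => S _; apply: lie_diag_scale.
apply: (@basis_form_ind k n lie_diag) => [|i v hv|]; last exact: lie_diagN.
  by apply: sum_of1; exists 0; rewrite /lie_eigen lie_form1 // mpolyC0 fscale0l.
rewrite -fwedgeX; apply: sum_of_add; first exact/lie_diag_fdiff/lie_diag_scale.
exact/lie_diagN/lie_diag_scale/lie_diag_fdiff.
Qed.

(** A sum of eigenforms with the number of terms displayed, for the induction in
    [lie0_primitive_aux]. *)
Fixpoint lie_sum_n (m : nat) (w : form) : Prop :=
  if m is m'.+1 then exists c x y, [/\ lie_eigen E c x, lie_sum_n m' y & w = x + y]
  else w = 0.

Lemma lie_sum_n_all w : exists m, lie_sum_n m w.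
Proof.
elim: (lie_diag_all w) => [|x y [c xE] _ [m IH]]; first by exists 0%N.
by exists m.+1, c, x, y.
Qed.

Lemma lie_cst c w : lie E (fscale c%:MP w) = fscale c%:MP (lie E w).
Proof.
rewrite lie_scale (_ : vfield E _ = 0) ?fscale0l ?add0r // /vfield big1 // => i _.
by rewrite mderivC mulr0.
Qed.

Lemma lie_sum_n_shift m (c : k) w :
  lie_sum_n m w -> lie_sum_n m (w - fscale c%:MP (lie E w)).
Proof.
elim: m w => [|m IH] w /=; first by move=> ->; rewrite lie0 fscale0r subr0.
case=> d [x [y [xE ym ->]]].
exists d, (x - fscale c%:MP (lie E x)), (y - fscale c%:MP (lie E y)); split.
- apply: lie_eigenB => //; rewrite xE /lie_eigen lie_cst lie_cst xE.
  by rewrite !fscaleA [c%:MP * d%:MP]mulrC.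
- exact: IH.
- by rewrite lieD fscaleDr opprD addrACA.
Qed.

(** The operator [1 - c^-1 * lie E] removes from a primitive its part of weight [c != 0]. It does
    not change the differential, since [lie E] commutes with [fdiff] and kills [w]. The parts of
    weight 0 are collected in [v0]. *)
Lemma lie0_primitive_aux p m w v v0 : lie E w = 0 -> lie E v0 = 0 ->
  deg_ge p (v0 + v) -> fdiff (v0 + v) = w -> lie_sum_n m v ->
  exists2 u, deg_ge p u & fdiff u = w /\ lie E u = 0.
Proof.
move=> w0; elim: m v v0 => [|m IH] v v0 Lv0 vp dv /=.
  move=> v_0; exists (v0 + v); first exact: vp.
  by split; [exact: dv|rewrite v_0 addr0; exact: Lv0].
case=> c [x [y [xE ym vE]]]; have [c0|c0] := eqVneq c 0.
  have xE0 : lie E x = 0 by rewrite xE c0 mpolyC0 fscale0l.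
  apply: (IH y (v0 + x)); first by rewrite lieD Lv0 xE0 addr0.
  - by rewrite -addrA -vE; exact: vp.
  - by rewrite -addrA -vE; exact: dv.
  - exact: ym.
have E1 : v0 + (y - fscale c^-1%:MP (lie E y)) =
    v0 + v - fscale c^-1%:MP (lie E (v0 + v)).
  rewrite lieD Lv0 add0r vE lieD fscaleDr xE fscaleA -mpolyCM mulVf //.
  by rewrite fscale1 -addrA; congr (_ + _); rewrite [x + y]addrC opprD addrA addrK.
have dLv : fdiff (lie E (v0 + v)) = 0 by rewrite -(lie_fdiff char0) dv w0.
apply: (IH (y - fscale c^-1%:MP (lie E y)) v0); first exact: Lv0.
- rewrite E1; apply: deg_geB; first exact: vp.
  exact/deg_ge_scale/deg_ge_lie.
- by rewrite E1 fdiffB fdiff_cst dLv fscale0r subr0; exact: dv.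
- exact: lie_sum_n_shift.
Qed.

Lemma lie0_primitive p w v : lie E w = 0 -> deg_ge p v -> fdiff v = w ->
  exists2 u, deg_ge p u & fdiff u = w /\ lie E u = 0.
Proof.
move=> w0 vp dv; have [m vm] := lie_sum_n_all v.
by apply: (lie0_primitive_aux w0 (lie0 E) _ _ vm); rewrite add0r.
Qed.

Lemma lie0_poincare p w : lie E w = 0 -> deg_ge p.+1 w -> fdiff w = 0 ->
  exists2 u, deg_ge p u & fdiff u = w /\ lie E u = 0.
Proof.
move=> Lw wp dw; have [v vp dv] := poincare char0 wp dw.
exact: (lie0_primitive Lw vp dv).
Qed.

(* With [theta = \sum a dg] one has [contract theta = 1] and [lie theta = 0];
   [1 + d theta] is then invertible and [1] is exact for [fdiff + contract] on
   the forms of weight [0]. The Poincare lemma in weight [0] forbids this. *)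
Lemma vfield_not_free (s : seq (A * A)) :
  (forall x, x \in s -> exists c : k,
     vfield E x.2 = c *: x.2 /\ vfield E x.1 = - c *: x.1) ->
  \sum_(x <- s) x.1 * vfield E x.2 <> 1.
Proof.
move=> hs s1.
pose Th (w : form) : form := \sum_(x <- s) fscale x.1 (fwedge x.2 w).
have ThC w : contract E (Th w) + Th (contract E w) = w.
  rewrite /Th (big_morph _ (@contractD k n E) (@contract0 k n E)) -big_split /=.
  under eq_bigr do rewrite contract_scale -fscaleDr contract_fwedge fscaleA.
  by rewrite -fscale_suml s1 fscale1.
have ThL w : lie E w = 0 -> lie E (Th w) = 0.
  move=> Lw; rewrite /Th lie_sum big_seq; apply: big1 => x /hs[c [gc ac]].
  have Lw0 : lie_eigen E 0 w by rewrite /lie_eigen Lw mpolyC0 fscale0l.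
  have := lie_eigen_scale ac (lie_eigen_fwedge char0 gc Lw0).
  by rewrite addr0 addNr /lie_eigen mpolyC0 fscale0l.
have Thdeg p w : deg_ge p w -> deg_ge p.+1 (Th w).
  by move=> wp; apply: deg_ge_sum => x _; apply/deg_ge_scale/deg_ge_fwedge.
have Th0 : Th 0 = 0.
  rewrite /Th; apply: big1 => x _; rewrite /fwedge fscale0r fdiff0.
  by rewrite fscale0r subr0 fscale0r.
(* The sum of the [eta j] is [theta * (1 + d theta)^-1], expanded as a geometric series. [cdeta]
   says that its image under [fdiff + contract E] is 1, degree by degree. *)
pose eta := fix eta j := if j is j'.+1 then - Th (fdiff (eta j')) else Th (form1 : form).
have etaL j : lie E (eta j) = 0.
  elim: j => [|j IH] /=; first by apply: ThL; exact: lie_form1.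
  by rewrite lieN ThL ?oppr0 ?(lie_fdiff char0) ?IH ?fdiff0.
have cdeta j : contract E (fdiff (eta j)) = 0 /\ contract E (eta j.+1) = - fdiff (eta j).
  elim: j => [|j [IH1 IH2]].
    have c0 : contract E (fdiff (eta 0%N)) = 0.
      have := etaL 0%N; rewrite /lie => /(canRL (addKr _)) ->.
      have := ThC form1; rewrite contract_form1 Th0 addr0 /= => ->.
      by rewrite fdiff_form1 oppr0 addr0.
    split=> //=; rewrite contractN; congr (- _).
    by have := ThC (fdiff (eta 0%N)); rewrite c0 Th0 addr0.
  have c0 : contract E (fdiff (eta j.+1)) = 0.
    have := etaL j.+1; rewrite /lie => /(canRL (addKr _)) ->.
    by rewrite IH2 fdiffN (fdiff_fdiff char0) !oppr0 addr0.
  split=> //; rewrite [eta j.+2]/= contractN; congr (- _).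
  by have := ThC (fdiff (eta j.+1)); rewrite c0 Th0 addr0.
have etadeg j : deg_ge j.*2.+1 (eta j).
  elim: j => [|j IH] /=; first by apply: Thdeg => S; rewrite ltn0.
  by apply/deg_geN/Thdeg/deg_ge_fdiff.
(* Descent on [j], starting where [eta j] vanishes for reasons of degree. A primitive [u] of weight
   0 of the closed form at [j.+1] corrects [eta j], because [fdiff (contract E u) = - contract E
   (fdiff u)]. *)
have Q j : exists2 z : form, deg_ge j.*2.+2 z &
    lie E z = 0 /\ fdiff (eta j - contract E z) = 0.
  have [m jm] : exists m, (n <= j + m)%N by exists n; rewrite leq_addl.
  elim: m j jm => [|m IH] j jm.
    have -> : eta j = 0.
      apply: deg_ge_eq0 => S Sn; apply: etadeg; apply: leq_trans Sn _.
      by move: jm; rewrite addn0 -addnn => jm; rewrite ltnS (leq_trans jm) ?leq_addr.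
    exists 0; first by move=> S _; rewrite ffunE.
    by rewrite lie0 contract0 subr0 fdiff0.
  have jm' : (n <= j.+1 + m)%N by rewrite addSn -addnS.
  have [z zdeg [zL zd]] := IH j.+1 jm'.
  have [||u udeg [ud uL]] := @lie0_poincare j.*2.+2 (eta j.+1 - contract E z) _ _ zd.
  - by rewrite lieB etaL (lie_contract char0) zL contract0 subr0.
  - apply: deg_geB; first by have := etadeg j.+1; rewrite doubleS.
    by apply: deg_ge_contract; move: zdeg; rewrite doubleS.
  exists u; first exact: udeg. split; first exact: uL.
  have : fdiff (contract E u) = - contract E (eta j.+1 - contract E z).
    by rewrite -ud; apply/eqP; rewrite -addr_eq0; apply/eqP.
  rewrite fdiffB => ->; rewrite contractB (contract_contract char0) subr0.
  by have [_ ->] := cdeta j; rewrite opprK subrr.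
have [z zdeg [zL zd]] := Q 0%N.
have [||u udeg [ud uL]] := @lie0_poincare 0 (eta 0%N - contract E z) _ _ zd.
- by rewrite lieB etaL (lie_contract char0) zL contract0 subr0.
- apply: deg_geB; first exact: (etadeg 0%N).
  exact: deg_ge_contract zdeg.
(* The end of the descent: the function 1 would be exact, although an exact form has no part of
   degree 0. *)
have : form1 = - fdiff (contract E u) :> form.
  apply/eqP; rewrite -addr_eq0 addrC; apply/eqP; rewrite -[RHS]uL /lie; congr (_ + _).
  rewrite ud contractB (contract_contract char0) subr0.
  by have := ThC form1; rewrite contract_form1 Th0 addr0.
move/ffunP/(_ finset.set0); rewrite !ffunE eqxx sum_ffunE big1 => [/eqP|i _].
  by rewrite oppr0 oner_eq0.
by rewrite ffunE inE.
Qed.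

End FixedPoint.

(** * Gradings by the characters of a torus *)

Definition in_span (k : fieldType) n (s : seq {mpoly k[n]}) (p : {mpoly k[n]}) :=
  exists l : seq ({mpoly k[n]} * {mpoly k[n]}),
    {in l, forall x, x.2 \in s} /\ p = \sum_(x <- l) x.1 * x.2.

Lemma mpoly_fg (k : fieldType) n (S : {mpoly k[n]} -> Prop) :
  exists s : seq {mpoly k[n]}, {in s, forall x, S x} /\
    forall p, S p -> in_span s p.
Proof.
apply: contrapT => nfg.
have next (s : seq {mpoly k[n]}) :
    exists p, {in s, forall x, S x} -> S p /\ ~ in_span s p.
  apply: contrapT => h.
  have hs : {in s, forall x, S x}.
    move=> x xs; apply: contrapT => nSx; apply: h; exists 0 => /(_ x xs).
    by [].
  apply: nfg; exists s; split=> // p Sp; apply: contrapT => ng.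
  by apply: h; exists p.
have [f fP] := choice next.
pose L := fix L j := if j is j'.+1 then f (L j') :: L j' else [::].
have LS j : {in L j, forall x, S x}.
  elim: j => // j IH x; rewrite inE => /predU1P[->|/IH//].
  by case: (fP (L j) IH).
have idg (s : seq {mpoly k[n]}) : is_ideal (in_span s).
  split; first by exists [::]; rewrite big_nil.
  move=> b p q [u [us ->]] [v [vs ->]].
  exists ([seq (b * x.1, x.2) | x <- u] ++ v); split.
    by move=> x; rewrite mem_cat => /orP[/mapP[y yu ->]|/vs//]; exact: (us _ yu).
  rewrite big_cat big_map mulr_sumr; congr (_ + _).
  by apply: eq_bigr => x _ /=; rewrite mulrA.
have [|j hj] := @mpoly_acc k n (fun j => in_span (L j)) (fun j => idg _).
  move=> j p [l [ls ->]]; exists l; split=> // x /ls xl.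
  by rewrite inE xl orbT.
have [_] := fP (L j) (@LS j); apply; apply: hj.
exists [:: (1, f (L j))]; rewrite big_seq1 mul1r; split=> // x.
by rewrite inE => /eqP -> /=; exact: mem_head.
Qed.

(** The hypothesis is spanning in dual form. A free family with fewer than [n] rows has a non-zero
    annihilator [v]; a row of [P] not killed by [v] extends it. *)
Lemma basis_pick (F : fieldType) n (P : 'rV[F]_n -> Prop) :
  (forall v : 'cV[F]_n, (forall w, P w -> w *m v = 0) -> v = 0) ->
  exists2 M : 'M[F]_n, M \in unitmx & forall i, P (row i M).
Proof.
move=> hP.
suff [M Mf MP] : exists2 M : 'M[F]_n, row_free M & forall i, P (row i M).
  by exists M => //; rewrite -row_free_unit.
suff h m : (m <= n)%N -> exists2 M : 'M[F]_(m, n), row_free M & forall i, P (row i M).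
  exact: h.
elim: m => [|m IH] mn.
  exists 0; last by case.
  by rewrite /row_free mxrank0.
have [M Mf MP] := IH (ltnW mn).
have [v v0 Mv] : exists2 v : 'cV[F]_n, v != 0 & M *m v = 0.
  have : kermx M^T != 0.
    rewrite -mxrank_eq0 mxrank_ker mxrank_tr (eqP Mf) -lt0n subn_gt0.
    by [].
  case/rowV0Pn => u /sub_kermxP uM u0; exists u^T.
    by apply: contraNneq u0 => /(congr1 trmx); rewrite trmxK trmx0 => ->.
  by apply: trmx_inj; rewrite trmx_mul trmxK uM trmx0.
have [w Pw wv] : exists2 w, P w & w *m v != 0.
  apply: contrapT => h; case/negP: v0; apply/eqP/hP => w Pw.
  by apply: contrapT => /eqP wv; apply: h; exists w.
rewrite -(addn1 m); exists (col_mx M w); last first.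
  move=> i; rewrite -[i](splitK (m := m) (n := 1)).
  by case: (split _) => j /=; rewrite ?rowKu ?rowKd // (row_id j).
rewrite /row_free -addsmxE.
have /eqP -> : \rank (M + w)%MS == (m + 1)%N; last by [].
rewrite mxrank_disjoint_sum.
  by rewrite (eqP Mf) rank_rV (contraNneq _ wv) // => ->; rewrite mul0mx.
apply/eqP/rowV0P => z; rewrite sub_capmx => /andP[/submxP[a zE] /sub_rVP[c zE2]].
have [c0|c0] := eqVneq c 0; first by rewrite zE2 c0 scale0r.
move: wv.
have -> : w = c^-1 *: z by rewrite zE2 scalerA mulVf // scale1r.
by rewrite -scalemxAl zE -mulmxA Mv mulmx0 scaler0 eqxx.
Qed.

(** * Weights and homogeneous components *)

Section Grading.
Context {k : fieldType} (char0 : [pchar k] =i pred0) {n r : nat}.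
Local Notation A := {mpoly k[n]}.
Local Notation W := 'rV[int]_r.
Implicit Types (t : 'I_r -> k) (c d : W) (p q : A).

Definition tunit t := forall i, t i != 0.
Definition tpow t c : k := \prod_i t i ^ c 0 i.

Lemma tpow_neq0 t c : tunit t -> tpow t c != 0.
Proof. by move=> ut; apply/prodf_neq0 => i _; rewrite expfz_neq0. Qed.
Lemma tpow0 t : tpow t 0 = 1.
Proof. by apply: big1 => i _; rewrite mxE expr0z. Qed.
Lemma tpowD t c d : tunit t -> tpow t (c + d) = tpow t c * tpow t d.
Proof.
move=> ut; rewrite -big_split; apply: eq_bigr => i _ /=.
by rewrite mxE expfzDr.
Qed.

(** The element 2 has infinite order, so points of the torus whose coordinates are powers of 2
    detect integer exponents. *)
Lemma char0_expz2 (e : int) : (2%:R : k) ^ e = 1 -> e = 0.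
Proof.
have h (m : nat) : (2%:R : k) ^+ m = 1 -> m = 0%N.
  rewrite -natrX => /(char0_natr_inj char0 (x2 := 1%N)) /eqP.
  by rewrite -[1%N](expn0 2) eqn_exp2l // => /eqP.
case: e => m; first by rewrite -exprnP => /h ->.
rewrite NegzE -exprnN => /eqP; rewrite invr_eq1 => /eqP /h.
by [].
Qed.

Definition tcoord (i : 'I_r) (a : k) : 'I_r -> k := fun j => if j == i then a else 1.

Lemma tunit_coord i a : a != 0 -> tunit (tcoord i a).
Proof. by move=> a0 j; rewrite /tcoord; case: ifP; rewrite ?oner_neq0. Qed.

Lemma tpow_coord i a c : tpow (tcoord i a) c = a ^ c 0 i.
Proof.
rewrite /tpow (bigD1 i) //= big1 => [|j /negbTE ji].
  by rewrite mulr1 /tcoord eqxx.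
by rewrite /tcoord ji exp1rz.
Qed.

Lemma two_neq0 : (2%:R : k) != 0.
Proof. by rewrite ((pcharf0P _).1 char0). Qed.

Lemma tpow_inj c d : (forall t, tunit t -> tpow t c = tpow t d) -> c = d.
Proof.
move=> h; apply/matrixP => z i; rewrite ord1; apply/eqP; rewrite -subr_eq0.
apply/eqP/char0_expz2; rewrite expfzDr ?two_neq0 // -invr_expz.
have := h _ (tunit_coord i two_neq0); rewrite !tpow_coord => ->.
by rewrite divff // expfz_neq0 // two_neq0.
Qed.

Lemma tpow_sep c d : c != d -> exists2 t, tunit t & tpow t c != tpow t d.
Proof.
move=> cd; apply: contrapT => h; case/negP: cd; apply/eqP/tpow_inj => t ut.
by apply: contrapT => /eqP tcd; apply: h; exists t.
Qed.

Context (phi : ('I_r -> k) -> polyend k n).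
Definition hom c p := forall t, tunit t -> p \mPo phi t = tpow t c *: p.
Hypothesis hom_dec : forall p, sum_of (fun q => exists c, hom c q) p.

Lemma hom0 c : hom c 0.
Proof. by move=> t _; rewrite comp_mpoly0 scaler0. Qed.
Lemma homD c p q : hom c p -> hom c q -> hom c (p + q).
Proof. by move=> hp hq t ut; rewrite comp_mpolyD hp // hq // scalerDr. Qed.
Lemma homZ c a p : hom c p -> hom c (a *: p).
Proof. by move=> hp t ut; rewrite comp_mpolyZ hp // !scalerA mulrC. Qed.
Lemma homN c p : hom c p -> hom c (- p).
Proof. by rewrite -scaleN1r; exact: homZ. Qed.
Lemma homB c p q : hom c p -> hom c q -> hom c (p - q).
Proof. by move=> hp hq; apply/homD/homN. Qed.
Lemma homM c d p q : hom c p -> hom d q -> hom (c + d) (p * q).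
Proof.
move=> hp hq t ut; rewrite rmorphM /= hp // hq // tpowD //.
by rewrite -scalerAl -scalerAr scalerA.
Qed.
Lemma homC a : hom 0 a%:MP.
Proof. by move=> t _; rewrite comp_mpolyC tpow0 scale1r. Qed.
Lemma hom_sum c (I : Type) (s : seq I) (P : pred I) (F : I -> A) :
  (forall i, P i -> hom c (F i)) -> hom c (\sum_(i <- s | P i) F i).
Proof. by move=> h; elim/big_ind: _ => //; [exact: hom0|exact: homD]. Qed.
Lemma homX c p (m : nat) : hom c p -> hom (c *+ m) (p ^+ m).
Proof.
move=> hp; elim: m => [|m IH]; first by rewrite mulr0n expr0; exact: (homC 1).
by rewrite mulrS exprS; exact: homM.
Qed.
Lemma hom_prod (I : Type) (s : seq I) (P : pred I) (F : I -> A) (g : I -> W) :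
  (forall i, P i -> hom (g i) (F i)) ->
  hom (\sum_(i <- s | P i) g i) (\prod_(i <- s | P i) F i).
Proof. by move=> h; elim/big_ind2: _ => //; [exact: (homC 1)|move=> *; exact: homM]. Qed.

Lemma hom_uniq c d p : p != 0 -> hom c p -> hom d p -> c = d.
Proof.
move=> p0 hc hd; apply: tpow_inj => t ut; have := hc t ut; rewrite hd // => /eqP.
by rewrite -subr_eq0 -scalerBl scaler_eq0 (negbTE p0) orbF subr_eq0 => /eqP.
Qed.

Definition stable (V : A -> Prop) := [/\ V 0,
  forall a p q, V p -> V q -> V (a *: p + q) &
  forall t p, tunit t -> V p -> V (p \mPo phi t)].

(** To isolate the part of weight [d], subtract [tpow t c] times the sum from its image under [t]:
    the part of weight [c] disappears and the others are scaled, for suitable [t] by a non-zero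
    factor in weight [d]. *)
Lemma stable_summand V (s : seq W) (f : W -> A) : stable V -> uniq s ->
  (forall c, hom c (f c)) -> V (\sum_(c <- s) f c) -> {in s, forall c, V (f c)}.
Proof.
case=> V0 VA Vt; elim: s f => // c s IH f /= /andP[cs us] hf.
rewrite big_cons => Vsum.
have Vs : {in s, forall d, V (f d)}.
  move=> d ds; have cd : c != d by apply: contraNneq cs => ->.
  have [t ut tcd] := tpow_sep cd.
  have /(_ d ds) : {in s, forall e, V ((tpow t e - tpow t c) *: f e)}.
    apply: IH => // [e|]; first exact: homZ.
    have := VA (- tpow t c) _ _ Vsum (Vt t _ ut Vsum).
    rewrite comp_mpolyD hf // raddf_sum /= scalerDr addrACA scaleNr addNr add0r.
    rewrite scaler_sumr -big_split /=; congr V; apply: eq_bigr => e _.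
    by rewrite hf // -scalerDl addrC.
  move=> Vd; have := VA (tpow t d - tpow t c)^-1 _ _ Vd V0.
  by rewrite addr0 scalerA mulVf ?scale1r // subr_eq0 eq_sym.
move=> d; rewrite inE => /predU1P[->|/Vs//].
have VS : V (\sum_(e <- s) f e).
  rewrite big_seq; elim/big_ind: _ => // x y Vx Vy.
  by rewrite -[x]scale1r; exact: VA.
by have := VA (-1) _ _ VS Vsum; rewrite scaleN1r addrC addrK.
Qed.

Lemma hom_dec_fun p : exists f : W -> A, (forall c, hom c (f c)) /\
  exists s : seq W, [/\ uniq s, forall c, c \notin s -> f c = 0 & p = \sum_(c <- s) f c].
Proof.
elim: (hom_dec p) => [|x y [c hx] _ [f [hf [s [us fs yE]]]]].
  by exists (fun=> 0); split; [move=> c; exact: hom0|exists [::]; rewrite big_nil].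
pose g d := if d == c then f d + x else f d.
exists g; split.
  by move=> d; rewrite /g; case: eqP => [->|_] //; exact: homD.
have yE' : y = \sum_(d <- undup (c :: s)) f d.
  rewrite yE /=; case: ifP => [_|cs]; first by rewrite undup_id.
  by rewrite big_cons fs ?cs // add0r undup_id.
exists (undup (c :: s)); split; first exact: undup_uniq.
  move=> d; rewrite mem_undup inE negb_or => /andP[dc ds].
  by rewrite /g (negbTE dc) fs.
rewrite yE' !(bigD1_seq c) ?undup_uniq ?mem_undup ?mem_head //= /g eqxx.
rewrite addrA [x + _]addrC; congr (_ + _).
by apply: eq_bigr => d /negbTE ->.
Qed.

Definition comp p : W -> A := projT1 (cid (hom_dec_fun p)).

Lemma compP p : (forall c, hom c (comp p c)) /\
  exists s : seq W, [/\ uniq s, forall c, c \notin s -> comp p c = 0 &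
    p = \sum_(c <- s) comp p c].
Proof.
exact: (projT2 (cid (hom_dec_fun p))).
Qed.

Lemma comp_hom p c : hom c (comp p c).
Proof. by case: (compP p). Qed.

Lemma sum_supp (f : W -> A) (s s' : seq W) : uniq s -> uniq s' ->
  (forall c, c \notin s -> f c = 0) -> {subset s <= s'} ->
  \sum_(c <- s') f c = \sum_(c <- s) f c.
Proof.
move=> us us' fs ss'; rewrite (bigID (mem s)) /= [X in _ + X]big1 => [|c /fs//].
rewrite addr0 -big_filter; apply: perm_big; apply: uniq_perm => //.
  exact: filter_uniq.
by move=> c; rewrite mem_filter; case: (boolP (c \in s)) => //= /ss'.
Qed.

Lemma comp_unique p (f : W -> A) (s : seq W) : (forall c, hom c (f c)) ->
  uniq s -> (forall c, c \notin s -> f c = 0) -> p = \sum_(c <- s) f c ->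
  forall c, comp p c = f c.
Proof.
move=> hf us fs pE c; have [hp [s' [us' ps' pE']]] := compP p.
pose u := undup (c :: s ++ s').
have z : \sum_(c <- u) (comp p c - f c) = 0.
  rewrite sumrB (sum_supp us' (undup_uniq _) ps') -?pE'; last first.
    by move=> d ds; rewrite mem_undup inE mem_cat ds !orbT.
  rewrite (sum_supp us (undup_uniq _) fs) -?pE ?subrr // => d ds.
  by rewrite mem_undup inE mem_cat ds orbT.
have V0 : stable (fun p => p = 0).
  split=> // [a x y -> ->|t x _ ->]; first by rewrite scaler0 addr0.
  exact: comp_mpoly0.
have := @stable_summand _ u _ V0 (undup_uniq _) (fun c => homB (hp c) (hf c)) z c.
rewrite mem_undup mem_head => /(_ isT) /eqP.
by rewrite subr_eq0 => /eqP.
Qed.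

Lemma comp_of_hom c p d : hom c p -> comp p d = if d == c then p else 0.
Proof.
move=> hp; pose f d := if d == c then p else 0.
apply: (@comp_unique p f [:: c]) => //.
- by move=> e; rewrite /f; case: eqP => [->|_] //; exact: hom0.
- by move=> e; rewrite inE /f => /negbTE ->.
- by rewrite big_seq1 /f eqxx.
Qed.

Lemma compD p q c : comp (p + q) c = comp p c + comp q c.
Proof.
have [hp [s [us ps pE]]] := compP p; have [hq [s' [us' qs' qE]]] := compP q.
apply: (@comp_unique _ (fun c => comp p c + comp q c) (undup (s ++ s'))).
- by move=> d; exact: homD.
- exact: undup_uniq.
- by move=> d; rewrite mem_undup mem_cat negb_or => /andP[/ps -> /qs' ->]; rewrite addr0.
- have Ep : \sum_(c <- undup (s ++ s')) comp p c = p.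
    rewrite [RHS]pE; apply: sum_supp => // [|d ds]; first exact: undup_uniq.
    by rewrite mem_undup mem_cat ds.
  have Eq : \sum_(c <- undup (s ++ s')) comp q c = q.
    rewrite [RHS]qE; apply: sum_supp => // [|d ds]; first exact: undup_uniq.
    by rewrite mem_undup mem_cat ds orbT.
  by rewrite big_split /= Ep Eq.
Qed.

Lemma comp0 c : comp 0 c = 0.
Proof. by rewrite (comp_of_hom _ (hom0 c)) eqxx. Qed.

Lemma comp_sum c (I : Type) (s : seq I) (P : pred I) (F : I -> A) :
  comp (\sum_(i <- s | P i) F i) c = \sum_(i <- s | P i) comp (F i) c.
Proof. exact: (big_morph (comp^~ c) (fun p q => compD p q c) (comp0 c)). Qed.

Lemma comp_mul_hom d p q c : hom d q -> comp (p * q) c = comp p (c - d) * q.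
Proof.
move=> hq; have [hp [s [us ps pE]]] := compP p.
apply: (@comp_unique _ (fun c => comp p (c - d) * q) [seq c + d | c <- s]).
- by move=> e; rewrite -[e in X in hom X](subrK d); exact: homM.
- by rewrite map_inj_uniq //; exact: addIr.
- move=> e eN; rewrite ps ?mul0r //; apply: contra eN => es.
  by apply/mapP; exists (e - d); rewrite ?subrK.
- rewrite big_map {1}pE mulr_suml; apply: eq_bigr => e _.
  by rewrite addrK.
Qed.

Lemma comp_stable V p c : stable V -> V p -> V (comp p c).
Proof.
move=> SV Vp; have [hp [s [us ps pE]]] := compP p.
have [cs|/ps ->] := boolP (c \in s); last by case: SV.
by apply: (stable_summand SV us hp) => //; rewrite -pE.
Qed.

Lemma comp_eq0 p : (forall c, comp p c = 0) -> p = 0.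
Proof. by move=> h; have [_ [s [_ _ ->]]] := compP p; rewrite big1. Qed.

Lemma int_argmax (T : eqType) (L : T -> int) (s : seq T) : s != [::] ->
  exists2 x, x \in s & {in s, forall y, L y <= L x}.
Proof.
elim: s => // x [|y s] IH _.
  by exists x; [exact: mem_head|move=> z; rewrite inE => /eqP ->].
have [//|z zs hz] := IH; have [le|lt] := lerP (L z) (L x).
  exists x; first exact: mem_head.
  by move=> u; rewrite inE => /predU1P[->//|/hz]; move/le_trans; apply.
exists z; first by rewrite inE zs orbT.
by move=> u; rewrite inE => /predU1P[->|/hz//]; exact: ltW.
Qed.

Lemma int_separate (s : seq W) : exists l : 'cV[int]_r,
  {in s, forall c, c != 0 -> (c *m l) 0 0 != 0}.
Proof.
elim: s => [|c s [l hl]]; first by exists 0.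
have [c0|c0] := eqVneq c 0.
  exists l => d; rewrite inE => /predU1P[->|/hl//]; by rewrite c0 eqxx.
have [cl|cl] := eqVneq ((c *m l) 0 0) 0; last first.
  by exists l => d; rewrite inE => /predU1P[->|/hl//].
have [i ci] : exists i, c 0 i != 0.
  apply: contrapT => h; case/negP: c0; apply/eqP/matrixP => z i; rewrite ord1 mxE.
  by apply: contrapT => /eqP ci; apply: h; exists i.
(* [N] exceeds the absolute value of every [d 0 i], so that adding [d 0 i] cannot cancel [N] times a
   non-zero integer. *)
pose N : int := (\sum_(d <- s) absz (d 0%R i))%N.+1%:Z.
exists (N *: l + delta_mx i 0) => d.
have E (e : W) : (e *m (N *: l + delta_mx i 0)) 0 0 = N * (e *m l) 0 0 + e 0 i.
  rewrite mulmxDr -scalemxAr mxE [X in X + _]mxE; congr (_ + _).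
  rewrite mxE (bigD1 i) //= big1 ?addr0 => [|j /negbTE ji]; rewrite mxE ?eqxx ?mulr1 //.
  by rewrite ji mulr0.
rewrite E inE => /predU1P[-> _|ds d0]; first by rewrite cl mulr0 add0r.
have := hl d ds d0; move: ((d *m l) 0 0) => x x0.
have : (absz (d 0%R i) < absz N)%N.
  by rewrite /N absz_nat ltnS (big_rem d) //= leq_addr.
move: (d 0 i) x0 => y x0; have : N > 0 by [].
move: {E}N => M; clear -x0; move=> M0 yM; apply/eqP => E; nia.
Qed.

(** A generic linear form orders the weights that occur. The products of the top components and of
    the bottom components are both non-zero components of [p * q], hence both of weight [c]; so the
    top and the bottom weights of [p] coincide. *)
Lemma hom_factor p q c : p * q != 0 -> hom c (p * q) -> exists d, hom d p.
Proof.
move=> pq0 hpq; have [hp [s [us ps pE]]] := compP p; have [hq [s' [us' qs' qE]]] := compP q.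
have [l hl] := int_separate [seq x.1 - x.2 | x <- allpairs pair (s ++ s') (s ++ s')].
pose L (d : W) := (d *m l) 0 0.
have Linj : {in s ++ s' &, injective L}.
  move=> x y xs ys Lxy; apply/eqP; rewrite -subr_eq0; apply: contraT => xy0.
  have /hl : x - y \in [seq x.1 - x.2 | x <- allpairs pair (s ++ s') (s ++ s')].
    by apply/mapP; exists (x, y) => //; apply/allpairsP; exists (x, y).
  by move=> /(_ xy0); rewrite mulmxBl mxE [X in _ + X]mxE -/(L x) -/(L y) Lxy subrr eqxx.
have p0 : p != 0 by apply: contraNneq pq0 => ->; rewrite mul0r.
have q0 : q != 0 by apply: contraNneq pq0 => ->; rewrite mulr0.
have ex (u : A) (su : seq W) : u != 0 -> u = \sum_(d <- su) comp u d ->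
    [seq d <- su | comp u d != 0] != [::].
  move=> u0 uE; apply: contra u0 => /eqP E; rewrite uE big_seq big1 // => d ds.
  apply/eqP; apply: contraT => nz; have : d \in [seq d <- su | comp u d != 0].
    by rewrite mem_filter nz.
  by rewrite E.
have extr (M : W -> int) : {morph M : x y / x + y} -> {in s ++ s' &, injective M} ->
    exists a b, [/\ comp p a != 0, forall d, comp p d != 0 -> M d <= M a,
      comp q b != 0, forall d, comp q d != 0 -> M d <= M b & c = a + b].
  move=> MD Minj.
  have [a] := int_argmax M (ex p s p0 pE); rewrite mem_filter => /andP[pa as_ amax].
  have [b] := int_argmax M (ex q s' q0 qE); rewrite mem_filter => /andP[qb bs_ bmax].
  have pmax d : comp p d != 0 -> M d <= M a.
    move=> pd; apply: amax; rewrite mem_filter pd; apply: contraT => ds.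
    by rewrite ps ?eqxx // in pd.
  have qs d : comp q d != 0 -> d \in s'.
    by move=> qd; apply: contraT => ds; rewrite qs' ?eqxx // in qd.
  have qmax d : comp q d != 0 -> M d <= M b.
    by move=> qd; apply: bmax; rewrite mem_filter qd qs.
  exists a, b; split=> //; apply/eqP.
  have : comp (p * q) (a + b) != 0; last first.
    by rewrite (comp_of_hom _ hpq); case: ifP => [/eqP <-|_]; rewrite eqxx.
  rewrite {1}qE mulr_sumr comp_sum (bigD1_seq b) //= (comp_mul_hom _ _ (hq b)) addrK.
  rewrite big1 ?addr0 ?mulf_neq0 // => e eb; rewrite (comp_mul_hom _ _ (hq e)).
  apply/eqP; rewrite mulf_eq0; apply: contraT; rewrite negb_or => /andP[pe qe].
  have lt : M e < M b.
    rewrite lt_neqAle qmax // andbT; apply: contra eb => /eqP /Minj ->//.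
      by rewrite mem_cat qs // orbT.
    by rewrite mem_cat bs_ orbT.
  by have := ler_ltD (pmax _ pe) lt; rewrite -!MD subrK ltxx.
have LD : {morph L : x y / x + y} by move=> x y; rewrite /L mulmxDl mxE.
have [a [b [pa amax qb bmax cE]]] := extr L LD Linj.
have [||a' [b' [pa' amin qb' bmin cE']]] := extr (fun x => - L x).
- by move=> x y; rewrite LD opprD.
- by move=> x y xs ys /oppr_inj; exact: Linj.
have LE : L a + L b = L a' + L b' by rewrite -!LD -cE cE'.
have La : L a' = L a.
  by have := amax _ pa'; have := bmax _ qb'; lia.
have sp d : comp p d != 0 -> d \in s by move=> pd; apply: contraT => ds; rewrite ps ?eqxx // in pd.
exists a; rewrite pE (bigD1_seq a) ?sp //= big_seq_cond big1 ?addr0 // => d /andP[_ da].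
apply/eqP; apply: contraT => pd; case/negP: da; apply/eqP/Linj.
- by rewrite mem_cat sp.
- by rewrite mem_cat sp.
- by have := amax _ pd; have := amin _ pd; lia.
Qed.

Lemma rat_clear_denominators (v : 'cV[rat]_r) : exists (D : nat) (z : 'cV[int]_r),
  D != 0%N /\ forall i, D%:R * v i 0 = (z i 0)%:~R.
Proof.
exists (\prod_j absz (denq (v j 0%R)))%N.
exists (\col_i (numq (v i 0) * (\prod_(j | j != i) absz (denq (v j 0%R)))%N%:Z)); split.
  rewrite -lt0n prodn_gt0 // => j; by rewrite absz_gt0 denq_neq0.
move=> i; rewrite mxE (bigD1 i) //= natrM mulrAC rmorphM /=; congr (_ * _).
rewrite -{2}[v i 0]divq_num_den mulrC.
have -> : (absz (denq (v i 0%R)))%:R = (denq (v i 0))%:~R :> rat.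
  by rewrite -[in RHS](gtz0_abs (denq_gt0 _)).
by rewrite divfK // intr_eq0 denq_neq0.
Qed.

Hypothesis phi_faithful : forall t, tunit t -> phi t = polyend_id -> forall i, t i = 1.

(** If the weights that occur did not span, an integral vector [z] orthogonal to all of them would
    give a point with coordinates [2 ^ z i 0] acting trivially, against faithfulness. *)
Lemma weights_basis : exists (h : 'I_r -> A) (M : 'M[int]_r),
  [/\ forall i, h i != 0, forall i, hom (row i M) (h i) &
      forall u : 'rV[int]_r, u *m M = 0 -> u = 0].
Proof.
pose P (w : 'rV[rat]_r) := exists c (h : A), [/\ h != 0, hom c h & w = map_mx intr c].
have [v hv|M uM MP] := @basis_pick rat r P.
  have [D [z [D0 zE]]] := rat_clear_denominators v.
  pose t i : k := 2%:R ^ z i 0.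
  have ut : tunit t by move=> i; rewrite expfz_neq0 // two_neq0.
  have t1 c (h : A) : h != 0 -> hom c h -> tpow t c = 1.
    move=> h0 hc; have /matrixP/(_ 0 0) := hv (map_mx intr c) (ex_intro _ c (ex_intro _ h (And3 h0 hc erefl))).
    rewrite !mxE => E.
    have : (\sum_j c 0 j * z j 0)%:~R = 0 :> rat.
      transitivity (D%:R * \sum_j (map_mx intr c : 'rV[rat]_r) 0 j * v j 0).
        rewrite rmorph_sum mulr_sumr; apply: eq_bigr => j _ /=.
        by rewrite mxE mulrCA zE -intrM.
      by rewrite E mulr0.
    move/eqP; rewrite intr_eq0 => /eqP E0.
    rewrite /tpow; transitivity ((2%:R : k) ^ (\sum_j c 0 j * z j 0)); last by rewrite E0 expr0z.
    elim/big_rec2: _ => [|j x y _ ->]; first by rewrite expr0z.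
    by rewrite expfzDr ?two_neq0 // -exprz_exp exprzAC.
  have tid : phi t = polyend_id.
    apply: eq_from_tnth => i; rewrite tnth_mktuple.
    have := comp_mpolyXU i (phi t); rewrite -tnth_nth => <-.
    elim: (hom_dec 'X_i) => [|x y [c hx] _ IH]; first exact: comp_mpoly0.
    rewrite comp_mpolyD IH hx //; have [->|x0] := eqVneq x 0; first by rewrite scaler0.
    by rewrite (t1 c x) // scale1r.
  apply/matrixP => i j; rewrite ord1 mxE; apply/eqP.
  have := phi_faithful ut tid i; move/char0_expz2 => zi.
  by have := zE i; rewrite zi => /eqP; rewrite mulf_eq0 pnatr_eq0 (negbTE D0).
have [c cP] := choice MP; have [h hP] := choice cP.
exists h, (\matrix_i c i); split=> [i|i|u uM0].
- by case: (hP i).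
- by rewrite rowK; case: (hP i).
have E : map_mx intr (\matrix_i c i) = M.
  by apply/row_matrixP => i; rewrite -map_row rowK; case: (hP i).
have : map_mx intr u *m M = 0 :> 'rV[rat]_r by rewrite -E -map_mxM uM0 map_mx0.
move/(congr1 (mulmx^~ (invmx M))); rewrite mulmxK // mul0mx => /matrixP E0.
by apply/matrixP => a b; have := E0 a b; rewrite !mxE => /eqP; rewrite intr_eq0 => /eqP.
Qed.

Lemma msizeM_leq p q : (msize (p * q) <= msize p + msize q)%N.
Proof.
have [->|p0] := eqVneq p 0; first by rewrite mul0r msize0.
have [->|q0] := eqVneq q 0; first by rewrite mulr0 msize0.
by rewrite msizeM // leq_pred.
Qed.

Lemma msizeX_leq p m : (msize (p ^+ m) <= m * msize p + 1)%N.
Proof.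
elim: m => [|m IH]; first by rewrite expr0 msize1.
by rewrite exprS mulSn -addnA; apply: leq_trans (msizeM_leq _ _) _; rewrite leq_add2l.
Qed.

(* There are about [N ^ r] monomials of degree [N] in the [h i] of [weights_basis],
   with distinct weights; their products with the [e N j] are too many for a space
   of polynomials in [n] variables, and one weight component of a relation
   between them can be divided by its monomial. *)
Lemma graded_dep (J : nat -> finType) (e : forall N, J N -> A) (wgt : nat -> W) (K : nat) :
  (forall N j, hom (wgt N) (e N j)) -> (forall N j, (0 < N)%N -> (msize (e N j) <= K * N)%N) ->
  (forall N, (N ^ n.+1 <= N ^ r * #|J N|)%N) ->
  exists N (b : J N -> k), (exists j, b j != 0) /\ \sum_j b j *: e N j = 0.
Proof.
move=> he se cJ; have [h [M [h0 hM Minj]]] := weights_basis.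
(* The products have [msize] at most [S.+1 * N] and there are at least [N ^ n.+1] of them;
   [N > S.+1 ^ n] makes this more than [(S.+1 * N) ^ n]. *)
pose S := (K + \sum_i (msize (h i) + 1))%N; pose N := (S.+1 ^ n).+1.
pose c := wgt N.
pose F (x : {ffun 'I_r -> 'I_N} * J N) := (\prod_i h i ^+ x.1 i) * e N x.2.
pose wt (a : {ffun 'I_r -> 'I_N}) : W := \sum_i row i M *+ a i.
have homF x : hom (wt x.1 + c) (F x).
  by apply: homM; last exact: he; apply: hom_prod => i _; exact: homX.
have szF x : (msize (F x) <= S.+1 * N)%N.
  apply: leq_trans (msizeM_leq _ _) _.
  have szp : (msize (\prod_i h i ^+ x.1 i) <= 1 + \sum_i N * (msize (h i) + 1))%N.
    elim/big_rec2: _ => [|i a q _ IH]; first by rewrite msize1.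
    apply: leq_trans (msizeM_leq _ _) _; rewrite addnCA leq_add //.
    apply: leq_trans (msizeX_leq _ _) _; rewrite mulnDr muln1 leq_add //.
      by rewrite leq_mul2r ltnW ?orbT.
  apply: leq_trans (leq_add szp (se _ _ _)) _ => //.
  by rewrite /S mulSn mulnDl big_distrl /= -big_distrr /= [(N * _)%N]mulnC big_distrl /= (addnC (K * N)%N) addnA leq_add2r leq_add2r.
have [|b [[[a0 j0] b0] bE]] := mpoly_dep char0 szF.
  rewrite card_prod card_ffun !card_ord; apply: leq_trans (cJ N).
  by rewrite expnMn expnS ltn_mul2r ltnS leqnn andbT expn_gt0.
exists N, (fun j => b (a0, j)); split; first by exists j0.
have wtinj a : wt a = wt a0 -> a = a0.
  move=> E; apply/ffunP => i; apply/val_inj/eqP => /=.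
  have /Minj/matrixP/(_ 0 i) : (\row_i ((a i : nat)%:Z - (a0 i : nat)%:Z)) *m M = 0.
    have wtE x : wt x = (\row_i (x i : nat)%:Z) *m M.
      rewrite mulmx_sum_row; apply: eq_bigr => l _.
      by rewrite mxE -scaler_nat natz.
    rewrite (_ : \row_i _ = \row_i (a i : nat)%:Z - \row_i (a0 i : nat)%:Z).
      by rewrite mulmxBl -!wtE E subrr.
    by apply/matrixP => x y; rewrite !mxE.
  by rewrite !mxE => /eqP; rewrite subr_eq0.
have : \prod_i h i ^+ a0 i != 0.
  by apply/prodf_neq0 => i _; rewrite expf_neq0.
move=> /mulfI; apply; rewrite mulr0.
have /(congr1 (fun p => comp p (wt a0 + c))) := bE.
have -> : \sum_x b x *: F x = \sum_a \sum_j b (a, j) *: F (a, j).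
  by rewrite pair_bigA; apply: eq_bigr => -[].
have -> : comp (\sum_a \sum_j b (a, j) *: F (a, j)) (wt a0 + c) =
    \sum_a \sum_j comp (b (a, j) *: F (a, j)) (wt a0 + c).
  by rewrite comp_sum; apply: eq_bigr => a _; rewrite comp_sum.
rewrite comp0 (bigD1 a0) //= [X in _ + X]big1 ?addr0 => [E0|a aa0].
  rewrite -[RHS]E0 mulr_sumr; apply: eq_bigr => j _.
  by rewrite (comp_of_hom _ (homZ _ (homF _))) eqxx scalerAr.
apply: big1 => j _; rewrite (comp_of_hom _ (homZ _ (homF _))) /=.
rewrite (inj_eq (addIr c)); case: eqP => // /esym/wtinj E.
by rewrite E eqxx in aa0.
Qed.

End Grading.

(** * Constant invariants *)

Lemma invmx_mul (F : fieldType) n (A B : 'M[F]_n) :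
  A \in unitmx -> B \in unitmx -> invmx (A *m B) = invmx B *m invmx A.
Proof.
move=> uA uB; have uAB : A *m B \in unitmx by rewrite unitmx_mul uA.
rewrite -[RHS](mulmxK uAB) mulmxA -(mulmxA (invmx B)) (mulVmx uA) mulmx1.
by rewrite (mulVmx uB) mul1mx.
Qed.

(** * Order of vanishing at a point *)

Section LowDegree.
Context {k : fieldType} {n : nat}.
Local Notation A := {mpoly k[n]}.
Implicit Types p q : A.

Definition low N p := forall m, (mdeg m < N)%N -> p@_m = 0.

Lemma low0 N : low N 0. Proof. by move=> m _; rewrite mcoeff0. Qed.
Lemma lowA N a p q : low N p -> low N q -> low N (a *: p + q).
Proof. by move=> hp hq m mN; rewrite mcoeffD mcoeffZ hp // hq // mulr0 addr0. Qed.
Lemma lowD N p q : low N p -> low N q -> low N (p + q).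
Proof. by move=> hp hq; rewrite -[p]scale1r; exact: lowA. Qed.
Lemma lowB N p q : low N p -> low N q -> low N (p - q).
Proof. by move=> hp hq; rewrite addrC -scaleN1r; exact: lowA. Qed.
Lemma lowW N M p : (M <= N)%N -> low N p -> low M p.
Proof. by move=> MN hp m mM; apply: hp; exact: leq_trans MN. Qed.
Lemma low_sum N (I : Type) (s : seq I) (P : pred I) (F : I -> A) :
  (forall i, P i -> low N (F i)) -> low N (\sum_(i <- s | P i) F i).
Proof. by move=> h; elim/big_ind: _ => //; [exact: low0|exact: lowD]. Qed.
Lemma lowM N M p q : low N p -> low M q -> low (N + M) (p * q).
Proof.
move=> hp hq m mNM; rewrite mcoeffM big1 // => -[u v] /= /eqP mE.
have uv : (mdeg (u : 'X_{1..n}) + mdeg (v : 'X_{1..n}) < N + M)%N by rewrite -mdegD -mE.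
have [uN|uN] := ltnP (mdeg u) N; first by rewrite hp // mul0r.
rewrite (hq (v : 'X_{1..n})) ?mulr0 //.
by rewrite -(ltn_add2l N); apply: leq_ltn_trans uv; rewrite leq_add2r.
Qed.
Lemma low_eq0 N p : low N p -> (msize p <= N)%N -> p = 0.
Proof.
move=> hp pN; apply/mpolyP => m; rewrite mcoeff0.
have [mN|mN] := ltnP (mdeg m) N; first exact: hp.
by apply: memN_msupp_eq0; apply: msize_mdeg_ge; exact: leq_trans mN.
Qed.

(** Both lie in the [N]-th power of the maximal ideal at the origin and have the same part of degree
    [N]. *)
Definition near_mod N p q := [/\ low N p, low N q & low N.+1 (p - q)].

Lemma near_modM N M p q p' q' : near_mod N p q -> near_mod M p' q' ->
  near_mod (N + M) (p * p') (q * q').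
Proof.
case=> pN qN pq [p'M q'M pq']; split; try exact: lowM.
have -> : p * p' - q * q' = p * (p' - q') + (p - q) * q'.
  by rewrite mulrBr mulrBl addrA subrK.
by apply: lowD; [rewrite -addnS|rewrite -addSn]; exact: lowM.
Qed.

Lemma near_mod1 : near_mod 0 1 1.
Proof. by split=> //; rewrite subrr; exact: low0. Qed.

Lemma low_comp N p (u v : n.-tuple A) : low N p ->
  (forall i, near_mod 1 (tnth u i) (tnth v i)) ->
  low N.+1 ((p \mPo u) - (p \mPo v)).
Proof.
move=> pN uv; rewrite !comp_mpolyEX -sumrB big_seq; apply: low_sum => m ms.
have Nm : (N <= mdeg m)%N.
  by rewrite leqNgt; apply: contraL ms => mN; rewrite mcoeff_msupp pN ?eqxx.
rewrite -scalerBr -[X in low _ X]addr0; apply: lowA; last exact: low0.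
rewrite !comp_mpolyX; apply: (@lowW (mdeg m).+1); first by rewrite ltnS.
rewrite mdegE.
have [] : near_mod (\sum_i m i) (\prod_i tnth u i ^+ m i) (\prod_i tnth v i ^+ m i).
  apply: (big_ind3 near_mod) => [||i _]; [exact: near_mod1|move=> *; exact: near_modM|].
  elim: (m i) => [|e IH]; first exact: near_mod1.
  by rewrite !exprS -add1n; exact: near_modM.
by [].
Qed.

Lemma low_comp1 N p (u : n.-tuple A) : low N p ->
  (forall i, low 1 (tnth u i)) -> low N (p \mPo u).
Proof.
move=> pN u1; rewrite comp_mpolyEX big_seq; apply: low_sum => m ms.
have Nm : (N <= mdeg m)%N.
  by rewrite leqNgt; apply: contraL ms => mN; rewrite mcoeff_msupp pN ?eqxx.
rewrite -[X in low _ X]addr0; apply: lowA; last exact: low0.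
rewrite comp_mpolyX; apply: (lowW Nm); rewrite mdegE.
elim/big_rec2: _ => [//|i x N' _ hx]; apply: lowM => //.
elim: (m i) => [//|e IH]; by rewrite exprS -add1n; exact: lowM.
Qed.

Lemma mcoeff0_meval p : p@_0%MM = p.@[fun=> 0].
Proof.
elim/mpoly_alg_ind: p => [c|i|p q IHp IHq|p q IHp IHq].
- by rewrite mcoeffC eqxx mulr1 mevalC.
- by rewrite mevalXU mcoeffX mnm1_eq0.
- by rewrite mcoeffD mevalD IHp IHq.
- by rewrite mevalM -IHp -IHq; exact: (rmorphM (mcoeff 0%MM)).
Qed.

Section Shift.
Context (a : 'I_n -> k).

Definition shift_tuple (c : 'I_n -> k) : n.-tuple A := [tuple 'X_i + (c i)%:MP | i < n].
Definition shift p : A := p \mPo shift_tuple a.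

Lemma shiftK p : shift p \mPo shift_tuple (fun i => - a i) = p.
Proof.
rewrite /shift comp_mpolyA -[RHS]comp_mpoly_id; congr (_ \mPo _).
apply: eq_from_tnth => i; rewrite !tnth_mktuple comp_mpolyD comp_mpolyC.
by rewrite comp_mpolyXU -tnth_nth tnth_mktuple -addrA -mpolyCD addNr mpolyC0 addr0.
Qed.

Lemma shift_coeff0 p : (shift p)@_0%MM = p.@[a].
Proof.
rewrite mcoeff0_meval comp_mpoly_meval; apply: meval_eq => i.
by rewrite tnth_mktuple mevalD mevalXU mevalC add0r.
Qed.

Lemma shift_coeff1 p j : (shift p)@_(U_(j)%MM) = p^`M(j).@[a].
Proof.
rewrite -shift_coeff0 /shift.
have -> : (p^`M(j) \mPo shift_tuple a) = (p \mPo shift_tuple a)^`M(j).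
  rewrite mderiv_comp (bigD1 j) //= big1 ?addr0 => [|i ij].
    rewrite tnth_mktuple mderivD mderivC addr0 mderivX mnm1E eqxx scale1r.
    by rewrite -{1}[U_(j)%MM]add0m addmK mpolyX0 mulr1.
  rewrite tnth_mktuple mderivD mderivC addr0 mderivX mnm1E (negbTE ij) scale0r.
  by rewrite mulr0.
by rewrite mcoeff_deriv mnm0E mulr1n add0m.
Qed.

Lemma low_shift_comp N p (q : n.-tuple A) : (forall i, (tnth q i).@[a] = a i) ->
  low N (shift p) -> low N (shift (p \mPo q)).
Proof.
move=> qa pN.
pose u : n.-tuple A := [tuple shift (tnth q i) - (a i)%:MP | i < n].
have -> : shift (p \mPo q) = shift p \mPo u.
  have E : polyend_comp q (shift_tuple a) = polyend_comp (shift_tuple a) u.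
    apply: eq_from_tnth => i; rewrite /polyend_comp !tnth_map !tnth_ord_tuple.
    rewrite comp_mpolyD comp_mpolyC comp_mpolyXU -tnth_nth tnth_mktuple.
    by rewrite subrK.
  by rewrite /shift comp_mpolyA E -comp_mpolyA.
apply: low_comp1 => // i m; rewrite ltnS leqn0 mdeg_eq0 => /eqP ->.
by rewrite tnth_mktuple mcoeffB shift_coeff0 qa mcoeffC eqxx mulr1 subrr.
Qed.

End Shift.

End LowDegree.

(** * Groups that contain the torus as a normal subgroup of finite index *)

Section Normalizer.
Context {k : fieldType} (char0 : [pchar k] =i pred0) {n r : nat}.
Local Notation A := {mpoly k[n]}.
Local Notation W := 'rV[int]_r.
Context (phi : ('I_r -> k) -> polyaut k n).
Local Notation phm := (fun t => polyaut_map (phi t)).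
Local Notation hom := (hom phm).
Hypothesis hom_dec : forall p, sum_of (fun q => exists c, hom c q) p.
Local Notation comp := (comp hom_dec).

(** A right action: matrices and Jacobians then multiply in the order of the group. *)
Definition act (g : polyaut k n) (p : A) : A := p \mPo polyaut_map g.

Lemma actM g h p : act (g * h)%g p = act h (act g p).
Proof. by rewrite /act comp_mpolyA. Qed.
Lemma act1 p : act 1%g p = p.
Proof. by rewrite /act comp_mpoly_id. Qed.
Lemma actK g p : act g^-1%g (act g p) = p.
Proof. by rewrite -actM mulgV act1. Qed.
Lemma actVK g p : act g (act g^-1%g p) = p.
Proof. by rewrite -actM mulVg act1. Qed.

Context (G : polyaut k n -> Prop).
Hypothesis GM : forall g h, G g -> G h -> G (g * h)%g.
Hypothesis GV : forall g, G g -> G g^-1%g.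
Hypothesis phiM : forall s t, tunit s -> tunit t ->
  phi (fun i => s i * t i) = (phi s * phi t)%g.
Hypothesis Gphi : forall t, tunit t -> G (phi t).
Hypothesis Gnorm : forall g t, G g -> tunit t ->
  exists t', tunit t' /\ (g * phi t = phi t' * g)%g.
Hypothesis Gfin : exists s : seq (polyaut k n), {in s, forall x, G x} /\
  forall g, G g -> exists t x, [/\ tunit t, x \in s & g = (phi t * x)%g].

Lemma act_hom0 g p : G g -> hom 0 p -> hom 0 (act g p).
Proof.
move=> Gg hp t ut; have [t' [ut' E]] := Gnorm Gg ut.
have := hp t' ut'; rewrite !tpow0 !scale1r => E'.
by rewrite -/(act (phi t) (act g p)) -actM E actM {2}/act E'.
Qed.

Lemma phiC s t : tunit s -> tunit t -> (phi s * phi t = phi t * phi s)%g.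
Proof.
move=> us ut; rewrite -!phiM //; congr phi; apply: funext => i; exact: mulrC.
Qed.

(** Normality only shows that each [phi t] multiplies [act g p] by some scalar. Any non-zero weight
    component of [act g p] is multiplied by the same scalar, which is therefore given by a
    character. *)
Lemma act_hom g c p : G g -> hom c p -> exists d, hom d (act g p).
Proof.
move=> Gg hp; have [p0|p0] := eqVneq p 0.
  by exists 0; rewrite p0 /act comp_mpoly0; exact: hom0.
set q := act g p.
have q0 : q != 0.
  by apply: contraNneq p0 => q0; rewrite -(actK g p) -/q q0 /act comp_mpoly0.
have key t : tunit t -> exists a, act (phi t) q = a *: q.
  move=> ut; have [t' [ut' E]] := Gnorm Gg ut; exists (tpow t' c).
  by rewrite /q -actM E actM [act (phi t') p]hp // /act comp_mpolyZ.
have [d qd] : exists d, comp q d != 0.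
  apply: contrapT => h; case/negP: q0.
  apply/eqP/(comp_eq0 (hom_dec := hom_dec)) => d.
  by apply: contrapT => /eqP qd; apply: h; exists d.
exists d; move=> t ut; have [a aE] := key t ut; rewrite -/(act (phi t) q) aE.
congr (_ *: _).
have V : stable phm (fun x => act (phi t) x = a *: x).
  split=> [|b x y xE yE|t' x ut' xE].
  - by rewrite /act comp_mpoly0 scaler0.
  - rewrite /act comp_mpolyD comp_mpolyZ -/(act _ _) xE -/(act _ y) yE.
    by rewrite scalerDr !scalerA mulrC.
  by rewrite -[x \mPo _]/(act (phi t') x) -actM (phiC ut' ut) actM xE /act comp_mpolyZ.
have := comp_stable char0 hom_dec d V aE.
rewrite [act _ _](comp_hom hom_dec q d) // => /eqP.
rewrite -subr_eq0 -scalerBl scaler_eq0 (negbTE qd) orbF subr_eq0.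
by move/eqP.
Qed.

(** A function on [G] that is constant on the cosets of the torus has finitely many values.
    Averaging over [G / T] becomes a sum over them. *)
Lemma finite_orbit (X : eqType) (F : polyaut k n -> X) :
  (forall t g, tunit t -> G g -> F (phi t * g)%g = F g) ->
  exists S : seq X, uniq S /\ forall x, x \in S <-> exists2 g, G g & F g = x.
Proof.
move=> FT; have [s [sG Gs]] := Gfin.
exists (undup [seq F x | x <- s]); split; first exact: undup_uniq.
move=> x; rewrite mem_undup; split=> [/mapP[g /sG Gg ->]|[g Gg <-]]; first by exists g.
by have [t [y [ut ys ->]]] := Gs g Gg; rewrite FT ?map_f //; exact: sG.
Qed.

(** * Linearization at the fixed point *)

Section ConstantInvariants.
Hypothesis inv_cst : forall p, hom 0 p -> exists c : k, p = c%:MP.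

(** The product is an invariant, hence a constant; if it were non-zero, [p] would be a unit, hence
    of weight 0. *)
Lemma hom_opp_mul0 c p q : c != 0 -> hom c p -> hom (- c) q -> p * q = 0.
Proof.
move=> c0 hp hq; have := homM hp hq; rewrite subrr => /inv_cst[b pq].
have [b0|b0] := eqVneq b 0; first by rewrite pq b0 mpolyC0.
have up : p \is a GRing.unit.
  by apply/unitrPr; exists (b^-1 *: q); rewrite -scalerAr pq -mul_mpolyC -mpolyCM mulVf.
move: up; rewrite mpoly_unit_msize => /msize_poly1P[e e0 pE].
have pn0 : p != 0 by rewrite pE mpolyC_eq0.
by case/negP: c0; apply/eqP/(hom_uniq char0 pn0 hp); rewrite pE; exact: homC.
Qed.

Definition fixed_pt (i : 'I_n) : k := (comp 'X_i 0)@_0%MM.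
Local Notation a := fixed_pt.

(** By [hom_opp_mul0] the projection to weight 0 is multiplicative. It is thus a homomorphism of
    algebras to the constants, that is, the evaluation at a point. *)
Lemma comp0_eval p : comp p 0 = (p.@[a])%:MP.
Proof.
elim/mpoly_alg_ind: p => [c|i|p q IHp IHq|p q IHp IHq].
- by rewrite (comp_of_hom char0 hom_dec 0 (homC _ c)) eqxx mevalC.
- have [c E] := inv_cst (comp_hom hom_dec 'X_i 0).
  by rewrite mevalXU /fixed_pt E mcoeffC eqxx mulr1.
- by rewrite compD // IHp IHq mevalD mpolyCD.
rewrite mevalM mpolyCM -IHp -IHq.
have [hq [s [us qs qE]]] := compP hom_dec q.
rewrite {1}qE mulr_sumr comp_sum //.
transitivity (\sum_(e <- s) if e == 0 then comp p 0 * comp q 0 else 0).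
  apply: eq_bigr => e _; rewrite (comp_mul_hom char0 hom_dec p 0 (hq e)) sub0r.
  case: eqVneq => [->|e0]; first by rewrite oppr0.
  by rewrite mulrC; apply: (hom_opp_mul0 e0 (hq e)); exact: comp_hom.
have [s0|s0] := boolP (0 \in s).
  rewrite (bigD1_seq 0) //= eqxx big1 ?addr0 // => e /negbTE ->.
  by [].
rewrite (qs 0 s0) mulr0 big1 // => e _; by case: ifP.
Qed.

Lemma hom_eval0 c p : c != 0 -> hom c p -> p.@[a] = 0.
Proof.
move=> c0 hp; have := comp0_eval p; rewrite (comp_of_hom char0 hom_dec 0 hp) eq_sym (negbTE c0).
by move/esym/eqP; rewrite mpolyC_eq0 => /eqP.
Qed.

Lemma act_eval g p : G g -> (act g p).@[a] = p.@[a].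
Proof.
move=> Gg; elim: (hom_dec p) => [|x y [c hx] _ IH].
  by rewrite /act comp_mpoly0.
rewrite /act comp_mpolyD !mevalD -/(act g y) IH; congr (_ + _).
have [c0|c0] := eqVneq c 0.
  have hx0 : hom 0 x by rewrite -c0.
  by have [b ->] := inv_cst hx0; rewrite comp_mpolyC.
have [x0|x0] := eqVneq x 0; first by rewrite x0 comp_mpoly0.
rewrite (hom_eval0 c0 hx); have [d hd] := act_hom Gg hx.
apply: (hom_eval0 _ hd); apply: contraNneq c0 => d0; apply/eqP.
apply: (hom_uniq char0 x0 hx); rewrite -(actK g x); apply: act_hom0; first exact: GV.
by rewrite -d0.
Qed.

Lemma act_fixed g i : G g -> (tnth (polyaut_map g) i).@[a] = a i.
Proof.
by move=> Gg; rewrite -(mevalXU a i) -(act_eval 'X_i Gg) /act comp_mpolyXU -tnth_nth.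
Qed.

(** The elements of weight [c] generate a finitely generated ideal. In an expression by generators
    of weight [c] only the parts of weight 0 of the coefficients count, and these are constants; so
    the degrees in weight [c] are bounded. *)
Lemma hom_bounded c : exists D, forall p, hom c p -> low D (shift a p) -> p = 0.
Proof.
have [s [hs sp]] := mpoly_fg (hom c).
exists (\max_(x <- s) msize (shift a x))%N => p hp lp.
have [l [ls pE]] := sp p hp.
have {pE} [f pE] : exists f : A * A -> k, p = \sum_(x <- l) f x *: x.2.
  have /choice[f fP] : forall x : A * A, exists e : k, comp x.1 0 = e%:MP.
    by move=> x; apply: inv_cst; exact: comp_hom.
  exists f; have := comp_of_hom char0 hom_dec c hp; rewrite eqxx => <-.
  rewrite {1}pE comp_sum // !big_seq; apply: eq_bigr => x xl.
  by rewrite (comp_mul_hom char0 hom_dec _ _ (hs _ (ls _ xl))) subrr fP mul_mpolyC.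
rewrite -(shiftK a p) (low_eq0 lp) ?comp_mpoly0 //.
rewrite pE /shift raddf_sum /=; apply: leq_trans (msize_sum _ _ _) _.
apply/bigmax_leqP_seq => x xl _; rewrite comp_mpolyZ.
apply: leq_trans (msizeZ_le _ _) _.
exact: (@leq_bigmax_seq _ s predT (fun x => msize (shift a x)) x.2 (ls x xl) isT).
Qed.

(** A homogeneous [p] is approximated by polynomials in [z] to higher and higher order at [a].
    Projecting each correction to the weight of [p] keeps the error homogeneous, so [hom_bounded]
    ends the process. *)
Lemma graded_nakayama (z : n.-tuple A) (w : 'I_n -> W) :
  (forall i, hom (w i) (tnth z i)) -> (forall i, (tnth z i).@[a] = 0) ->
  (\matrix_(i, j) (tnth z i)^`M(j).@[a]) \in unitmx ->
  forall p, exists P, p = P \mPo z.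
Proof.
set B := \matrix_(i, j) _ => hz za uB.
pose V p := exists P, p = P \mPo z.
have SV : stable phm V.
  split=> [|c _ _ [P ->] [Q ->]|t _ ut [P ->]].
  - by exists 0; rewrite comp_mpoly0.
  - by exists (c *: P + Q); rewrite comp_mpolyD comp_mpolyZ.
  exists (P \mPo [tuple tpow t (w i) *: 'X_i | i < n]); rewrite !comp_mpolyA.
  congr (comp_mpoly _ P); apply: eq_from_tnth => i; rewrite /polyend_comp !tnth_map !tnth_ord_tuple.
  by rewrite comp_mpolyZ comp_mpolyXU -tnth_nth hz.
have SU N : stable phm (fun p => low N (shift a p)).
  split=> [|c p q pN qN|t p ut pN].
  - by rewrite /shift comp_mpoly0; exact: low0.
  - by rewrite /shift comp_mpolyD comp_mpolyZ; exact: lowA.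
  by apply: low_shift_comp => // i; apply: act_fixed; exact: Gphi.
have step N p c : hom c p -> low N (shift a p) ->
    exists u, [/\ V u, hom c u & low N.+1 (shift a (p - u))].
  move=> hp pN.
  (* To first order at [a], the matrix [invmx B] applied to [z] gives the centred coordinates.
     Substituting this in the Taylor expansion of [p] leaves an error of order [N.+1]. *)
  pose L : n.-tuple A := [tuple \sum_j (invmx B) i j *: 'X_j | i < n].
  pose v := (shift a p \mPo L) \mPo z.
  have Vv : V v by exists (shift a p \mPo L).
  exists (comp v c); split; [exact: comp_stable|exact: comp_hom|].
  have pv : low N.+1 (shift a (p - v)); last first.
    have := comp_stable char0 hom_dec c (SU N.+1) pv.
    rewrite -scaleN1r compD // (comp_of_hom char0 hom_dec c hp) eqxx.
    rewrite [comp (-1 *: v) c](_ : _ = - comp v c) //.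
    apply/eqP; rewrite scaleN1r -addr_eq0 -compD // addNr comp0 //.
  rewrite /shift comp_mpolyB -/(shift a p) -/(shift a v).
  have -> : shift a v = shift a p \mPo [tuple \sum_j (invmx B) i j *: shift a (tnth z j) | i < n].
    rewrite /v /shift !comp_mpolyA; congr (comp_mpoly _ p).
    congr (polyend_comp _ _).
    apply: eq_from_tnth => i; rewrite /polyend_comp !tnth_map !tnth_ord_tuple raddf_sum /=.
    apply: eq_bigr => j _; rewrite comp_mpolyZ comp_mpolyXU -tnth_nth.
    by rewrite !tnth_map tnth_ord_tuple.
  rewrite -{1}[shift a p]comp_mpoly_id; apply: low_comp => // i.
  rewrite !tnth_mktuple.
  have zl j : low 1 (shift a (tnth z j)).
    by move=> m; rewrite ltnS leqn0 mdeg_eq0 => /eqP ->; rewrite shift_coeff0.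
  have Xl : low 1 ('X_i : A).
    by move=> m; rewrite ltnS leqn0 mdeg_eq0 => /eqP ->; rewrite mcoeffX mnm1_eq0.
  have Sl : low 1 (\sum_j (invmx B) i j *: shift a (tnth z j)).
    by apply: low_sum => j _; rewrite -[X in low _ X]addr0; apply: lowA => //; exact: low0.
  split=> // m; rewrite ltnS leq_eqVlt => /predU1P[/eqP|]; last exact: lowB.
  case/mdeg1P => j /eqP ->; rewrite mcoeffB raddf_sum /= mcoeffXU.
  have /matrixP/(_ i j) := mulVmx uB; rewrite !mxE => E.
  rewrite -[X in X - _]E -sumrB big1 // => l _.
  by rewrite mcoeffZ shift_coeff1 mxE subrr.
have iter N p c : hom c p -> exists u, [/\ V u, hom c u & low N (shift a (p - u))].
  move=> hp; elim: N => [|N [u [Vu hu lu]]].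
    by exists 0; split=> //; [exists 0; rewrite comp_mpoly0|exact: hom0].
  have [v [Vv hv lv]] := step N (p - u) c (homB hp hu) lu.
  exists (u + v); split; [|exact: homD|by rewrite opprD addrA].
  by rewrite -[u]scale1r; case: SV => _ VA _; exact: VA.
move=> p; elim: (hom_dec p) => [|x y [c hx] _ [Q ->]].
  by exists 0; rewrite comp_mpoly0.
have [D hD] := hom_bounded c; have [u [[P uE] hu lu]] := iter D x c hx.
have /eqP := hD _ (homB hx hu) lu; rewrite subr_eq0 => /eqP ->.
by exists (P + Q); rewrite comp_mpolyD uE.
Qed.

Local Notation cmx := (map_mx (@mpolyC n k)).
Definition act_mx g (Y : 'cV[A]_n) : 'cV[A]_n := map_mx (act g) Y.
Definition grad (Y : 'cV[A]_n) : 'M[k]_n := \matrix_(i, j) (Y i 0)^`M(j).@[a].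
Definition jac g : 'M[k]_n := \matrix_(i, j) (tnth (polyaut_map g) i)^`M(j).@[a].

Lemma grad_act g Y : G g -> grad (act_mx g Y) = grad Y *m jac g.
Proof.
move=> Gg; apply/matrixP => i j; rewrite !mxE mderiv_comp rmorph_sum /=.
apply: eq_bigr => l _; rewrite !mxE mevalM; congr (_ * _).
exact: act_eval.
Qed.

Lemma grad_mul M Y : grad (cmx M *m Y) = M *m grad Y.
Proof.
apply/matrixP => i j; rewrite !mxE (raddf_sum (mderiv j)) (raddf_sum (meval a)) /=.
by apply: eq_bigr => l _; rewrite !mxE mderiv_mulC mevalM mevalC.
Qed.

Lemma act_mx_mul g M Y : act_mx g (cmx M *m Y) = cmx M *m act_mx g Y.
Proof.
apply/matrixP => i j; rewrite !mxE /act raddf_sum /=; apply: eq_bigr => l _.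
by rewrite !mxE rmorphM /= comp_mpolyC.
Qed.

Lemma act_mxM g h Y : act_mx (g * h)%g Y = act_mx h (act_mx g Y).
Proof. by apply/matrixP => i j; rewrite !mxE actM. Qed.

Lemma jacM g h : G g -> G h -> jac (g * h)%g = jac g *m jac h.
Proof.
move=> Gg Gh.
have E f : jac f = grad (act_mx f (\col_i 'X_i)).
  by apply/matrixP => i j; rewrite !mxE /act comp_mpolyXU -tnth_nth.
by rewrite E act_mxM grad_act // -E.
Qed.

Lemma jac1 : jac 1%g = 1%:M.
Proof.
by apply/matrixP => i j; rewrite !mxE tnth_mktuple mderivXU mevalC.
Qed.

Lemma jac_unit g : G g -> jac g \in unitmx.
Proof.
move=> Gg; have := jacM Gg (GV Gg); rewrite mulgV jac1 => /esym/mulmx1_unit.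
by case.
Qed.

Definition linearized (y : polyaut k n) :=
  (forall i, exists c, hom c (tnth (polyaut_map y) i)) /\
  (forall g, G g -> exists M : 'M[k]_n, forall i,
     act g (tnth (polyaut_map y) i) = \sum_j M i j *: tnth (polyaut_map y) j).

Lemma polyaut_of_generators (z : n.-tuple A) :
  (forall i, exists P, 'X_i = P \mPo z) -> exists y : polyaut k n, polyaut_map y = z.
Proof.
move=> /choice[P PE]; pose psi : polyend k n := [tuple P i | i < n].
have E : polyend_comp psi z = polyend_id.
  by apply: eq_from_tnth => i; rewrite !tnth_mktuple -PE.
have pf : inverse_pair (z, psi).
  by rewrite /inverse_pair /= E (polyend_left_inverse char0 E) eqxx.
by exists (Polyaut pf).
Qed.

Lemma linearize_constant_invariants : exists y, linearized y.
Proof.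
pose gr (p : A) : 'rV[k]_n := \row_j p^`M(j).@[a].
have grD p q : gr (p + q) = gr p + gr q.
  by apply/rowP => j; rewrite !mxE mderivD mevalD.
(* The gradients of homogeneous elements span, since the variables are sums of such elements. *)
have [v hv|B uB Bp] := @basis_pick k n (fun w => exists c p, hom c p /\ w = gr p).
  have h p : gr p *m v = 0.
    elim: (hom_dec p) => [|x y [c hx] _ IH].
      by rewrite (_ : gr 0 = 0) ?mul0mx //; apply/rowP => j; rewrite !mxE mderiv0 meval0.
    by rewrite grD mulmxDl IH addr0; apply: hv; exists c, x.
  apply/matrixP => i j; have /matrixP/(_ 0 j) := h 'X_i; rewrite !mxE => <-.
  rewrite (bigD1 i) //= big1 ?addr0 => [|l li]; rewrite !mxE mderivXU mevalC.
    by rewrite eqxx mul1r.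
  by rewrite eq_sym (negbTE li) mul0r.
have [w /choice[p hp]] := choice Bp.
have w0 i : w i != 0.
  apply/eqP => wi; have [hpi Bi] := hp i; rewrite wi in hpi.
  have [c pc] := inv_cst hpi.
  have : delta_mx 0 i *m B = 0 :> 'rV_n.
    rewrite -rowE Bi pc; apply/rowP => j; by rewrite !mxE mderivC meval0.
  move/(congr1 (mulmx^~ (invmx B))); rewrite mulmxK // mul0mx => /matrixP/(_ 0 i).
  by rewrite !mxE !eqxx => /eqP; rewrite oner_eq0.
pose y : 'cV[A]_n := \col_i p i.
pose D t : 'M[k]_n := diag_mx (\row_i tpow t (w i)).
have gy : grad y = B.
  apply/row_matrixP => i; have [_ ->] := hp i; by apply/rowP => j; rewrite !mxE.
have acty t : tunit t -> act_mx (phi t) y = cmx (D t) *m y.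
  move=> ut; apply/matrixP => i j; rewrite mxE mxE map_diag_mx mul_diag_mx !mxE.
  by have [hpi _] := hp i; rewrite /act hpi // mul_mpolyC.
have BJ t : tunit t -> B *m jac (phi t) = D t *m B.
  by move=> ut; rewrite -gy -grad_act ?acty ?grad_mul //; exact: Gphi.
pose Y := cmx (invmx B) *m y.
have gY : grad Y = 1%:M by rewrite grad_mul gy mulVmx.
have actY t : tunit t -> act_mx (phi t) Y = cmx (jac (phi t)) *m Y.
  move=> ut; have E : invmx B *m D t *m B = jac (phi t).
    by rewrite -mulmxA -(BJ t ut) mulKmx.
  rewrite /Y act_mx_mul (acty t ut) !mulmxA -!map_mxM -E.
  by rewrite (mulmxK uB).
(* The twisted action whose fixed columns transform by the linear part of [h] at [a]. The torus
   fixes [Y], so the orbit of [Y] under [G] is finite and its average [Z] is fixed by all of [G]. *)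
pose T h (Z : 'cV[A]_n) := cmx (invmx (jac h)) *m act_mx h Z.
have TM g h Z : G g -> G h -> T (g * h)%g Z = T h (T g Z).
  move=> Gg Gh; rewrite /T act_mxM act_mx_mul mulmxA -map_mxM (jacM Gg Gh).
  by rewrite (invmx_mul (jac_unit Gg) (jac_unit Gh)).
have [|S [uS SE]] := @finite_orbit _ (fun g => T g Y).
  move=> t g ut Gg; rewrite (TM _ _ _ (Gphi ut) Gg) {2}/T (actY t ut) mulmxA.
  by rewrite -map_mxM (mulVmx (jac_unit (Gphi ut))) map_mx1 mul1mx.
have T1 h Z : G h -> T h^-1%g (T h Z) = Z.
  move=> Gh; rewrite -(TM _ _ _ Gh (GV Gh)) mulgV /T jac1 invmx1 map_mx1 mul1mx; apply/matrixP => i j.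
  by rewrite mxE act1.
have permS h : G h -> perm_eq [seq T h Z | Z <- S] S.
  move=> Gh; have ui : uniq [seq T h Z | Z <- S].
    rewrite map_inj_uniq => [|Z Z' E]; first exact: uS.
    by rewrite -(T1 h Z Gh) E (T1 h Z' Gh).
  have sub : {subset [seq T h Z | Z <- S] <= S}.
    move=> _ /mapP[Z /SE[g Gg <-] ->]; apply/SE; exists (g * h)%g; first exact: GM.
    exact: TM.
  apply: uniq_perm; [exact: ui|exact: uS|].
  by have [|_] := uniq_min_size ui sub; first by rewrite size_map.
pose N := size S.
have N0 : N%:R != 0 :> k.
  rewrite ((pcharf0P _).1 char0) -lt0n /N; have : T (phi (fun=> 1)) Y \in S.
    by apply/SE; exists (phi (fun=> 1)) => //; apply: Gphi => i; rewrite oner_neq0.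
  by case: S {uS SE permS N}.
pose Z := cmx (N%:R^-1)%:M *m \sum_(z <- S) z.
have Tscale h c X : T h (cmx c%:M *m X) = cmx c%:M *m T h X.
  by rewrite /T act_mx_mul !mulmxA -!map_mxM scalar_mxC.
have Tsum h (s : seq 'cV[A]_n) : T h (\sum_(z <- s) z) = \sum_(z <- s) T h z.
  rewrite /T -mulmx_sumr; congr (_ *m _); apply/matrixP => i j.
  by rewrite mxE !summxE /act raddf_sum; apply: eq_bigr => z _; rewrite mxE.
have TZ h : G h -> T h Z = Z.
  move=> Gh; rewrite /Z Tscale Tsum; congr (_ *m _).
  by rewrite -[RHS](perm_big _ (permS h Gh)) big_map.
have actZ h : G h -> act_mx h Z = cmx (jac h) *m Z.
  by move=> Gh; rewrite -{2}(TZ h Gh) mulmxA -map_mxM (mulmxV (jac_unit Gh)) map_mx1 mul1mx.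
have gZ : grad Z = 1%:M.
  rewrite grad_mul; have -> : grad (\sum_(z <- S) z) = \sum_(z <- S) grad z.
    apply/matrixP => i j; rewrite mxE !summxE (raddf_sum (mderiv j)) (raddf_sum (meval a)) /=.
    by apply: eq_bigr => z _; rewrite mxE.
  rewrite big_seq (eq_bigr (fun=> 1%:M)) => [|z /SE[g Gg <-]]; last first.
    by rewrite grad_mul (grad_act _ Gg) gY mul1mx (mulVmx (jac_unit Gg)).
  rewrite -big_seq big_const_seq count_predT iter_addr_0 -/N -scaler_nat scalemx1.
  by rewrite -scalar_mxM mulVf.
(* The change of basis by [B] diagonalizes the torus again, which makes the entries homogeneous. *)
pose zt : n.-tuple A := [tuple (cmx B *m Z) i 0 | i < n].
have zE : \col_i tnth zt i = cmx B *m Z.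
  by apply/matrixP => i j; rewrite mxE tnth_mktuple ord1.
have hz i : hom (w i) (tnth zt i).
  move=> t ut; have := actZ _ (Gphi ut) => /(congr1 (mulmx (cmx B))).
  rewrite -act_mx_mul mulmxA -map_mxM (BJ t ut) map_mxM -mulmxA -zE => /matrixP/(_ i 0).
  by rewrite map_diag_mx mul_diag_mx !mxE mul_mpolyC.
have gz : \matrix_(i, j) (tnth zt i)^`M(j).@[a] = B.
  have <- : grad (\col_i tnth zt i) = B by rewrite zE grad_mul gZ mulmx1.
  by apply/matrixP => i j; rewrite !mxE.
have [|yy yE] := @polyaut_of_generators zt.
  move=> i; apply: (graded_nakayama hz); last by rewrite gz.
  by move=> j; exact: (hom_eval0 (w0 j) (hz j)).
exists yy; rewrite /linearized yE; split=> [i|g Gg]; first by exists (w i).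
have [M ME] : exists M : 'M[k]_n, B *m jac g = M *m B.
  by exists (B *m jac g *m invmx B); rewrite mulmxKV.
exists M => i; have := actZ _ Gg => /(congr1 (mulmx (cmx B))).
rewrite -act_mx_mul mulmxA -map_mxM ME map_mxM -mulmxA -zE.
move=> /matrixP/(_ i 0); rewrite !mxE => ->; apply: eq_bigr => j _.
by rewrite !mxE mul_mpolyC.
Qed.

End ConstantInvariants.
End Normalizer.

(** * Non-constant invariants *)

Lemma monomials_dep (k : fieldType) (char0 : [pchar k] =i pred0) n N (p : 'I_N -> {mpoly k[n]}) :
  (n < N)%N -> exists M (c : {ffun 'I_N -> 'I_M} -> k),
    (exists al, c al != 0) /\ \sum_al c al *: \prod_i p i ^+ al i = 0.
Proof.
(* Exponents below [M] give [M ^ N] monomials, determined by [(K * M) ^ n] values; [N > n] and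
   [M > K ^ n] force a relation. *)
move=> nN; pose K := (\sum_i (msize (p i) + 1)).+1; pose M := (K ^ n).+1.
pose F (al : {ffun 'I_N -> 'I_M}) := \prod_i p i ^+ al i.
have szF al : (msize (F al) <= K * M)%N.
  have : (msize (F al) <= 1 + \sum_i M * (msize (p i) + 1))%N.
    rewrite /F; elim/big_rec2: _ => [|i a q _ IH]; first by rewrite msize1.
    apply: leq_trans (msizeM_leq _ _) _; rewrite addnCA leq_add //.
    apply: leq_trans (msizeX_leq _ _) _; rewrite mulnDr muln1 leq_add //.
    by rewrite leq_mul2r ltnW ?orbT.
  move=> h; apply: leq_trans h _.
  by rewrite -big_distrr /= /K mulSn [(_ * M)%N]mulnC leq_add2r.
have [|c h] := mpoly_dep char0 szF; last by exists M, c.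
rewrite card_ffun !card_ord expnMn; apply: leq_trans (leq_pexp2l (ltn0Sn _) nN).
by rewrite expnS ltn_mul2r ltnS leqnn andbT expn_gt0.
Qed.

(** * Polynomials in a single element *)

Section PolyEval.
Context {k : closedFieldType} {n : nat}.
Local Notation A := {mpoly k[n]}.

Definition ev (p : A) (Q : {poly k}) : A := (map_poly (@mpolyC n k) Q).[p].

HB.instance Definition _ p :=
  GRing.RMorphism.copy (ev p) (horner_eval p \o map_poly (@mpolyC n k)).

Lemma evX p : ev p 'X = p. Proof. by rewrite /ev map_polyX hornerX. Qed.
Lemma evC p c : ev p c%:P = c%:MP. Proof. by rewrite /ev map_polyC hornerC. Qed.
Lemma evZ p c Q : ev p (c *: Q) = c *: ev p Q.
Proof. by rewrite -mul_polyC rmorphM /= evC mul_mpolyC. Qed.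

(** Over a closed field the elements of the subring generated by [p] are products of translates of
    [p], so divisibility by a prime is tested on the fibres of [p]. *)
Lemma ev_factor p Q : exists s : seq k, (all (root Q) s || (Q == 0)) /\
  ev p Q = (lead_coef Q)%:MP * \prod_(z <- s) (p - z%:MP).
Proof.
have [s sE] := closed_field_poly_normal Q; exists s; split.
  have [//|Q0] := eqVneq Q 0; first by rewrite orbT.
  rewrite orbF; apply/allP => z zs; rewrite sE rootZ ?lead_coef_eq0 //.
  by rewrite root_prod_XsubC.
rewrite {1}sE evZ rmorph_prod mul_mpolyC; congr (_ *: _).
by apply: eq_bigr => z _; rewrite rmorphB /= evX evC.
Qed.

Lemma mpolyC_unit (c : k) : c != 0 -> (c%:MP : A) \is a GRing.unit.
Proof. by move=> c0; rewrite mpoly_unit_msize msizeC c0. Qed.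

Lemma primer_not_cst (q : A) (c : k) : primer q -> c != 0 -> ~ dvdr q c%:MP.
Proof.
case=> _ nq _ c0 [d E]; have := mpolyC_unit c0; rewrite E unitrM => /andP[_ uq].
by rewrite uq in nq.
Qed.

Lemma ev_root (q p : A) Q : primer q -> Q != 0 -> dvdr q (ev p Q) ->
  exists2 z, root Q z & dvdr q (p - z%:MP).
Proof.
move=> pq Q0; have [s [sQ ->]] := ev_factor p Q; rewrite (negbTE Q0) orbF in sQ.
have [_ _ pqM] := pq; case/pqM => [h|].
  by case: (primer_not_cst pq _ h); rewrite lead_coef_eq0.
rewrite big_seq => /(primer_prod pq)[z zs h]; exists z => //.
exact: (allP sQ).
Qed.

Lemma ev_neq0 p Q : (1 < msize p)%N -> Q != 0 -> ev p Q != 0.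
Proof.
move=> p1 Q0; have [s [_ ->]] := ev_factor p Q.
rewrite mulf_neq0 ?mpolyC_eq0 ?lead_coef_eq0 // prodf_seq_neq0.
apply/allP => z _ /=; rewrite subr_eq0; apply: contraTneq p1 => ->.
by rewrite msizeC; case: eqP.
Qed.

Lemma ev_inj p : (1 < msize p)%N -> injective (ev p).
Proof.
move=> p1 Q R E; apply/eqP; rewrite -subr_eq0; apply: contraT => h.
by have := ev_neq0 p1 h; rewrite rmorphB /= E subrr eqxx.
Qed.

Lemma dvdr_ev_sub (p : A) c Q : dvdr (p - c%:MP) (ev p Q - (Q.[c])%:MP).
Proof.
have /factor_theorem[R E] : root (Q - (Q.[c])%:P) c.
  by rewrite rootE hornerD hornerN hornerC subrr.
exists (ev p R); have := congr1 (ev p) E.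
by rewrite rmorphM !rmorphB /= evX !evC.
Qed.

Lemma nonunit_msize (p : A) : p != 0 -> p \isn't a GRing.unit -> (1 < msize p)%N.
Proof. by rewrite mpoly_unit_msize -msize_poly_eq0; case: (msize p) => [|[|]]. Qed.

Lemma irred_msize (p : A) : irred p -> (1 < msize p)%N.
Proof. by case=> p0 np _; exact: nonunit_msize. Qed.

Lemma irred_assoc (p q : A) : irred p -> irred q -> dvdr p q ->
  exists2 c, c != 0 & q = c *: p.
Proof.
move=> ip iq [d E]; have [_ np _] := ip; have [_ _ hq] := iq.
case: (hq _ _ E) => [|up]; last by rewrite up in np.
rewrite mpoly_unit_msize => /msize_poly1P[c c0 dE].
by exists c => //; rewrite E dE mul_mpolyC.
Qed.

Lemma irred_scale (c : k) (p : A) : c != 0 -> irred p -> irred (c *: p).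
Proof.
move=> c0 [p0 np hp]; split.
- by rewrite scaler_eq0 negb_or c0.
- by rewrite -mul_mpolyC unitrM negb_and np orbT.
move=> x y E; have [ux|uy] : c^-1 *: x \is a GRing.unit \/ y \is a GRing.unit.
- by apply: hp; rewrite -scalerAl -E scalerA mulVf // scale1r.
- by left; move: ux; rewrite -mul_mpolyC unitrM => /andP[].
- by right.
Qed.

Lemma dvdr_scale (c : k) (p q : A) : c != 0 -> dvdr (c *: p) q <-> dvdr p q.
Proof.
move=> c0; split=> -[d ->].
  by exists (c *: d); rewrite -scalerAr -scalerAl.
by exists (c^-1 *: d); rewrite -scalerAl -scalerAr scalerA mulVf ?scale1r.
Qed.

(* Cancelling the irreducible factors of [u] one at a time. *)
Lemma coprime_dvdr (u x y : A) : u != 0 ->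
  (forall q, irred q -> dvdr q u -> ~ dvdr q y) -> dvdr u (x * y) -> dvdr u x.
Proof.
move=> /mpoly_atomic[c [s [uc irs ->]]] {u}.
elim: s irs x => [|q s IH] irs x cop.
  by rewrite big_nil mulr1 => _; exists (x * c^-1); rewrite mulrVK.
have irq : irred q by apply: irs; exact: mem_head.
have [q0 nq pq] := mpoly_gauss irq.
have qu : dvdr q (c * \prod_(j <- q :: s) j).
  by exists (c * \prod_(j <- s) j); rewrite big_cons mulrA mulrAC.
move=> [d E]; have /pq[[x' xE]|/(cop q irq qu)//] : dvdr q (x * y).
  by rewrite E; apply: dvdr_mull.
have [|z qs zs||z zE] := IH _ x'.
- by move=> z zs; apply: irs; rewrite inE zs orbT.
- apply: cop => //; apply: dvdr_trans zs _; exists q.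
  by rewrite big_cons mulrCA.
- exists d; apply: (mulfI q0); rewrite mulrCA mulrA -xE.
  by rewrite E big_cons !mulrA [q * d]mulrC -!mulrA; congr (_ * _); rewrite mulrCA.
by exists z; rewrite xE zE big_cons -!mulrA; congr (_ * (_ * _)); rewrite mulrC.
Qed.

End PolyEval.

Section CaseTwo.
Context {k : closedFieldType} (char0 : [pchar k] =i pred0) {n r : nat}.
Local Notation A := {mpoly k[n]}.
Local Notation W := 'rV[int]_r.
Context (phi : ('I_r -> k) -> polyaut k n).
Local Notation phm := (fun t => polyaut_map (phi t)).
Local Notation hom := (hom phm).
Hypothesis hom_dec : forall p, sum_of (fun q => exists c, hom c q) p.
Local Notation comp := (comp hom_dec).
Hypothesis phi_faithful : forall t, tunit t -> phm t = polyend_id -> forall i, t i = 1.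

Lemma hom_comp_eq p q : (forall c, comp p c = comp q c) -> p = q.
Proof.
move=> h; apply/eqP; rewrite -subr_eq0; apply/eqP/(comp_eq0 (hom_dec := hom_dec)) => c.
rewrite compD // h -compD // subrr; exact: comp0.
Qed.

Lemma comp_sum_supp q (S : seq W) : uniq S -> (forall c, c \notin S -> comp q c = 0) ->
  q = \sum_(e <- S) comp q e.
Proof.
move=> uS hS; apply: hom_comp_eq => c; rewrite comp_sum //.
have E e : comp (comp q e) c = if c == e then comp q e else 0.
  exact: (comp_of_hom char0 hom_dec c (comp_hom hom_dec q e)).
have [cS|cS] := boolP (c \in S).
  rewrite (bigD1_seq c) //= E eqxx big1 ?addr0 // => e ec.
  by rewrite E eq_sym (negbTE ec).
rewrite hS // big_seq big1 // => e eS; rewrite E.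
by case: eqP => // ce; rewrite ce eS in cS.
Qed.

Lemma comp_mulE p q (S : seq W) c : uniq S -> (forall e, e \notin S -> comp q e = 0) ->
  comp (p * q) c = \sum_(e <- S) comp p (c - e) * comp q e.
Proof.
move=> uS hS; rewrite {1}(comp_sum_supp uS hS) mulr_sumr comp_sum //.
by apply: eq_bigr => e _; exact: (comp_mul_hom char0 hom_dec p c (comp_hom hom_dec q e)).
Qed.

(** The infinitesimal action of a cocharacter. It is prescribed on the variables; additivity of [l]
    and the Leibniz rule extend the formula to products. *)
Lemma weight_vfield (l : W -> k) : {morph l : x y / x + y} ->
  exists E : 'I_n -> A, forall c p, hom c p -> vfield E p = l c *: p.
Proof.
move=> lD; have l0 : l 0 = 0 by apply: (addrI (l 0)); rewrite -lD !addr0.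
have /choice[E EP] : forall i : 'I_n, exists e : A, forall c, comp e c = l c *: comp 'X_i c.
  move=> i; have [hi [s [us si iE]]] := compP hom_dec 'X_i.
  exists (\sum_(c <- s) l c *: comp 'X_i c) => c.
  have hf d : hom d (l d *: comp 'X_i d) by exact: homZ.
  have fs d : d \notin s -> l d *: comp 'X_i d = 0 by move=> /si ->; rewrite scaler0.
  exact: (comp_unique char0 hom_dec hf us fs erefl c).
exists E => c p hp; suff key q d : comp (vfield E q) d = l d *: comp q d.
  apply: hom_comp_eq => d; rewrite key (comp_of_hom char0 hom_dec d hp).
  rewrite (comp_of_hom char0 hom_dec d (homZ _ hp)).
  by case: eqP => [->//|_]; rewrite scaler0.
elim/mpoly_alg_ind: q d => [b|i|x y IHx IHy|x y IHx IHy] d.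
- rewrite /vfield big1 => [|j _]; last by rewrite mderivC mulr0.
  rewrite comp0 // (comp_of_hom char0 hom_dec d (homC _ b)).
  by case: eqP => [->|_]; rewrite ?l0 ?scale0r ?scaler0.
- rewrite /vfield (bigD1 i) //= big1 ?addr0 => [|j ji].
    by rewrite mderivXU eqxx mpolyC1 mulr1 EP.
  by rewrite mderivXU eq_sym (negbTE ji) mpolyC0 mulr0.
- have -> : vfield E (x + y) = vfield E x + vfield E y.
    by rewrite /vfield -big_split; apply: eq_bigr => j _; rewrite mderivD mulrDr.
  by rewrite !compD // IHx IHy scalerDr.
have -> : vfield E (x * y) = vfield E x * y + x * vfield E y.
  rewrite /vfield mulr_suml mulr_sumr -big_split; apply: eq_bigr => j _ /=.
  by rewrite mderivM mulrDr; congr (_ + _); [exact: mulrA|exact: mulrCA].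
have [hy [s [us ys yE]]] := compP hom_dec y.
rewrite compD // (comp_mulE (vfield E x) d us ys) (comp_mulE x d us ys).
rewrite (comp_mulE x (q := vfield E y) d us) => [|e es]; last by rewrite IHy ys ?scaler0.
rewrite -big_split scaler_sumr; apply: eq_bigr => e _ /=.
rewrite IHx IHy -scalerAl -scalerAr -scalerDl; congr (_ *: _).
by rewrite -lD subrK.
Qed.

Lemma char0_intr_eq0 (z : int) : ((z%:~R : k) == 0) = (z == 0).
Proof.
case: z => m; first by rewrite ((pcharf0P _).1 char0).
by rewrite NegzE rmorphN oppr_eq0 ((pcharf0P _).1 char0) oppr_eq0.
Qed.

(* The derivation acting on each weight by a generic integer maps [p] and [q] to
   non-zero multiples, so that the identity contradicts [vfield_not_free]. *)
Lemma no_two_reducible_fibers c d p p' q q' (b : k) : c != 0 -> d != 0 -> b != 0 ->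
  hom c p -> hom (- c) p' -> hom d q -> hom (- d) q' -> p * p' - q * q' <> b%:MP.
Proof.
move=> c0 d0 b0 hp hp' hq hq' E.
have [m hm] := int_separate [:: c; d].
pose l (e : W) : k := ((e *m m) 0 0)%:~R.
have lD : {morph l : x y / x + y} by move=> x y; rewrite /l mulmxDl mxE rmorphD.
have lN x : l (- x) = - l x by rewrite /l mulNmx mxE rmorphN.
have lc : l c != 0 by rewrite char0_intr_eq0 hm // inE eqxx.
have ld : l d != 0 by rewrite char0_intr_eq0 hm // !inE eqxx orbT.
have [F FP] := weight_vfield lD.
apply: (@vfield_not_free _ char0 n F _ [:: ((b * l c)^-1 *: p', p); (- (b * l d)^-1 *: q', q)]).
- move=> f; apply: (sum_of_morph (f := id)) (hom_dec f) => // x [e hx].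
  by apply: sum_of1; exists (l e); exact: FP.
- move=> x; rewrite !inE => /orP[] /eqP ->; [exists (l c)|exists (l d)] => /=.
    by rewrite (FP _ _ hp) -lN (FP _ _ (homZ _ hp')).
  by rewrite (FP _ _ hq) -lN (FP _ _ (homZ _ hq')).
- rewrite big_cons big_seq1 /= (FP _ _ hp) (FP _ _ hq).
  rewrite -!scalerAl -!scalerAr !scalerA mulNr !invfM.
  rewrite -!mulrA !mulVf // !mulr1 scaleNr -scalerBr [p' * p]mulrC [q' * q]mulrC E.
  by rewrite -mul_mpolyC -mpolyCM mulVf // mpolyC1.
Qed.

Hypothesis nr : (n <= r.+1)%N.

(** * Fibres of an invariant of least degree *)

Section Invariant.
Context (w : A).
Hypotheses (w1 : (1 < msize w)%N) (hw : hom 0 w)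
  (wmin : forall p, hom 0 p -> (1 < msize p)%N -> (msize w <= msize p)%N).

Lemma msize_shift (p : A) (c : k) : (1 < msize p)%N -> msize (p - c%:MP) = msize p.
Proof.
move=> p1; apply/eqP; rewrite eqn_leq; apply/andP; split.
  apply: leq_trans (msizeD_le _ _) _; rewrite msizeN geq_max leqnn /= msizeC.
  by apply: leq_trans (leq_b1 _) (ltnW p1).
rewrite -{1}(subrK c%:MP p); have := msizeD_le (p - c%:MP) c%:MP.
rewrite msizeC leq_max => /orP[//|h]; move: p1.
by rewrite -{1}(subrK c%:MP p) ltnNge (leq_trans h (leq_b1 _)).
Qed.

Lemma hom_shift (p : A) c : hom 0 p -> hom 0 (p - c%:MP).
Proof. by move=> hp; apply: homB => //; exact: homC. Qed.

Lemma wsub_neq0 c : w - c%:MP != 0.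
Proof. by rewrite -msize_poly_eq0 msize_shift //; case: (msize w) w1. Qed.

Lemma hom_div c d p q : p * q != 0 -> hom c (p * q) -> hom d q -> hom (c - d) p.
Proof.
move=> pq0 hpq hq; have [e he] := hom_factor char0 hom_dec pq0 hpq.
suff -> : c - d = e by [].
by rewrite (hom_uniq char0 pq0 hpq (homM he hq)) addrK.
Qed.

(** The factors are homogeneous of opposite weights. Weight 0 would make [x] a non-constant
    invariant of smaller degree, against [wmin]. *)
Lemma reducible_fiber a : ~ irred (w - a%:MP) ->
  exists c x y, [/\ c != 0, hom c x, hom (- c) y & w - a%:MP = x * y].
Proof.
move=> nirr; have wa0 := wsub_neq0 a.
have nwa : w - a%:MP \isn't a GRing.unit.
  by rewrite mpoly_unit_msize msize_shift // gtn_eqF.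
have [x [y [E nx ny]]] : exists x y, [/\ w - a%:MP = x * y,
    x \isn't a GRing.unit & y \isn't a GRing.unit].
  apply: contrapT => h; apply: nirr; split=> // x y E.
  apply: contrapT => /not_orP[/negP nx /negP ny].
  by apply: h; exists x, y.
have xy0 : x * y != 0 by rewrite -E.
have hxy : hom 0 (x * y) by rewrite -E; exact: hom_shift.
have [c hx] := hom_factor char0 hom_dec xy0 hxy.
have yx0 : y * x != 0 by rewrite mulrC.
have hyx : hom 0 (y * x) by rewrite mulrC.
have hy : hom (- c) y by rewrite -sub0r; exact: (hom_div yx0 hyx hx).
exists c, x, y; split=> //; apply/eqP => c0; rewrite c0 in hx.
move: xy0; rewrite mulf_eq0 negb_or => /andP[x0 y0].
have gt1 := @nonunit_msize k n.
have := wmin hx (gt1 x x0 nx); rewrite -(msize_shift a w1) E msizeM //.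
by have := gt1 y y0 ny; have := gt1 x x0 nx; case: (msize x) (msize y) => [|u] [|v] //=; lia.
Qed.

Lemma reducible_fiber_uniq a b : ~ irred (w - a%:MP) -> ~ irred (w - b%:MP) -> a = b.
Proof.
move=> /reducible_fiber[c [x [y [c0 hx hy E]]]] /reducible_fiber[d [u [v [d0 hu hv F]]]].
apply/eqP; rewrite -subr_eq0; apply: contraT => ab.
have ba : b - a != 0 by rewrite -opprB oppr_eq0.
case: (no_two_reducible_fibers c0 d0 ba hx hy hu hv).
by rewrite -E -F mpolyCB opprB addrC addrA subrK addrC.
Qed.

Lemma exists_good_value (b : k) (Q : {poly k}) : Q != 0 -> exists2 a, a != b & Q.[a] != 0.
Proof.
move=> Q0; have : Q * ('X - b%:P) != 0 by rewrite mulf_neq0 ?polyXsubC_eq0.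
case/closed_nonrootP => a; rewrite rootM root_XsubC negb_or rootE => /andP[Qa ab].
by exists a.
Qed.

(** For each [N] the [N * N] products of a power of [w] with [u ^+ i * v ^+ (N.-1 - i)] share one
    weight. Since [n <= r.+1], one has [N ^ n.+1 <= N ^ r * (N * N)], the count required by
    [graded_dep]. *)
Lemma graded_relation c u v : hom c u -> hom c v ->
  exists N (F : 'I_N -> {poly k}), (exists i, F i != 0) /\
    \sum_i ev w (F i) * (u ^+ i * v ^+ (N.-1 - i)) = 0.
Proof.
move=> hu hv.
pose e N (j : 'I_N * 'I_N) := w ^+ j.1 * (u ^+ j.2 * v ^+ (N.-1 - j.2)).
have [|||N [b [[[l0 i0] b0] bE]]] := @graded_dep _ char0 _ _ _ hom_dec phi_faithful
  (fun N => ('I_N * 'I_N)%type : finType) e (fun N => c *+ N.-1)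
  (msize w + (msize u + msize v) + 3).
- move=> N [l i]; have iN : (i <= N.-1)%N by case: i => i /=; case: N {l}.
  have E : c *+ N.-1 = c *+ i + c *+ (N.-1 - i) by rewrite -mulrnDr subnKC.
  rewrite /e E -[_ + _]add0r; apply: homM.
    by have := homX l hw; rewrite mul0rn.
  by apply: homM; exact: homX.
- move=> N [l i] N0 /=; have pX q (j : nat) : (j <= N)%N -> (msize (q ^+ j : A) <= N * msize q + 1)%N.
    by move=> jN; apply: leq_trans (msizeX_leq _ _) _; rewrite leq_add2r leq_mul2r jN orbT.
  apply: leq_trans (msizeM_leq _ _) _.
  apply: leq_trans (leq_add (pX w l (ltnW (ltn_ord l))) (msizeM_leq _ _)) _.
  have iN : (i <= N)%N by exact: ltnW.
  have iN' : (N.-1 - i <= N)%N by lia.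
  apply: leq_trans (leq_add (leqnn _) (leq_add (pX u i iN) (pX v _ iN'))) _.
  by move: (msize w) (msize u) (msize v) => x y z; nia.
- move=> N; rewrite card_prod !card_ord mulnA -!expnSr.
  by have [->|N0] := posnP N; [rewrite exp0n|rewrite leq_pexp2l].
exists N, (fun i => \poly_(l < N) (if insub l is Some j then b (j, i) else 0)); split.
  exists i0; apply: contraNneq b0 => /polyP/(_ l0).
  by rewrite coef_poly ltn_ord valK coef0 => ->.
have E : \sum_i \sum_l b (l, i) *: e N (l, i) = 0.
  by rewrite exchange_big pair_bigA -[RHS]bE; apply: eq_bigr => -[].
rewrite -[RHS]E; apply: eq_bigr => i _; rewrite poly_def rmorph_sum mulr_suml; apply: eq_bigr => l _ /=.
by rewrite valK evZ rmorphXn /= evX -scalerAl.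
Qed.

(** * The ring of invariants and the special elements *)

Section Exceptional.
Hypothesis irrw : forall a, a != 0 -> irred (w - a%:MP).

(** In a relation between the powers of [f] over the polynomials in [w], put [w = a] with [a != 0]
    outside the zeros of one coefficient. The prime [w - a] then divides a non-zero polynomial in
    [f], hence some [f - z], and the quotient is an invariant of smaller degree. *)
Lemma inv_poly f : hom 0 f -> exists Q, f = ev w Q.
Proof.
have [m] := ubnP (msize f); elim: m f => // m IH f; rewrite ltnS => fm hf.
have [f1|f1] := leqP (msize f) 1.
  by exists (f@_0%MM)%:P; rewrite evC; exact: msize1_polyC.
have [N [F [[i0 F0] FE]]] := graded_relation hf (homC _ 1).
have [a a0 Fa] := exists_good_value 0 F0.
pose Q := \poly_(i < N) (if insub i is Some j then (F j).[a] else 0).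
have Q0 : Q != 0.
  by apply: contraNneq Fa => /polyP/(_ i0); rewrite coef_poly ltn_ord valK coef0 => ->.
have pw := mpoly_gauss (irrw a0).
have : dvdr (w - a%:MP) (ev f Q).
  rewrite -[ev f Q]opprK -[- ev f Q]add0r -FE opprB.
  rewrite /Q poly_def rmorph_sum -sumrB; apply: dvdr_sum => i _ /=.
  rewrite valK evZ rmorphXn /= evX mpolyC1 expr1n mulr1 -mul_mpolyC -mulrBl.
  have [x E] := dvdr_ev_sub w a (F i).
  by exists (x * - f ^+ i); rewrite -(opprB (ev w (F i))) E mulNr mulrN mulNr mulrAC.
case/(ev_root pw Q0) => z _ [f' f'E].
have fz : msize (f - z%:MP) = msize f by exact: msize_shift.
have ff0 : f' * (w - a%:MP) != 0 by rewrite -f'E -msize_poly_eq0 fz; case: (msize f) f1.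
have f'0 : f' != 0 by apply: contraNneq ff0 => ->; rewrite mul0r.
have [||Q' Q'E] := IH f'.
- apply: leq_trans fm; rewrite -fz f'E msizeM ?wsub_neq0 // msize_shift //.
  move: w1 f'0; rewrite -msize_poly_eq0; case: (msize w) (msize f') => [|[|x]] [|y] // _ _.
  by rewrite !addnS /=; lia.
- rewrite -[0]subr0; apply: (hom_div ff0); last by apply: hom_shift; exact: hw.
  by rewrite -f'E; exact: hom_shift.
exists (z%:P + Q' * ('X - a%:P)); rewrite rmorphD rmorphM rmorphB /= !evC evX -Q'E.
by rewrite -f'E addrC subrK.
Qed.

(* In the relation of [graded_relation] for coprime [u] and [v], [u] divides the
   coefficient of the lowest power of [u], up to a power of [v]; the quotient has
   weight opposite to [c]. *)
Lemma rank_one c u v : u != 0 -> v != 0 -> hom c u -> hom c v ->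
  exists F H, [/\ F != 0, H != 0 & ev w F * u = ev w H * v].
Proof.
have [m] := ubnP (msize u); elim: m u v c => // m IH u v c; rewrite ltnS => um u0 v0 hu hv.
have [[q [irq [u' uE] [v' vE]]]|cop] :=
  pselect (exists q, [/\ irred q, dvdr q u & dvdr q v]).
  have u'0 : u' != 0 by apply: contraNneq u0 => E; rewrite uE E mul0r.
  have v'0 : v' != 0 by apply: contraNneq v0 => E; rewrite vE E mul0r.
  have q0 : q != 0 by case: irq.
  have [d hq] : exists d, hom d q.
    by apply: (@hom_factor _ char0 _ _ _ hom_dec q u' c); rewrite mulrC -uE.
  have [|||||F [H [F0 H0 E]]] := IH u' v' (c - d) => //.
  - apply: leq_trans um; rewrite uE msizeM //; have := irred_msize irq.
    move: u'0; rewrite -msize_poly_eq0; case: (msize q) (msize u') => [|[|x]] [|y] // _ _.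
    by rewrite !addnS /=; lia.
  - by apply: (hom_div _ _ hq); rewrite -uE.
  - by apply: (hom_div _ _ hq); rewrite -vE.
  by exists F, H; split=> //; rewrite uE vE !mulrA E.
have [N [F [exF FE]]] := graded_relation hu hv.
have exi : exists i, [exists j : 'I_N, (F j != 0) && (i == j :> nat)].
  by case: exF => i Fi; exists i; apply/existsP; exists i; rewrite Fi eqxx.
case: (ex_minnP exi) => i' /existsP[i /andP[Fi /eqP ->]] mini {i'}.
have uF : dvdr u (ev w (F i) * v ^+ (N.-1 - i)).
  have : dvdr (u ^+ i * u) (\sum_(j | j != i) ev w (F j) * (u ^+ j * v ^+ (N.-1 - j))).
    apply: dvdr_sum => j ji; have [->|Fj] := eqVneq (F j) 0.
      by rewrite rmorph0 mul0r; exact: dvdr0.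
    apply/dvdr_mull/dvdr_mulr; rewrite -exprSr.
    have ij : (i < j)%N.
      rewrite ltn_neqAle eq_sym ji /=; apply: mini; apply/existsP; exists j.
      by rewrite Fj eqxx.
    by exists (u ^+ (j - i.+1)); rewrite -exprD subnK.
  move: FE; rewrite (bigD1 i) //= => /eqP; rewrite addr_eq0 => /eqP FE [x xE].
  exists (- x); apply: (mulfI (expf_neq0 i u0)).
  by rewrite mulrCA FE xE mulNr mulrN mulrA mulrCA mulrA.
have [|u'' uu] := coprime_dvdr u0 _ uF.
  move=> q irq qu qv; apply: cop; exists q; split=> //.
  exact: (primerX (mpoly_gauss irq) qv).
have F0 := ev_neq0 w1 Fi; rewrite uu in F0.
have hevw Q : hom 0 (ev w Q).
  rewrite /ev horner_coef; apply: hom_sum => j _; rewrite coef_map.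
  by rewrite -[0]addr0; apply: homM; [exact: homC|have := homX j hw; rewrite mul0rn].
have hu'' : hom (0 - c) u'' by apply: (hom_div F0 _ hu); rewrite -uu.
have hvu : hom 0 (v * u'') by rewrite -[0](subrr c) -[- c]sub0r; exact: homM.
have [H HE] := inv_poly hvu.
have u''0 : u'' != 0 by apply: contraNneq F0 => ->; rewrite mul0r.
exists H, (F i); split=> //.
  apply: contraNneq u''0 => H0; move/eqP: HE; rewrite H0 rmorph0 mulf_eq0 (negbTE v0).
  by [].
by rewrite -HE uu -mulrA mulrC.
Qed.

Lemma poly_root0 (Q : {poly k}) : Q != 0 -> (forall z, root Q z -> z = 0) ->
  exists2 c, c != 0 & exists m, Q = c *: 'X^m.
Proof.
move=> Q0 hQ; have [s sE] := closed_field_poly_normal Q.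
exists (lead_coef Q); first by rewrite lead_coef_eq0.
exists (size s); rewrite {1}sE; congr (_ *: _).
rewrite big_seq (eq_bigr (fun=> 'X)) => [|z zs]; last first.
  rewrite (hQ z) ?subr0 // sE rootZ ?lead_coef_eq0 // root_prod_XsubC.
  by [].
by rewrite -big_seq big_const_seq count_predT iter_mulr_1.
Qed.

Definition special p :=
  [/\ irred p, exists c, hom c p & forall a, a != 0 -> ~ dvdr (w - a%:MP) p].

Lemma dvdr_ev_cancel a Q x : a != 0 -> Q != 0 -> ~ dvdr (w - a%:MP) x ->
  dvdr (w - a%:MP) (ev w Q * x) -> root Q a.
Proof.
move=> a0 Q0 nx; have pw := mpoly_gauss (irrw a0); have [_ _ pwM] := pw.
case/pwM => // /(ev_root pw Q0)[z rz dz]; suff -> : a = z by [].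
apply/eqP; rewrite -subr_eq0; apply: contraT => az.
case: (primer_not_cst pw (c := a - z) az).
have -> : (a - z)%:MP = (w - z%:MP) - (w - a%:MP).
  by rewrite mpolyCB opprB [RHS]addrC addrA subrK.
by apply: dvdr_sub => //; exact: dvdr_refl.
Qed.

Section Powers.
Context (N : nat) (p : 'I_N -> A) (sp : forall i, special (p i)).
Definition monom (al : 'I_N -> nat) : A := \prod_i p i ^+ al i.

Lemma monom_neq0 al : monom al != 0.
Proof. by apply/prodf_neq0 => i _; rewrite expf_neq0 //; case: (sp i) => -[]. Qed.

Lemma monom_ndvdr al a : a != 0 -> ~ dvdr (w - a%:MP) (monom al).
Proof.
move=> a0; have pw := mpoly_gauss (irrw a0).
by case/(primer_prod pw) => i _ /(primerX pw); case: (sp i) => _ _; apply.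
Qed.

(** By [rank_one] the two monomials agree up to factors [ev w F] and [ev w H]. The prime [w - a]
    with [a != 0] divides no monomial in special elements, so a root [a] of [F] or [H] is common to
    both and cancels; what remains are powers of [w]. *)
Lemma monom_ratio c al be : hom c (monom al) -> hom c (monom be) ->
  exists i j e, e != 0 /\ monom al * w ^+ i = e *: (monom be * w ^+ j).
Proof.
move=> hal hbe; have [F [H]] := rank_one (monom_neq0 al) (monom_neq0 be) hal hbe.
have [m] := ubnP (size F); elim: m F H => // m IH F H; rewrite ltnS => Fm [F0 H0 E].
have cancel a : a != 0 -> root F a \/ root H a -> exists i j e, e != 0 /\ monom al * w ^+ i = e *: (monom be * w ^+ j).
  move=> a0 rFH.
  have wa0 : w - a%:MP != 0 by exact: wsub_neq0.
  have evr Q : root Q a -> dvdr (w - a%:MP) (ev w Q).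
    move=> rQ; have := dvdr_ev_sub w a Q; move: rQ; rewrite rootE => /eqP ->.
    by rewrite mpolyC0 subr0.
  have rF : root F a.
    case: rFH => // rH; apply: (dvdr_ev_cancel a0 F0 (monom_ndvdr (al := al) a0)).
    by rewrite E; exact/dvdr_mulr/evr.
  have rH : root H a.
    apply: (dvdr_ev_cancel a0 H0 (monom_ndvdr (al := be) a0)).
    by rewrite -E; exact/dvdr_mulr/evr.
  have [F' FE] := factor_theorem _ _ rF; have [H' HE] := factor_theorem _ _ rH.
  have F'0 : F' != 0 by apply: contraNneq F0 => F'0; rewrite FE F'0 mul0r.
  apply: (IH F' H'); last split=> //.
  - apply: leq_trans Fm; rewrite FE size_Mmonic ?monicXsubC // size_XsubC addn2.
    by [].
  - by apply: contraNneq H0 => H'0; rewrite HE H'0 mul0r.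
  apply: (mulfI wa0); have evS : ev w ('X - a%:P) = w - a%:MP by rewrite rmorphB /= evX evC.
  by move: E; rewrite FE HE !rmorphM /= evS mulrAC [_ * (w - _) * _]mulrAC ![(w - _) * _]mulrC.
have [[a a0 ra]|nr'] := pselect (exists2 a, a != 0 & root F a \/ root H a).
  exact: (cancel a).
have only0 Q : (forall a, root Q a -> root F a \/ root H a) -> forall z, root Q z -> z = 0.
  move=> hQ z rz; apply: contrapT => /eqP z0; apply: nr'; exists z => //; exact: hQ.
have [c1 c10 [i FE]] := poly_root0 F0 (only0 F (fun a h => or_introl h)).
have [c2 c20 [j HE]] := poly_root0 H0 (only0 H (fun a h => or_intror h)).
exists i, j, (c1^-1 * c2); split; first by rewrite mulf_neq0 ?invr_eq0.
move: E; rewrite FE HE !evZ !rmorphXn /= evX -!scalerAl => /(congr1 (fun x => c1^-1 *: x)).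
by rewrite !scalerA mulVf // scale1r ![w ^+ _ * _]mulrC.
Qed.

Hypothesis nassoc : forall i j, i != j -> ~ dvdr (p i) (p j).

Lemma monom_inj al be e : e != 0 -> monom al = e *: monom be -> al =1 be.
Proof.
have le al' be' e' : e' != 0 -> monom al' = e' *: monom be' -> forall i, (al' i <= be' i)%N.
  move=> e0 E i; rewrite leqNgt; apply/negP => lt.
  have [irp _ _] := sp i; have pp := mpoly_gauss irp; have [p0 _ _] := irp.
  move: E; rewrite /monom (bigD1 i) //= [in RHS](bigD1 i) //= => E.
  have : dvdr (p i) (\prod_(j | j != i) p j ^+ be' j).
    have E' : p i ^+ (al' i - be' i) * \prod_(j | j != i) p j ^+ al' j =
        e' *: \prod_(j | j != i) p j ^+ be' j.
      apply: (mulfI (expf_neq0 (be' i) p0)).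
      by rewrite mulrA -exprD subnKC ?(ltnW lt) // E scalerAr.
    have : dvdr (p i) (e' *: \prod_(j | j != i) p j ^+ be' j).
      rewrite -E'; apply: dvdr_mulr; rewrite -(prednK (n := (al' i - be' i)%N)) ?subn_gt0 //.
      by exists (p i ^+ (al' i - be' i).-1); rewrite -exprSr.
    by case=> x xE; exists (e'^-1 *: x); rewrite -scalerAl -xE scalerA mulVf ?scale1r.
  case/(primer_prod pp) => j ji /(primerX pp); apply: nassoc.
  by rewrite eq_sym.
move=> e0 E i; apply/anti_leq; rewrite (le al be e) //=.
by apply: (le be al e^-1); rewrite ?invr_eq0 // E scalerA mulVf // scale1r.
Qed.

(* Monomials of equal weight in the [p i] differ by a power of [w] and a scalar, so
   that a linear relation between monomials would make [w] algebraic. *)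
Lemma special_count : (N <= n)%N.
Proof.
rewrite leqNgt; apply/negP => nN.
have /choice[wt hwt] : forall i, exists c, hom c (p i) by move=> i; case: (sp i).
have [M [c [[al0 c0] cE]]] := monomials_dep char0 p nN.
pose F (al : {ffun 'I_N -> 'I_M}) := monom (fun i => al i).
pose Wt (al : {ffun 'I_N -> 'I_M}) : W := \sum_i wt i *+ al i.
have homF al : hom (Wt al) (F al).
  by apply: hom_prod => i _; exact: homX.
have sumF : \sum_(al | Wt al == Wt al0) c al *: F al = 0.
  have := congr1 (fun q => comp q (Wt al0)) cE.
  rewrite (comp0 char0 hom_dec) (comp_sum char0 hom_dec) => E.
  rewrite -[RHS]E big_mkcond; apply: eq_bigr => al _; rewrite (comp_of_hom char0 hom_dec _ (homZ _ (homF al))).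
  by rewrite eq_sym.
have /choice[t tP] : forall al, exists t : nat * nat * k, Wt al == Wt al0 ->
    t.2 != 0 /\ F al * w ^+ t.1.1 = t.2 *: (F al0 * w ^+ t.1.2).
  move=> al; have [E|nE] := eqVneq (Wt al) (Wt al0); last first.
    by exists ((0%N, 0%N), 1).
  have := homF al; rewrite E => hal.
  have [i [j [e [e0 eE]]]] := monom_ratio hal (homF al0).
  by exists ((i, j), e).
(* A common exponent [I] of [w]: multiplied by [w ^+ I], each monomial of the weight in question is
   a scalar times [F al0 * w ^+ d al]. *)
pose I := \sum_al (t al).1.1; pose d al := ((t al).1.2 + (I - (t al).1.1))%N.
have dP al : Wt al == Wt al0 -> F al * w ^+ I = (t al).2 *: (F al0 * w ^+ d al).
  move=> /tP[_ E]; have iI : ((t al).1.1 <= I)%N by rewrite /I (bigD1 al) //= leq_addr.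
  by rewrite -{1}(subnKC iI) exprD mulrA E /d exprD -scalerAl mulrA.
have w0 : w != 0 by rewrite -[w]subr0 -mpolyC0 wsub_neq0.
pose Q := \sum_(al | Wt al == Wt al0) (c al * (t al).2) *: 'X^(d al).
have Q0 : Q != 0.
  suff : Q`_(d al0) = c al0 * (t al0).2.
    move=> E; apply: contraTneq c0 => Q0; move/eqP: E; rewrite Q0 coef0 eq_sym mulf_eq0.
    by rewrite (negbTE (proj1 (tP al0 (eqxx _)))) orbF => /eqP ->; rewrite eqxx.
  rewrite coef_sum (bigD1 al0) //= coefZ coefXn eqxx mulr1 big1 ?addr0 // => al /andP[Ea na].
  rewrite coefZ coefXn; case: eqP => [dE|_]; last by rewrite mulr0.
  (* Equal exponents [d al] and [d al0] would make the two monomials proportional, hence equal by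
     unique factorization. *)
  case/eqP: na; apply/ffunP => i; apply/val_inj.
  have [e10 _] := tP al Ea; have [e20 _] := tP al0 (eqxx _).
  have e0 : (t al).2 / (t al0).2 != 0 by rewrite mulf_neq0 ?invr_eq0.
  apply: (@monom_inj (fun i => al i) (fun i => al0 i) _ e0 _ i).
  rewrite -/(F al) -/(F al0); apply: (mulIf (expf_neq0 I w0)).
  by rewrite -scalerAl (dP al0 (eqxx _)) (dP al Ea) scalerA divfK // dE.
have := ev_neq0 w1 Q0; suff -> : ev w Q = 0 by rewrite eqxx.
have F0 : F al0 != 0 by exact: monom_neq0.
apply: (mulfI F0); rewrite mulr0 /Q rmorph_sum mulr_sumr /=.
transitivity (\sum_(al | Wt al == Wt al0) c al *: (F al * w ^+ I)).
  apply: eq_bigr => al Ea; rewrite dP // evZ rmorphXn /= evX scalerA.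
  by rewrite -scalerAr.
transitivity ((\sum_(al | Wt al == Wt al0) c al *: F al) * w ^+ I); last by rewrite sumF mul0r.
by rewrite mulr_suml; apply: eq_bigr => al _; rewrite scalerAl.
Qed.

End Powers.

Lemma special_basis : exists N (p : 'I_N -> A), [/\ (N <= n)%N, forall i, special (p i) &
  forall q, special q -> exists i c, q = c *: p i].
Proof.
pose P N := exists p : 'I_N -> A, (forall i, special (p i)) /\
  forall i j, i != j -> ~ dvdr (p i) (p j).
have P0 : exists N, `[< P N >].
  by exists 0%N; apply/asboolP; exists (fun=> 0); split=> -[].
have Pn N : `[< P N >] -> (N <= n)%N.
  by move=> /asboolP[p [sp na]]; exact: (special_count sp na).
case: (ex_maxnP P0 Pn) => N /asboolP[p [sp na]] maxN.
exists N, p; split=> //; first by apply: Pn; apply/asboolP; exists p.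
move=> q sq; apply: contrapT => nq.
have [irq _ _] := sq.
have npq i : ~ dvdr (p i) q.
  move=> d; have [irp _ _] := sp i.
  by have [c _ qE] := irred_assoc irp irq d; apply: nq; exists i, c.
have nqp i : ~ dvdr q (p i).
  move=> d; have [irp _ _] := sp i.
  by apply: (npq i); exact: (irred_dvdr irq irp d).
suff /maxN : `[< P N.+1 >] by rewrite ltnn.
apply/asboolP; exists (fun i => if unlift ord_max i is Some j then p j else q); split.
  by move=> i; case: unliftP.
move=> i j; case: unliftP => [i' ->|->]; case: unliftP => [j' ->|->] //.
- by rewrite (inj_eq lift_inj); exact: na.
- by rewrite eqxx.
Qed.

(** The irreducible factors of a homogeneous element are homogeneous, so each is special or
    associate to [w - a] with [a != 0]. It remains to see that [w] is itself a product of special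
    elements up to a unit. *)
Lemma special_generators : exists z : n.-tuple A,
  [/\ forall i, special (tnth z i) \/ tnth z i = 0,
      forall q, special q -> exists i c, q = c *: tnth z i &
      forall q, exists P, q = P \mPo z].
Proof.
have [N [p [Nn sp pP]]] := special_basis.
(* A family of fewer than [n] special elements is padded with zeros to have the length of a
   coordinate system. *)
pose z : n.-tuple A := [tuple if insub (i : nat) is Some j then p j else 0 | i < n].
have zP q : special q -> exists i c, q = c *: tnth z i.
  move=> /pP[i [c ->]]; exists (widen_ord Nn i), c; rewrite tnth_mktuple /=.
  by rewrite valK.
exists z; split=> // [i|].
  by rewrite tnth_mktuple; case: insubP => [j _ _|_]; [left|right].
pose gen q := exists P, q = P \mPo z.
have genC c : gen c%:MP by exists c%:MP; rewrite comp_mpolyC.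
have genM x y : gen x -> gen y -> gen (x * y).
  by move=> [P ->] [Q ->]; exists (P * Q); rewrite rmorphM.
have genD x y : gen x -> gen y -> gen (x + y).
  by move=> [P ->] [Q ->]; exists (P + Q); rewrite rmorphD.
have genZ c x : gen x -> gen (c *: x) by rewrite -mul_mpolyC; apply: genM.
have genS q : special q -> gen q.
  by move=> /zP[i [c ->]]; apply: genZ; exists 'X_i; rewrite comp_mpolyXU -tnth_nth.
have gen_unit (u : A) : u \is a GRing.unit -> gen u.
  by rewrite mpoly_unit_msize => /msize_poly1P[c _ ->].
have gen_prod (s : seq A) : (forall x, x \in s -> gen x) -> gen (\prod_(j <- s) j).
  move=> h; rewrite big_seq; elim/big_ind: _ => //.
  by rewrite -mpolyC1.
have hom_fac c (s : seq A) u x : u * \prod_(j <- s) j != 0 ->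
    hom c (u * \prod_(j <- s) j) -> x \in s -> exists d, hom d x.
  move=> n0 h xs; move: n0 h; rewrite (big_rem x) //= mulrCA => n0 h.
  exact: (hom_factor char0 hom_dec n0 h).
have w0 : w != 0 by rewrite -[w]subr0 -mpolyC0 wsub_neq0.
have genw : gen w.
  have [u [s [uu irs wE]]] := mpoly_atomic w0; rewrite wE; apply: genM; first exact: gen_unit.
  apply: gen_prod => x xs; apply: genS; split; first exact: irs.
    by apply: (@hom_fac 0 s u) => //; rewrite -wE //; exact: hw.
  (* If [w - a] divided a factor of [w], it would divide [w] and hence the non-zero constant [a]. *)
  move=> a a0 d; have pw := mpoly_gauss (irrw a0).
  apply: (primer_not_cst pw a0).
  have E : a%:MP = w - (w - a%:MP) by rewrite opprB addrC subrK.
  rewrite [X in dvdr _ X]E; apply: dvdr_sub; last exact: dvdr_refl.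
  apply: dvdr_trans d _; exists (u * \prod_(j <- rem x s) j).
  by rewrite wE (big_rem x) //= mulrCA mulrC.
have genh c q : hom c q -> gen q.
  have [->|q0] := eqVneq q 0; first by rewrite -mpolyC0.
  have [u [s [uu irs qE]]] := mpoly_atomic q0; move=> hq.
  rewrite qE; apply: genM; first exact: gen_unit.
  apply: gen_prod => x xs.
  have [[a a0 d]|nd] := pselect (exists2 a, a != 0 & dvdr (w - a%:MP) x).
    have [e _ ->] := irred_assoc (irrw a0) (irs x xs) d.
    by apply/genZ/genD => //; rewrite -mpolyCN.
  apply: genS; split; first exact: irs.
    by apply: (@hom_fac c s u) => //; rewrite -qE.
  by move=> a a0 d; apply: nd; exists a.
move=> q; elim: (hom_dec q) => [|x y [c hx] _ IH].
  by have := genC 0; rewrite mpolyC0.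
by apply: genD; [exact: (genh c)|exact: IH].
Qed.

End Exceptional.
End Invariant.

(** * The action of the group on the invariants *)

Section Group.
Context (G : polyaut k n -> Prop).
Hypothesis GM : forall g h, G g -> G h -> G (g * h)%g.
Hypothesis GV : forall g, G g -> G g^-1%g.
Hypothesis phiM : forall s t, tunit s -> tunit t ->
  phi (fun i => s i * t i) = (phi s * phi t)%g.
Hypothesis Gphi : forall t, tunit t -> G (phi t).
Hypothesis Gnorm : forall g t, G g -> tunit t ->
  exists t', tunit t' /\ (g * phi t = phi t' * g)%g.
Hypothesis Gfin : exists s : seq (polyaut k n), {in s, forall x, G x} /\
  forall g, G g -> exists t x, [/\ tunit t, x \in s & g = (phi t * x)%g].

Lemma act_sub (g : polyaut k n) (p q : A) : act g (p - q) = act g p - act g q.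
Proof. by rewrite /act rmorphB. Qed.
Lemma act_mul (g : polyaut k n) (p q : A) : act g (p * q) = act g p * act g q.
Proof. by rewrite /act rmorphM. Qed.
Lemma act_scale (g : polyaut k n) c (p : A) : act g (c *: p) = c *: act g p.
Proof. by rewrite /act comp_mpolyZ. Qed.
Lemma act_cst (g : polyaut k n) (c : k) : act g c%:MP = c%:MP :> A.
Proof. by rewrite /act comp_mpolyC. Qed.
Lemma act_ev (g : polyaut k n) (p : A) Q : act g (ev p Q) = ev (act g p) Q.
Proof.
rewrite /ev !horner_coef !size_map_poly {1}/act rmorph_sum; apply: eq_bigr => i _ /=.
by rewrite !coef_map /= rmorphM rmorphXn /= comp_mpolyC.
Qed.

Lemma act_unit (g : polyaut k n) (p : A) : p \is a GRing.unit -> act g p \is a GRing.unit.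
Proof.
move=> up; have := up; rewrite (mpoly_unit_msize p) => /msize_poly1P[c c0 E].
by rewrite E act_cst mpolyC_unit.
Qed.

Lemma act_irred (g : polyaut k n) (p : A) : irred p -> irred (act g p).
Proof.
case=> p0 np hp; split.
- by apply: contraNneq p0 => E; rewrite -(actK g p) E -mpolyC0 act_cst.
- by apply: contraNN np => u; rewrite -(actK g p) act_unit.
move=> x y E; have [ux|uy] := hp (act g^-1%g x) (act g^-1%g y) (etrans (esym (actK g p)) (etrans (congr1 (act g^-1%g) E) (act_mul _ _ _))).
- by left; rewrite -(actVK g x) act_unit.
- by right; rewrite -(actVK g y) act_unit.
Qed.

Lemma act_dvdr (g : polyaut k n) (p q : A) : dvdr p q -> dvdr (act g p) (act g q).
Proof. by case=> d ->; exists (act g d); rewrite act_mul. Qed.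

Section Semiinvariant.
Context (w : A).
Hypotheses (w1 : (1 < msize w)%N) (hw : hom 0 w)
  (irrw : forall a, a != 0 -> irred (w - a%:MP))
  (Gw : forall g, G g -> exists c, act g w = c *: w).

Lemma act_special g p : G g -> special w p -> special w (act g p).
Proof.
move=> Gg [irp [c hp] np]; split; first exact: act_irred.
  exact: (act_hom char0 hom_dec phiM Gnorm Gg hp).
move=> a a0 /(act_dvdr g^-1%g); rewrite actK act_sub act_cst.
have [b bE] := Gw (GV Gg).
have b0 : b != 0.
  apply/eqP => b0; have := actVK g w; rewrite bE b0 scale0r -mpolyC0 act_cst => w0.
  by move: w1; rewrite -w0 mpolyC0 msize0.
have ab0 : a / b != 0 by rewrite mulf_neq0 ?invr_eq0.
rewrite bE (_ : _ - _ = b *: (w - (a / b)%:MP)).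
  by move/(dvdr_scale _ _ b0); exact: np.
by rewrite scalerBr -[b *: _%:MP]mul_mpolyC -mpolyCM mulrCA divff // mulr1.
Qed.

Lemma linearize_semiinvariant : exists y, linearized phi G y.
Proof.
have [z [zS zP zG]] := special_generators w1 hw irrw.
have [y yz] := polyaut_of_generators char0 (fun i => zG 'X_i).
exists y; rewrite /linearized yz; split=> [i|g Gg].
  by case: (zS i) => [[_ [c hc] _]|->]; [exists c|exists 0; exact: hom0].
have /choice[R RE] : forall i, exists R : 'rV[k]_n, act g (tnth z i) = \sum_j R 0 j *: tnth z j.
  move=> i; case: (zS i) => [/(act_special Gg)/zP[j [c ->]]|->].
    exists (c *: delta_mx 0 j); rewrite (bigD1 j) //= big1 ?addr0 => [|l lj].
      by rewrite !mxE !eqxx mulr1.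
    by rewrite !mxE (negbTE lj) andbF mulr0 scale0r.
  exists 0; rewrite -mpolyC0 act_cst mpolyC0 big1 // => j _.
  by rewrite mxE scale0r.
exists (\matrix_i R i) => i; rewrite RE; apply: eq_bigr => j _.
by rewrite mxE.
Qed.

End Semiinvariant.

Section Affine.
Context (w : A).
Hypotheses (w1 : (1 < msize w)%N) (hw : hom 0 w)
  (irrw : forall a, a != 0 -> irred (w - a%:MP)).

(** Both [g] and its inverse map [w] to polynomials in [w]. These compose to the identity, so their
    degrees multiply to 1. *)
Lemma act_affine g : G g -> exists a b, a != 0 /\ act g w = a *: w + b%:MP.
Proof.
move=> Gg; have aw h : G h -> exists Q, act h w = ev w Q.
  by move=> Gh; exact: (inv_poly w1 hw irrw (act_hom0 Gnorm Gh hw)).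
have [Q QE] := aw g Gg; have [R RE] := aw _ (GV Gg).
have E : Q \Po R = 'X.
  apply: (ev_inj w1); rewrite evX.
  have -> : ev w (Q \Po R) = ev (ev w R) Q.
    elim/poly_ind: Q {QE} => [|Q c IH]; first by rewrite comp_poly0 !rmorph0.
    by rewrite comp_polyD comp_polyM comp_polyX comp_polyC !rmorphD !rmorphM /= IH !evC evX.
  by rewrite -RE -act_ev -QE actK.
have sQ : size Q = 2.
  have := size_comp_poly Q R; rewrite E size_polyX /= => /esym/eqP; rewrite muln_eq1.
  by case/andP => /eqP; case: (size Q) => [|[|[]]].
exists Q`_1, Q`_0; split.
  have : lead_coef Q != 0 by rewrite lead_coef_eq0 -size_poly_eq0 sQ.
  by rewrite lead_coefE sQ.
rewrite QE {1}/ev horner_coef size_map_poly sQ !big_ord_recl big_ord0 !coef_map /=.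
by rewrite expr0 expr1 mulr1 addr0 mul_mpolyC addrC.
Qed.

End Affine.

Lemma linearize_shifted w b : (1 < msize w)%N -> hom 0 w ->
  (forall a, a != b -> irred (w - a%:MP)) ->
  (forall g, G g -> exists c, act g (w - b%:MP) = c *: (w - b%:MP)) ->
  exists y, linearized phi G y.
Proof.
move=> w1 hw irrw Gw.
apply: (@linearize_semiinvariant (w - b%:MP)) => //.
- by rewrite msize_shift.
- exact: hom_shift.
move=> a a0; rewrite -addrA -opprD -mpolyCD; apply: irrw.
by rewrite -subr_eq0 addrAC subrr add0r.
Qed.

Lemma linearize_nonconstant w : (1 < msize w)%N -> hom 0 w ->
  (forall p, hom 0 p -> (1 < msize p)%N -> (msize w <= msize p)%N) ->
  exists y, linearized phi G y.
Proof.
move=> w1 hw wmin.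
have [[b nirr]|allirr] := pselect (exists b, ~ irred (w - b%:MP)).
  have irrw a : a != b -> irred (w - a%:MP).
    move=> ab; apply: contrapT => na; case/eqP: ab.
    exact: (reducible_fiber_uniq w1 hw wmin na nirr).
  apply: (linearize_shifted w1 hw irrw) => g Gg.
  pose v := w - b%:MP.
  have v1 : (1 < msize v)%N by rewrite msize_shift.
  have hv : hom 0 v by exact: hom_shift.
  have irrv a : a != 0 -> irred (v - a%:MP).
    move=> a0; rewrite /v -addrA -opprD -mpolyCD; apply: irrw.
    by rewrite -subr_eq0 addrAC subrr add0r.
  have [a [c [a0 E]]] := act_affine v1 hv irrv Gg.
  (* Otherwise [g] would carry the reducible fibre [v] to a scalar multiple of an irreducible
     one. *)
  exists a; rewrite -/v E; suff -> : c = 0 by rewrite mpolyC0 addr0.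
  apply/eqP; apply: contraT => c0; case: nirr.
  have E' : act g v = a *: (v - (- (c / a))%:MP).
    by rewrite mpolyCN opprK scalerDr E -[a *: _%:MP]mul_mpolyC -mpolyCM mulrCA divff // mulr1.
  rewrite -/v -(actK g v) E'; apply/act_irred/irred_scale => //; apply: irrv.
  by rewrite oppr_eq0 mulf_neq0 ?invr_eq0.
have irrw a : irred (w - a%:MP) by apply: contrapT => na; apply: allirr; exists a.
have irrw0 a : a != 0 -> irred (w - a%:MP) by [].
have /choice[f fP] : forall g, exists ab : k * k, G g -> ab.1 != 0 /\ act g w = ab.1 *: w + ab.2%:MP.
  move=> g; have [Gg|nG] := pselect (G g); last by exists (0, 0).
  by have [a [b h]] := act_affine w1 hw irrw0 Gg; exists (a, b).
have w_affine a b a' b' : a *: w + b%:MP = a' *: w + b'%:MP -> b = b'.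
  move=> E; have evE (c d : k) : ev w (c *: 'X + d%:P) = c *: w + d%:MP.
    by rewrite rmorphD /= evZ evX evC.
  have /(ev_inj w1)/polyP/(_ 0%N) : ev w (a *: 'X + b%:P) = ev w (a' *: 'X + b'%:P).
    by rewrite !evE.
  by rewrite !coefD !coefZ !coefX !coefC /= !mulr0 !add0r.
have fM g h : G g -> G h -> (f (g * h)%g).2 = (f g).1 * (f h).2 + (f g).2.
  move=> Gg Gh; have [_] := fP _ (GM Gg Gh).
  have [_ Eg] := fP _ Gg; have [_ Eh] := fP _ Gh.
  rewrite actM Eg /act comp_mpolyD comp_mpolyZ comp_mpolyC -/(act h w) Eh.
  rewrite scalerDr scalerA -addrA -[_ *: _%:MP]mul_mpolyC -mpolyCM -mpolyCD.
  by move/esym/w_affine.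
have fphi t g : tunit t -> G g -> (f (phi t * g)%g).2 = (f g).2.
  move=> ut Gg; rewrite fM //; last exact: Gphi.
  have [_] := fP _ (Gphi ut); rewrite {1}/act hw // tpow0 scale1r => E.
  have E0 := E; rewrite -{1}[w]scale1r -[_ *: w]addr0 -mpolyC0 in E0.
  have b0 : (f (phi t)).2 = 0 by rewrite -(w_affine _ _ _ _ E0).
  rewrite b0 mpolyC0 addr0 in E; rewrite b0 addr0.
  have : (1 - (f (phi t)).1) *: w == 0 by rewrite scalerBl scale1r -E subrr.
  rewrite scaler_eq0 subr_eq0 => /orP[/eqP <-|/eqP w0]; first by rewrite mul1r.
  by move: w1; rewrite w0 msize0.
(* With no distinguished fibre, [G] acts on the line of values of [w] by affine maps, through a
   finite quotient. [S] is the orbit of 0, and its barycentre [b] is a fixed point. *)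
have [S [uS SP]] := @finite_orbit _ _ _ phi G Gfin _ (fun g => (f g).2) fphi.
have SL h x : G h -> x \in S -> (f h).1 * x + (f h).2 \in S.
  move=> Gh /SP[g Gg <-]; apply/SP; exists (h * g)%g; first exact: GM.
  by rewrite fM.
have S0 : (size S)%:R != 0 :> k.
  rewrite ((pcharf0P _).1 char0) size_eq0.
  have [s [sG Gs]] := Gfin.
  have [t [x [ut xs _]]] := Gs _ (Gphi (fun i : 'I_r => oner_neq0 k)).
  have : (f x).2 \in S by apply/SP; exists x => //; exact: sG.
  by case: (S).
have [b bS] : exists b, b * (size S)%:R = \sum_(x <- S) x.
  by exists ((\sum_(x <- S) x) / (size S)%:R); rewrite divfK.
apply: (linearize_shifted (b := b) w1 hw) => // g Gg.
have [a0 E] := fP _ Gg; exists (f g).1.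
suff Eb : b = (f g).1 * b + (f g).2.
  rewrite act_sub act_cst E scalerBr -[_ *: b%:MP]mul_mpolyC -mpolyCM {1}Eb mpolyCD.
  by rewrite -addrA [_%:MP + - _]addrC opprD addrNK.
apply: (mulIf S0); rewrite /= mulrDl -mulrA bS.
have inj : injective (fun x => (f g).1 * x + (f g).2).
  by move=> x y /addIr/(mulfI a0).
have pS : perm_eq [seq (f g).1 * x + (f g).2 | x <- S] S.
  have um : uniq [seq (f g).1 * x + (f g).2 | x <- S] by rewrite map_inj_uniq.
  apply: uniq_perm => //; apply: (uniq_min_size um _ _).2; last by rewrite size_map.
  by move=> _ /mapP[x xS ->]; exact: SL.
rewrite -{1}(perm_big _ pS) /= big_map big_split /= -mulr_sumr; congr (_ + _).
by rewrite big_const_seq count_predT iter_addr_0 mulr_natr.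
Qed.

Lemma linearize : exists y, linearized phi G y.
Proof.
have [cst|/existsNP[p0 /not_implyP[hp0 np0]]] := pselect (forall p, hom 0 p -> exists c, p = c%:MP).
  exact: (linearize_constant_invariants char0 hom_dec GM GV phiM Gphi Gnorm Gfin cst).
have ex : exists m, `[< exists p, [/\ hom 0 p, (1 < msize p)%N & msize p = m] >].
  exists (msize p0); apply/asboolP; exists p0; split=> //.
  rewrite ltnNge; apply/negP => h; apply: np0; exists p0@_0%MM.
  exact: msize1_polyC.
case: (ex_minnP ex) => m /asboolP[w [hw w1 wm]] mmin.
apply: (linearize_nonconstant w1 hw) => p hp p1; rewrite wm; apply: mmin.
by apply/asboolP; exists p.
Qed.

End Group.
End CaseTwo.

(** * Charts of varieties *)

Local Open Scope classical_set_scope.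
Local Open Scope ring_scope.

Lemma sub_nbhsP (X : topologicalType) (A : set X) (x : A) (S : set A) :
  nbhs x S <-> exists2 V, nbhs (val x) V & forall y : A, V (val y) -> S y.
Proof.
split=> [|[V]]; rewrite nbhsE => -[B].
  move=> [[V Vo <-] Vx] VS; exists V => //.
  by exists V.
move=> [Bo Bx] BV h; rewrite nbhsE; exists (val @^-1` B); last by move=> y /BV /h.
by split=> //; exists B.
Qed.

Lemma sub_near_open (X : topologicalType) (A : set X) (x : A) (S : set A) :
  open A -> nbhs x S -> \forall z \near val x, exists2 u, val u = z & S u.
Proof.
move=> Ao /sub_nbhsP[V Vx VS].
have Ax : nbhs (val x) A by apply: open_nbhs_nbhs; split=> //; exact/set_mem/valP.
apply: filterS2 Vx Ax => z Vz Az.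
by exists (SigSub (mem_set Az)) => //; exact: VS.
Qed.

Lemma near_sub (X : topologicalType) (A : set X) (x : A) (S : set X) :
  nbhs (val x) S -> \forall u \near x, S (val u).
Proof. by move=> h; apply/sub_nbhsP; exists S. Qed.

Lemma comp_continuous (X Y Z : topologicalType) (f : X -> Y) (g : Y -> Z) :
  continuous f -> continuous g -> continuous (g \o f).
Proof. by move=> fc gc x; apply: continuous_comp; [exact: fc|exact: gc]. Qed.

Section Neighbourhoods.
Context {k : fieldType}.

Lemma affine_nbhsP (n : nat) (x : affine k n) (S : set (affine k n)) :
  nbhs x S <-> exists p, p.@[x] != 0 /\ forall y : affine k n, p.@[y] != 0 -> S y.
Proof.
split=> [|[p [px pS]]].
  rewrite nbhsE => -[B [[D DE <-]] [C DC Cx] BS].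
  have [E ED EC] := DE _ DC; rewrite -EC in Cx.
  have /choice[P PE] : forall A : set (affine k n), exists p : {mpoly k[n]},
      A \in E -> [set x : affine k n | p.@[x] != 0] = A.
    move=> A; have [AE|] := boolP (A \in E); last by exists 0.
    by have /set_mem[p _ <-] := ED A AE; exists p.
  exists (\prod_(A <- E) P A); rewrite rmorph_prod /=; split.
    rewrite prodf_seq_neq0; apply/allP => A AE /=.
    by have := Cx A AE; rewrite -{1}(PE A AE).
  move=> y; rewrite rmorph_prod /= prodf_seq_neq0 => /allP yP; apply: BS.
  have Cy : (\bigcap_(A in [set` E]) A) y.
    by move=> A AE; rewrite -(PE A AE); exact: yP.
  by exists C => //; rewrite -EC.
rewrite nbhsE; exists [set y : affine k n | p.@[y] != 0] => //; split=> //.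
exists [set [set y : affine k n | p.@[y] != 0]]; last by rewrite bigcup_set1.
move=> _ ->.
apply: (@finI_from1 _ _ [set [set x : affine k n | p.@[x] != 0] | p in [set: {mpoly k[n]}]] id).
by exists p.
Qed.

Lemma sub_affine_nbhsP (n : nat) (A : set (affine k n)) (x : A) (S : set A) :
  nbhs x S <-> exists p, p.@[val x] != 0 /\ forall y : A, p.@[val y] != 0 -> S y.
Proof.
split=> [/sub_nbhsP[V /affine_nbhsP[p [px pV]] VS]|[p [px pS]]].
  by exists p; split=> // y /pV /VS.
apply/sub_nbhsP; exists [set y : affine k n | p.@[y] != 0] => //.
by apply/affine_nbhsP; exists p.
Qed.

End Neighbourhoods.

Section Charts.
Context {k : fieldType}.

(** An embedding of germs: [e] matters near [x] only. Since a [spaceType] carries nothing but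
    locality of [regular_at], charts are the source of the algebra operations on regular germs and
    of the openness of non-vanishing. *)
Definition chart_at (X : spaceType k) (x : X) := exists m (e : X -> affine k m),
  (forall p, p.@[e x] != 0 -> \forall z \near x, p.@[e z] != 0) /\
  (forall f, regular_at x f <-> exists p q, q.@[e x] != 0 /\
     \forall z \near x, f z = p.@[e z] / q.@[e z]).

Lemma affine_chart n (x : affine k n) : chart_at (x : (affine k n : spaceType k)).
Proof.
exists n, id; split=> [p px|f]; last by [].
by apply/affine_nbhsP; exists p.
Qed.

Lemma variety_chart (X : spaceType k) (x : X) : is_variety X -> chart_at x.
Proof.
case=> -[r [U [Uo Ucov Uaff]] _].
have [i _ Ux] : (\bigcup_i U i) x by rewrite Ucov.
have [m [Z [_ [f [[fc fr] [g [fK gK [gc gr]]]]]]]] := Uaff i.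
pose u0 : U i := SigSub (mem_set Ux).
(* The value 0 outside [U i] is a dummy; [U i] is a neighbourhood of [x]. *)
pose e z := if insub z is Some u then val (f u) else fun=> 0.
have eE (u : U i) : e (val u) = val (f u) by rewrite /e valK.
exists m, e; split=> [p px|s].
  have : \forall w \near f u0, p.@[val w] != 0.
    by apply/sub_affine_nbhsP; exists p; rewrite -eE.
  move=> h; apply: filterS (sub_near_open (Uo i) (fc u0 _ h)) => z [u <- pu].
  by rewrite eE.
split=> [sx|[p [q [qx]]]].
  have su : regular_at u0 (s \o val) by exists s => //; apply: filterE.
  have [h [p [q [qx hE]]]] : regular_at (f u0) ((s \o val) \o g).
    by apply: gr; rewrite fK.
  move=> gE; exists p, q; split; first by rewrite -[x]/(val u0) eE.
  have h' : \forall w \near f u0, s (val (g w)) = p.@[val w] / q.@[val w].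
    by apply: filterS2 gE (near_sub hE) => w /= -> ->.
  apply: filterS (sub_near_open (Uo i) (fc u0 _ h')) => z [u <- /=].
  by rewrite fK eE.
move=> sE; pose h (w : affine k m) := p.@[w] / q.@[w].
have hr : regular_at (val (f u0)) h.
  by exists p, q; split; [rewrite -eE|apply: filterE].
have hZ : regular_at (f u0) (h \o val) by exists h => //; apply: filterE.
have [s' s'x] := fr u0 _ hZ.
move=> h2; apply: regular_at_local s'x.
have hE := sub_near_open (Uo i) h2.
by apply: filterS2 sE hE => z -> [u <- /= <-]; rewrite eE.
Qed.

Section Regular.
Context (X : spaceType k) (x : X) (chx : chart_at x).

Lemma regular_cst c : regular_at x (fun=> c).
Proof.
have [m [e [_ /(_ (fun=> c))[_ h]]]] := chx.
apply: h; exists c%:MP, 1%:MP; rewrite mevalC oner_neq0; split=> //.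
by apply: filterE => z; rewrite !mevalC divr1.
Qed.

Lemma regular_linear a f g : regular_at x f -> regular_at x g ->
  regular_at x (fun z => a * f z + g z).
Proof.
have [m [e [eo eP]]] := chx.
move=> /eP[p [q [qx fE]]] /eP[p' [q' [qx' gE]]]; apply/eP.
exists (a%:MP * p * q' + p' * q), (q * q'); split.
  by rewrite mevalM mulf_neq0.
apply: filterS (filterI (filterI fE gE) (filterI (eo q qx) (eo q' qx'))) => z [[-> ->] [qz q'z]].
by rewrite mevalD !mevalM mevalC mulrA addf_div // !mulrA.
Qed.

Lemma regular_neq0 f : regular_at x f -> f x != 0 -> \forall z \near x, f z != 0.
Proof.
have [m [e [eo eP]]] := chx => /eP[p [q [qx fE]]].
rewrite (nbhs_singleton fE) mulf_eq0 invr_eq0 negb_or => /andP[px _].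
apply: filterS (filterI fE (filterI (eo q qx) (eo p px))) => z [-> [qz pz]].
by rewrite mulf_neq0 ?invr_eq0.
Qed.

Lemma regular_div f g : regular_at x f -> regular_at x g -> g x != 0 ->
  regular_at x (fun z => f z / g z).
Proof.
have [m [e [eo eP]]] := chx.
move=> /eP[p [q [qx fE]]] gr gx; have /eP[p' [q' [qx' gE]]] := gr.
have p'x : p'.@[e x] != 0.
  by move: gx; rewrite (nbhs_singleton gE) mulf_eq0 negb_or => /andP[].
apply/eP; exists (p * q'), (q * p'); split; first by rewrite mevalM mulf_neq0.
apply: filterS (filterI fE gE) => z [-> ->].
by rewrite !mevalM invf_div mulf_div.
Qed.

Lemma regular_sum r (c : 'I_r -> k) (f : 'I_r -> X -> k) :
  (forall i, regular_at x (f i)) -> regular_at x (fun z => \sum_i c i * f i z).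
Proof.
elim: r c f => [|r IH] c f fr.
  by apply: regular_at_local (regular_cst 0); apply: filterE => z; rewrite big_ord0.
apply: regular_at_local (regular_linear (c ord0) (fr ord0) (IH (fun i => c (lift ord0 i)) (fun i => f (lift ord0 i)) _)).
  by apply: filterE => z; rewrite big_ord_recl.
by move=> i; exact: fr.
Qed.

End Regular.

Lemma vprod_nbhs (X Y : spaceType k) (z : vprod X Y) (S : set (vprod X Y)) :
  nbhs z S -> exists E : {fset (set (vprod X Y))},
    (forall A, A \in E -> vprod_subbase A /\ A z) /\ \bigcap_(A in [set` E]) A `<=` S.
Proof.
rewrite nbhsE => -[B [[D DE <-]] [C DC Cx] BS].
have [E ED EC] := DE _ DC; rewrite -EC in Cx.
exists E; split=> [A AE|y yE]; first by split; [exact/set_mem/ED|exact: Cx].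
by apply: BS; exists C => //; rewrite -EC.
Qed.

(** On a slice a tensor becomes a linear combination of regular functions, whose non-vanishing is
    open. *)
Lemma vprod_slicel (X Y : spaceType k) (b : Y) : (forall x : X, chart_at x) ->
  continuous (fun x : X => (x, b) : vprod X Y).
Proof.
move=> ch x S /vprod_nbhs[E [Esub ES]].
have : \forall z \near x, (\bigcap_(A in [set` E]) (fun z => A (z, b))) z.
  apply: filter_bigI => A AE; have [[U [V [r [f [g [Uo _ fr _ ->]]]]]] [Ux Vb nz]] := Esub A AE.
  have Ur : \forall z \near x, U z by exact: open_nbhs_nbhs.
  have fr' : \forall z \near x, sum_tensor f g (z, b) != 0.
    refine (regular_neq0 (ch x) (f := fun z => sum_tensor f g (z, b)) _ nz).
    apply: regular_at_local (regular_sum (ch x) (fun i => g i b) (fun i => fr i x Ux)).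
    by apply: filterE => z; apply: eq_bigr => i _; rewrite mulrC.
  by apply: filterS2 Ur fr'.
by apply: filterS => z zE; apply: ES => A AE; exact: zE.
Qed.

Lemma vprod_slicer (X Y : spaceType k) (a : X) : (forall y : Y, chart_at y) ->
  continuous (fun y : Y => (a, y) : vprod X Y).
Proof.
move=> ch y S /vprod_nbhs[E [Esub ES]].
have : \forall z \near y, (\bigcap_(A in [set` E]) (fun z => A (a, z))) z.
  apply: filter_bigI => A AE; have [[U [V [r [f [g [_ Vo _ gr ->]]]]]] [Ua Vy nz]] := Esub A AE.
  have Vr : \forall z \near y, V z by exact: open_nbhs_nbhs.
  have gr' : \forall z \near y, sum_tensor f g (a, z) != 0.
    refine (regular_neq0 (ch y) (f := fun z => sum_tensor f g (a, z)) _ nz).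
    by apply: (regular_sum (ch y) (fun i => f i a)) => i; exact: gr.
  by apply: filterS2 Vr gr'.
by apply: filterS => z zE; apply: ES => A AE; exact: zE.
Qed.

Lemma vprod_slicel_regular (X Y : spaceType k) (x : X) (b : Y) (s : vprod X Y -> k) :
  (forall x : X, chart_at x) -> regular_at ((x, b) : vprod X Y) s ->
  regular_at x (fun z => s (z, b)).
Proof.
move=> ch [r [r' [f [g [f' [g' [fr fr' nz sE]]]]]]].
have sumr u (h : 'I_u -> X -> k) (h' : 'I_u -> Y -> k) :
    (forall i, regular_at x (h i) /\ regular_at b (h' i)) ->
    regular_at x (fun z => sum_tensor h h' (z, b)).
  move=> hr; have hx i := (hr i).1.
  apply: regular_at_local (regular_sum (ch x) (fun i => h' i b) hx).
  by apply: filterE => z; apply: eq_bigr => i _; rewrite mulrC.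
apply: regular_at_local (regular_div (ch x) (sumr _ _ _ fr) (sumr _ _ _ fr') nz).
have h : \forall z \near x, s (z, b) = _ := vprod_slicel ch sE.
by apply: filterS h => z /= ->.
Qed.

End Charts.

(** * Translations and the quotient topology on the image group *)

Section Group.
Context {k : fieldType} {n : nat} (G : algSubgroup k n).
Local Notation H := (alg_source G).
Local Notation pi := (@alg_proj k n G).

Lemma source_chart (x : H) : chart_at x.
Proof. exact/variety_chart/alg_group_variety. Qed.

Lemma source_mull (a : H) : continuous (fun x : H => (a * x)%g).
Proof.
have [mc _] := @alg_group_mulM k H.
exact: (comp_continuous (@vprod_slicer _ H H a source_chart) mc).
Qed.

Lemma source_mulr (a : H) : continuous (fun x : H => (x * a)%g).
Proof.
have [mc _] := @alg_group_mulM k H.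
exact: (comp_continuous (@vprod_slicel _ H H a source_chart) mc).
Qed.

Lemma projM x y : pi (x * y)%g = (pi x * pi y)%g.
Proof. by apply: val_inj; rewrite /= gmulfM. Qed.

Lemma proj_one : pi 1%g = 1%g.
Proof. by apply: (mulgI (pi 1%g)); rewrite -projM !mulg1. Qed.

Lemma proj_surj (z : algpt G) : exists x, pi x = z.
Proof.
case: z => g gG; have /set_mem[x _ xg] := gG; exists x; exact: val_inj.
Qed.

Lemma algpt_mull (a : algpt G) : continuous (fun x : algpt G => (a * x)%g).
Proof.
have [b <-] := proj_surj a; apply/continuousP => U Uo.
have /continuousP/(_ _ Uo) := @alg_proj_continuous k n G.
move: (@source_mull b) => /continuousP h /(h _).
rewrite -[X in _ -> X]/(open (pi @^-1` _)); congr open; apply/funext => x /=.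
by rewrite projM.
Qed.

Lemma algpt_mulr (a : algpt G) : continuous (fun x : algpt G => (x * a)%g).
Proof.
have [b <-] := proj_surj a; apply/continuousP => U Uo.
have /continuousP/(_ _ Uo) := @alg_proj_continuous k n G.
move: (@source_mulr b) => /continuousP h /(h _).
rewrite -[X in _ -> X]/(open (pi @^-1` _)); congr open; apply/funext => x /=.
by rewrite projM.
Qed.

(** The saturation of [U] is the union of its translates by the kernel. *)
Lemma proj_open (U : set H) : open U -> open (pi @` U).
Proof.
move=> Uo.
have -> : open (pi @` U) = open (\bigcup_(a in [set a : H | pi a = 1%g]) (fun x : H => (x * a)%g) @^-1` U).
  rewrite -[LHS]/(open (pi @^-1` _)); congr open; apply/seteqP; split=> x /=.
    case=> u Uu ux; exists (x^-1 * u)%g; last by rewrite /= mulVKg.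
    by rewrite /= projM ux -projM mulVg proj_one.
  by case=> a /= a1 Uxa; exists (x * a)%g => //; rewrite projM a1 mulg1.
by apply: bigcup_open => a _; move/continuousP: (@source_mulr a); exact.
Qed.

Lemma proj_near (x : H) (S : set (algpt G)) :
  nbhs x [set y | S (pi y)] -> nbhs (pi x) S.
Proof.
rewrite nbhsE => -[B [Bo Bx] BS]; rewrite nbhsE; exists (pi @` B).
  by split; [exact: proj_open|exists x].
by move=> _ [y /BS h <-].
Qed.

End Group.

(** * Laurent expansions *)

Section Laurent.
Context {k : closedFieldType} (char0 : [pchar k] =i pred0).

Lemma poly_cofinite_eq (e P Q : {poly k}) : e != 0 ->
  (forall s, s != 0 -> e.[s] != 0 -> P.[s] = Q.[s]) -> P = Q.
Proof.
move=> e0 h; apply/eqP; rewrite -subr_eq0; apply: contraT => PQ0.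
have : (P - Q) * ('X * e) != 0 by rewrite !mulf_neq0 ?polyX_eq0.
case/closed_nonrootP => s; rewrite !rootM !negb_or !rootE hornerX => /and3P[PQs s0 es].
by move: PQs; rewrite hornerD hornerN h // subrr eqxx.
Qed.

(** Write [R] near 1 as a fraction [p' / q'] in lowest terms. Two local expressions agree off
    finitely many points, so [q'] divides every local denominator and vanishes at most at 0. *)
Lemma locally_rational_laurent (R : k -> k) :
  (forall s0, s0 != 0 -> exists p q e : {poly k}, [/\ q.[s0] != 0, e.[s0] != 0 &
     forall s, s != 0 -> e.[s] != 0 -> R s * q.[s] = p.[s]]) ->
  exists N (L : {poly k}), forall s, s != 0 -> s ^+ N * R s = L.[s].
Proof.
move=> hR; have neq0 (P : {poly k}) s : P.[s] != 0 -> P != 0.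
  by apply: contraNneq => ->; rewrite horner0.
have [p [q [e [q1 e1 pq]]]] := hR 1 (oner_neq0 k).
have q0 := neq0 _ _ q1; have e0 := neq0 _ _ e1.
pose g := gcdp p q; pose p' := p %/ g; pose q' := q %/ g.
have pE : p' * g = p by rewrite divpK ?dvdp_gcdl.
have qE : q' * g = q by rewrite divpK ?dvdp_gcdr.
have cop : coprimep q' p' by rewrite coprimep_sym coprimep_div_gcd // q0 orbT.
have g0 : g != 0 by apply: contraNneq q0 => g0; rewrite -qE g0 mulr0.
have q'0 : q' != 0 by apply: contraNneq q0 => q'0; rewrite -qE q'0 mul0r.
have key s0 : s0 != 0 -> q'.[s0] != 0 /\ R s0 * q'.[s0] = p'.[s0].
  move=> s00; have [u [v [f [v0 f0 uv]]]] := hR s0 s00.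
  have E : p' * v = u * q'.
    apply: (@poly_cofinite_eq (e * f * g)); first by rewrite !mulf_neq0 // (neq0 _ _ f0).
    move=> s s1; rewrite !hornerM !mulf_eq0 !negb_or -andbA => /and3P[es fs gs].
    have E1 : R s * q'.[s] = p'.[s].
      by apply: (mulIf gs); rewrite -[RHS]hornerM pE -mulrA -hornerM qE pq.
    by rewrite -E1 -uv // mulrAC.
  have /dvdpP[w wE] : q' %| v.
    by rewrite -(Gauss_dvdpr v cop) E dvdp_mull.
  have q's : q'.[s0] != 0.
    by apply: contraNneq v0 => q's; rewrite wE hornerM q's mulr0.
  split=> //; apply: (mulIf v0).
  have := congr1 (fun P => P.[s0]) E; rewrite !hornerM => ->.
  by rewrite -uv // mulrAC.
have [c c0 [m qX]] : exists2 c, c != 0 & exists m, q' = c *: 'X^m.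
  apply: poly_root0 q'0 _ => z; rewrite rootE => qz; apply/eqP; apply: contraT => z0.
  by have [] := key z z0; rewrite qz.
exists m, (c^-1 *: p') => s s0; have [_ E] := key s s0.
by rewrite hornerZ -E qX hornerZ hornerXn [R s * _]mulrC -mulrA mulKf.
Qed.

Section Weights.
Context {n r : nat}.
Local Notation A := {mpoly k[n]}.
Context (phi : ('I_r -> k) -> polyaut k n).
Local Notation phm := (fun t => polyaut_map (phi t)).
Hypothesis phiM : forall s t, tunit s -> tunit t ->
  phi (fun i => s i * t i) = (phi s * phi t)%g.

Lemma phi1 : phi (fun=> 1) = 1%g.
Proof.
have u1 : tunit (fun _ : 'I_r => 1 : k) by move=> i; exact: oner_neq0.
apply: (mulgI (phi (fun=> 1))); rewrite mulg1 -phiM //; congr phi.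
by apply/funext => i; rewrite mulr1.
Qed.

Definition cochar j (s : k) p := act (phi (tcoord j s)) p.
Definition laurent j p := exists N (P : {poly A}), forall s, s != 0 ->
  s ^+ N *: cochar j s p = P.[s%:MP].
Definition eigen j (e : int) p := forall s, s != 0 -> cochar j s p = s ^ e *: p.

Lemma cocharM j s u p : s != 0 -> u != 0 -> cochar j u (cochar j s p) = cochar j (s * u) p.
Proof.
move=> s0 u0; rewrite /cochar -actM -phiM; try exact: tunit_coord.
by congr (act (phi _) p); apply/funext => i; rewrite /tcoord; case: ifP; rewrite ?mulr1.
Qed.

Lemma cocharC i j s u p : s != 0 -> u != 0 ->
  cochar j u (cochar i s p) = cochar i s (cochar j u p).
Proof.
move=> s0 u0; rewrite /cochar -!actM -!phiM; try exact: tunit_coord.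
by congr (act (phi _) p); apply/funext => l; rewrite mulrC.
Qed.

Lemma mpolyC_horner_eq (P Q : {poly A}) :
  (forall s : k, s != 0 -> P.[s%:MP] = Q.[s%:MP]) -> P = Q.
Proof.
move=> h; apply/eqP; rewrite -subr_eq0; apply/eqP.
apply: (@roots_geq_poly_eq0 _ _ [seq (i : nat)%:R | i <- iota 1 (size (P - Q))]).
- apply/allP => x /mapP[i]; rewrite mem_iota => /andP[i0 _] ->.
  have i0' : (i%:R : k) != 0 by rewrite ((pcharf0P _).1 char0) -lt0n.
  by rewrite rootE hornerD hornerN -mpolyC_nat h // subrr.
- rewrite map_inj_uniq ?iota_uniq // => a b; rewrite -!mpolyC_nat => /(congr1 (mcoeff 0%MM)).
  rewrite !mcoeffC eqxx !mulr1.
  exact: (char0_natr_inj char0).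
by rewrite size_map size_iota.
Qed.

Lemma cochar_horner j u (P : {poly A}) (s : k) :
  cochar j u P.[s%:MP] = (map_poly (cochar j u) P).[s%:MP].
Proof.
rewrite /cochar /act; have := horner_map (comp_mpoly (polyaut_map (phi (tcoord j u)))) P s%:MP.
by rewrite /= comp_mpolyC => <-.
Qed.

Lemma coef_cochar j u (P : {poly A}) l : (map_poly (cochar j u) P)`_l = cochar j u P`_l.
Proof. by rewrite coef_map_id0 // /cochar /act comp_mpoly0. Qed.

(** Multiplicativity of the one-parameter subgroup, read coefficient by coefficient in [s], shows
    that the [l]-th coefficient is an eigenvector with exponent [l - N]. As the subgroups commute,
    eigenvector properties for the other coordinates are inherited. *)
Lemma laurent_eigen j p : laurent j p -> exists (M : nat) (c : nat -> A),
  [/\ p = \sum_(l < M) c l, forall l, exists e, eigen j e (c l) &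
      forall i e, eigen i e p -> forall l, eigen i e (c l)].
Proof.
case=> N [P PE]; exists (size P), (fun l => P`_l); split.
- have := PE 1 (oner_neq0 k); rewrite expr1n scale1r mpolyC1 horner_coef.
  rewrite /cochar (_ : tcoord j 1 = fun=> 1); last first.
    by apply/funext => i; rewrite /tcoord if_same.
  by rewrite phi1 act1 => ->; apply: eq_bigr => l _; rewrite expr1n mulr1.
- move=> l; exists (l%:Z - N%:Z) => u u0.
  have uN0 : u ^+ N != 0 by exact: expf_neq0.
  have E : (u ^+ N)%:MP%:P * map_poly (cochar j u) P = \poly_(i < size P) (u%:MP ^+ i * P`_i).
    apply: mpolyC_horner_eq => s s0.
    rewrite hornerM hornerC -cochar_horner -PE // horner_poly.
    rewrite {1}/cochar act_scale -/(cochar j u _) cocharM // mul_mpolyC scalerA -exprMn.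
    rewrite [u * s]mulrC PE ?mulf_neq0 // horner_coef; apply: eq_bigr => i _.
    by rewrite mpolyCM exprMn [RHS]mulrAC [RHS]mulrC; congr (_ * _); rewrite mulrC.
  have := congr1 (fun Q : {poly A} => Q`_l) E; rewrite /= coefCM coef_cochar coef_poly.
  rewrite mul_mpolyC; case: ltnP => [_|lP]; last first.
    by rewrite nth_default // /cochar /act comp_mpoly0 !scaler0.
  rewrite -(rmorphXn (@mpolyC n k)) mul_mpolyC => /(congr1 (fun x => (u ^+ N)^-1 *: x)).
  rewrite !scalerA mulVf // scale1r => ->; congr (_ *: _).
  by rewrite expfzDr // -invr_expz -!exprnP mulrC.
move=> i e ep l u u0.
have E : map_poly (cochar i u) P = (u ^ e)%:MP%:P * P.
  apply: mpolyC_horner_eq => s s0.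
  rewrite hornerM hornerC -cochar_horner -PE // {1}/cochar act_scale -/(cochar i u _).
  rewrite cocharC // (ep u u0) {1}/cochar act_scale -/(cochar j s _) mul_mpolyC.
  by rewrite !scalerA mulrC.
by have := congr1 (fun Q : {poly A} => Q`_l) E; rewrite /= coefCM coef_cochar mul_mpolyC.
Qed.

Hypothesis laurentX : forall j i, laurent j 'X_i.

Lemma laurent_all j p : laurent j p.
Proof.
elim/mpoly_alg_ind: p => [c|i|p q [N [P PE]] [M [Q QE]]|p q [N [P PE]] [M [Q QE]]].
- by exists 0%N, c%:MP%:P => s s0; rewrite hornerC /cochar act_cst scale1r.
- exact: laurentX.
- exists (N + M)%N, ('X^M * P + 'X^N * Q) => s s0.
  rewrite hornerD !hornerM !hornerXn -PE // -QE // -!(rmorphXn (@mpolyC n k)) !mul_mpolyC !scalerA.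
  by rewrite /cochar /act comp_mpolyD scalerDr !exprD [_ ^+ M * _]mulrC.
exists (N + M)%N, (P * Q) => s s0; rewrite hornerM -PE // -QE //.
by rewrite /cochar act_mul -scalerAl -scalerAr scalerA exprD.
Qed.

Lemma eigen_hom q : (forall j, exists e, eigen j e q) -> exists c, hom phm c q.
Proof.
move=> /choice[e eP]; exists (\row_j e j) => t ut.
have u1 : tunit (fun _ : 'I_r => 1 : k) by move=> i; exact: oner_neq0.
pose tr (s : seq 'I_r) i := if i \in s then t i else 1.
have utr s : tunit (tr s) by move=> i; rewrite /tr; case: ifP; rewrite ?oner_neq0.
suff key s : uniq s -> act (phi (tr s)) q = (\prod_(i <- s) t i ^ e i) *: q.
  have := key (enum 'I_r) (enum_uniq _); rewrite (_ : tr _ = t); last first.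
    by apply/funext => i; rewrite /tr mem_enum.
  rewrite /act => ->; congr (_ *: _); rewrite /tpow big_enum /=.
  by apply: eq_bigr => i _; rewrite mxE.
elim: s => [_|j s IH /= /andP[js us]].
  by rewrite big_nil scale1r [tr _](_ : _ = fun=> 1) ?phi1 ?act1.
have -> : tr (j :: s) = fun i => tcoord j (t j) i * tr s i.
  apply/funext => i; rewrite /tr /tcoord inE; case: eqVneq => [->|_] /=.
    by rewrite (negbTE js) mulr1.
  by rewrite mul1r.
rewrite phiM //; last exact: tunit_coord.
rewrite actM -/(cochar j (t j) q) (eP j) // act_scale IH // scalerA big_cons.
by [].
Qed.

Lemma laurent_hom_dec p : sum_of (fun q => exists c, hom phm c q) p.
Proof.
have key (s : seq 'I_r) : forall p, sum_of (fun q => forall j, j \in s -> exists e, eigen j e q) p.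
  elim: s => [|j s IH] {}p; first exact: sum_of1.
  elim: (IH p) => [|x y hx _ hy]; first exact: sum_of0.
  apply: sum_of_add hy; have [M [c [xE c1 c2]]] := laurent_eigen (laurent_all j x).
  rewrite xE; apply: sum_of_sum => l _; apply: sum_of1 => i; rewrite inE => /predU1P[->|i_s].
    exact: c1.
  by have [e he] := hx i i_s; exists e; exact: c2.
apply: (sum_of_morph (f := id)) (key (enum 'I_r) p) => // x hx.
by apply: sum_of1; apply: eigen_hom => j; apply: hx; rewrite mem_enum.
Qed.

End Weights.
End Laurent.

(** * The torus of automorphisms *)

Lemma polyaut_map_inj (k : fieldType) n : injective (@polyaut_map k n).
Proof.
move=> [[a b] /= abP] [[c d] /= cdP]; rewrite /polyaut_map /= => E; apply: val_inj => /=.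
move: abP cdP; rewrite -E /inverse_pair /= => /andP[_ /eqP ba] /andP[/eqP ad _].
by rewrite -(polyend_1comp d) -ba -polyend_compA ad polyend_comp1.
Qed.

Lemma msize_mulr (k : fieldType) n (p q : {mpoly k[n]}) : q != 0 -> (msize p <= msize (p * q))%N.
Proof.
move=> q0; have [->|p0] := eqVneq p 0; first by rewrite mul0r.
by rewrite msizeM //; move: q0; rewrite -msize_poly_eq0; case: (msize q) => // m _; rewrite addnS leq_addr.
Qed.

Lemma mpoly_open_eq (k : closedFieldType) (char0 : [pchar k] =i pred0) n (e p q : {mpoly k[n]}) :
  e != 0 -> (forall a, e.@[a] != 0 -> p.@[a] = q.@[a]) -> p = q.
Proof.
move=> e0 h; apply/eqP; rewrite -subr_eq0; apply/eqP/(mulfI e0); rewrite mulr0.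
apply: (mpoly_eval0 char0) => a; rewrite mevalM mevalB.
by have [->|ea] := eqVneq e.@[fun i => (a i)%:R] 0; rewrite ?mul0r // h // subrr mulr0.
Qed.

Lemma meval_neq0 (k : fieldType) n (p : {mpoly k[n]}) a : p.@[a] != 0 -> p != 0.
Proof. by apply: contraNneq => ->; rewrite meval0. Qed.

Lemma common_denominator (k : fieldType) n (x : affine k n) m (g : 'I_m -> affine k n -> k) :
  (forall j, regular_at x (g j)) -> exists (P : 'I_m -> {mpoly k[n]}) (d : {mpoly k[n]}),
  d.@[x] != 0 /\ \forall y \near x, d.@[y] != 0 /\ forall j, g j y = (P j).@[y] / d.@[y].
Proof.
move=> /choice[p /choice[q pq]].
exists (fun j => p j * \prod_(l | l != j) q l), (\prod_j q j).
have dx : (\prod_j q j).@[x] != 0.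
  by rewrite rmorph_prod; apply/prodf_neq0 => j _; case: (pq j).
split=> //.
have near_d : \forall y \near x, (\prod_j q j).@[y] != 0 by apply/affine_nbhsP; eexists; split; first exact: dx.
have near_g : \forall y \near x, forall j, g j y = (p j).@[y] / (q j).@[y].
  exact: (@filter_forall _ _ (fun j y => g j y = (p j).@[y] / (q j).@[y]) (nbhs x) _
    (fun j => proj2 (pq j))).
apply: filterS2 near_d near_g => y dy gy; split=> // j; rewrite gy.
have q0 l : (q l).@[y] != 0 by move: dy; rewrite rmorph_prod => /prodf_neq0; apply.
have dE : \prod_j q j = q j * \prod_(l | l != j) q l by rewrite (bigD1 j).
rewrite dE !mevalM invfM mulrACA divff ?mulr1 //.
by rewrite rmorph_prod; apply/prodf_neq0 => l _; exact: q0.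
Qed.

Lemma coord_regular (k : fieldType) n (x : affine k n) i :
  regular_at (x : (affine k n : spaceType k)) (fun w => w i).
Proof.
exists 'X_i, 1; split; first by rewrite rmorph1 oner_neq0.
by apply: filterE => y; rewrite mevalXU rmorph1 divr1.
Qed.

Section Action.
Context {k : closedFieldType} (char0 : [pchar k] =i pred0) {n : nat} (G : algSubgroup k n).
Local Notation H := (alg_source G).

Lemma algpt_eval_regular (z : algpt G) (a : affine k n) i :
  regular_at z (fun z : algpt G => (tnth (polyaut_map (val z)) i).@[a]).
Proof.
apply: filterE => _ x _.
have [_ /(_ (x, a) (fun w => w i) (coord_regular _ i))] := alg_actionM G.
exact: (vprod_slicel_regular (@source_chart k n G)).
Qed.

Lemma msize_lincomb m (c : 'I_m -> k) (P : 'I_m -> {mpoly k[n]}) :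
  (msize (\sum_j c j *: P j) <= \sum_j msize (P j))%N.
Proof.
elim/big_rec2: _ => [|j s p _ IH]; first by rewrite msize0.
apply: leq_trans (msizeD_le _ _) _; rewrite geq_max.
rewrite (leq_trans (msizeZ_le _ _) (leq_addr _ _)).
exact: leq_trans IH (leq_addl _ _).
Qed.

(* Near [1] the coordinate functions of the action are quotients of functions of
   the form [\sum_j f_j(h) g_j(a)], whose degree in [a] is bounded. *)
Lemma source_degree i : exists D : nat,
  \forall h \near (1%g : H), (msize (tnth (polyaut_map (alg_hom G h)) i) <= D)%N.
Proof.
pose o : affine k n := fun=> 0.
have [_ /(_ (1%g, o) (fun w => w i) (coord_regular _ i))] := alg_actionM G.
case=> r [r' [f [g [f' [g' [R1 R2 nz sE]]]]]].
have [P [d [d0 gE]]] := common_denominator (fun j => proj2 (R1 j)).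
have [P' [d' [d'0 g'E]]] := common_denominator (fun j => proj2 (R2 j)).
exists (\sum_j msize (P j) + msize d')%N.
have A1 : \forall h \near (1%g : H), sum_tensor f' g' (h, o) != 0.
  refine (regular_neq0 (source_chart _) (f := fun h => sum_tensor f' g' (h, o)) _ nz).
  apply: regular_at_local (regular_sum (source_chart _) (fun i => g' i o) (fun j => proj1 (R2 j))).
  by apply: filterE => z; apply: eq_bigr => l _; rewrite mulrC.
have A2 := vprod_slicel (@source_chart k n G) (near_join sE).
apply: filterS2 A1 A2 => h den0 nearw.
have A3 : \forall a \near o, (tnth (polyaut_map (alg_hom G h)) i).@[a] =
    sum_tensor f g (h, a) / sum_tensor f' g' (h, a) := vprod_slicer (@affine_chart k n) nearw.
have [e [eo eP]] := (affine_nbhsP _ _).1 (filterI A3 (filterI gE g'E)).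
set F := tnth _ i.
pose Num := \sum_j f j h *: P j; pose Den := \sum_j f' j h *: P' j.
have sumE m (u : 'I_m -> H -> k) (v : 'I_m -> affine k n -> k) (Q : 'I_m -> {mpoly k[n]}) (c : {mpoly k[n]}) a :
    (forall j, v j a = (Q j).@[a] / c.@[a]) ->
    sum_tensor u v (h, a) = (\sum_j u j h *: Q j).@[a] / c.@[a].
  move=> vE; rewrite /sum_tensor raddf_sum mulr_suml; apply: eq_bigr => j _ /=.
  by rewrite vE mevalZ mulrA.
have [sEo [[do' gEo] [d'o g'Eo]]] := eP o eo.
have Den0 : Den.@[o] != 0.
  by move: den0; rewrite (sumE _ _ _ _ _ _ g'Eo) mulf_eq0 negb_or => /andP[].
(* Clearing denominators turns equality on an open set into an identity. Multiplication by a
   non-zero polynomial does not lower [msize], so the right-hand side bounds [F] uniformly in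
   [h]. *)
have E : F * Den * d = Num * d'.
  apply: (mpoly_open_eq char0 (e := e * Den)); first by rewrite mulf_neq0 ?(meval_neq0 eo) ?(meval_neq0 Den0).
  move=> a; rewrite !mevalM mulf_eq0 negb_or => /andP[ea Dena].
  have [Ea [[da ga] [d'a g'a]]] := eP a ea; move: Ea => /= Ea.
  have -> : F.@[a] = Num.@[a] / d.@[a] / (Den.@[a] / d'.@[a]).
    by rewrite -(sumE _ _ _ _ _ _ ga) -(sumE _ _ _ _ _ _ g'a) -Ea.
  rewrite invf_div mulrAC -!mulrA; congr (_ * _).
  by field; rewrite da Dena.
apply: (leq_trans (msize_mulr F (meval_neq0 Den0))).
apply: (leq_trans (msize_mulr (F * Den) (meval_neq0 d0))).
rewrite E; apply: leq_trans (msizeM_leq _ _) _.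
by rewrite leq_add2r; exact: msize_lincomb.
Qed.

Lemma algpt_degree : exists D : nat, \forall z \near (1%g : algpt G),
  forall i, (msize (tnth (polyaut_map (val z)) i) <= D)%N.
Proof.
have /choice[D DP] := source_degree; exists (\max_i D i).
rewrite -(proj_one G); apply: proj_near.
have DP' := @filter_forall _ _ (fun i (h : H) => (msize (tnth (polyaut_map (alg_hom G h)) i) <= D i)%N)
  (nbhs (1%g : H)) (nbhs_filter _) DP.
apply: filterS DP' => h hD i.
by apply: leq_trans (hD i) _; exact: leq_bigmax.
Qed.

End Action.

(** * The action of the torus is algebraic in the sense of weights *)

Section TorusMap.
Context {k : closedFieldType} (char0 : [pchar k] =i pred0) {n r : nat} (G : algSubgroup k n).
Context (f : Gm_set k r -> id_component G).
Hypothesis fiso : is_isomorphism f.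
Hypothesis fM : forall s t u : Gm_set k r, (forall i, val u i = val s i * val t i) ->
  val (f u) = (val (f s) * val (f t))%g.

Definition torus_pt (t : 'I_r -> k) (ut : tunit t) : Gm_set k r := SigSub (mem_set (ut : Gm_set k r t)).

(** Extended by the identity to all [t], because the theory of gradings takes a total function
    restricted by [tunit]. *)
Definition torus_aut (t : 'I_r -> k) : polyaut k n :=
  if pselect (tunit t) is left ut then val (val (f (torus_pt ut))) else 1%g.

Local Notation phi := torus_aut.
Local Notation phm := (fun t => polyaut_map (phi t)).

Lemma torus_unit (u : Gm_set k r) : tunit (val u).
Proof. exact: set_mem (valP u). Qed.

Lemma torus_autE (u : Gm_set k r) : phi (val u) = val (val (f u)).
Proof.
rewrite /phi; case: pselect => [ut|[]]; last exact: torus_unit.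
by congr (val (val (f _))); exact: val_inj.
Qed.

Lemma torus_aut_pt t (ut : tunit t) : phi t = val (val (f (torus_pt ut))).
Proof. by rewrite -torus_autE. Qed.

Lemma torus_autM s t : tunit s -> tunit t -> phi (fun i => s i * t i) = (phi s * phi t)%g.
Proof.
move=> us ut; have ust : tunit (fun i => s i * t i) by move=> i; rewrite mulf_neq0.
by rewrite !torus_aut_pt (fM (s := torus_pt us) (t := torus_pt ut)).
Qed.

Let u1 : tunit (fun _ : 'I_r => 1 : k).
Proof. by move=> i; exact: oner_neq0. Qed.

Lemma torus_one (v : tunit (fun=> 1)) : val (f (torus_pt v)) = 1%g.
Proof. by apply: val_inj; rewrite /= -torus_aut_pt; exact: (phi1 torus_autM). Qed.

Lemma torus_faithful t : tunit t -> phm t = polyend_id -> forall i, t i = 1.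
Proof.
move=> ut E i; have [_ [g [fK _ _]]] := fiso.
have E' : f (torus_pt ut) = f (torus_pt u1).
  apply/val_inj/val_inj; rewrite -!torus_aut_pt.
  by apply: polyaut_map_inj; rewrite (phi1 torus_autM) E.
by have /(congr1 (fun u : Gm_set k r => val u i)) := can_inj fK E'.
Qed.

Lemma torus_image t : tunit t -> id_component_image G (phi t).
Proof. by move=> ut; rewrite torus_aut_pt; exists (val (f (torus_pt ut))) => //; exact/set_mem/valP. Qed.

Lemma torus_image_surj x : id_component_image G x -> exists2 t, tunit t & x = phi t.
Proof.
case=> z zT <-; have [_ [g [_ gK _]]] := fiso.
exists (val (g (SigSub (mem_set zT)))); first exact: torus_unit.
by rewrite torus_autE gK.
Qed.

Lemma torus_eval_rational (t0 : 'I_r -> k) (a : affine k n) i : tunit t0 ->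
  exists p q e : {mpoly k[r]}, [/\ q.@[t0] != 0, e.@[t0] != 0 &
    forall t, tunit t -> e.@[t] != 0 -> (tnth (phm t) i).@[a] * q.@[t] = p.@[t]].
Proof.
move=> ut0; pose u := torus_pt ut0.
pose F (z : algpt G) := (tnth (polyaut_map (val z)) i).@[a].
have [[_ fr] _] := fiso.
have [|h [p [q [qu hE]]] FE] := fr u (F \o val).
  by exists F; [exact: algpt_eval_regular|apply: filterE].
have [e1 [e1u e1P]] := (sub_affine_nbhsP _ _).1 FE.
have [e2 [e2u e2P]] := (affine_nbhsP _ _).1 hE.
exists p, q, (e1 * e2 * q); split=> //; first by rewrite !mevalM !mulf_neq0.
move=> t ut; rewrite !mevalM !mulf_eq0 !negb_or -andbA => /and3P[e1t e2t qt].
have := e1P (torus_pt ut) e1t; rewrite /= /F -torus_aut_pt => ->.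
by rewrite (e2P t e2t) divfK.
Qed.

Lemma torus_degree : exists (D : nat) (e : {mpoly k[r]}), e.@[fun=> 1] != 0 /\
  forall t, tunit t -> e.@[t] != 0 -> forall i, (msize (tnth (phm t) i) <= D)%N.
Proof.
have [D DP] := algpt_degree char0 G; exists D.
have [[fc _] _] := fiso.
rewrite -(torus_one u1) in DP; have := fc _ _ (near_sub DP).
case/sub_affine_nbhsP => e [e1 eP]; exists e; split=> // t ut et i.
by rewrite torus_aut_pt; exact: (eP (torus_pt ut) et).
Qed.

Definition restrict_line (j : 'I_r) (p : {mpoly k[r]}) : {poly k} :=
  mmap polyC (fun i => if i == j then 'X else 1) p.

Lemma restrict_lineE j p s : (restrict_line j p).[s] = p.@[tcoord j s].
Proof.
rewrite /restrict_line; elim/mpoly_alg_ind: p => [c|i|p q IHp IHq|p q IHp IHq].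
- by rewrite mmapC hornerC mevalC.
- by rewrite mmapX mmap1U mevalXU /tcoord; case: ifP => _; rewrite ?hornerX ?hornerC.
- by rewrite rmorphD hornerD IHp IHq mevalD.
by rewrite rmorphM hornerM IHp IHq mevalM.
Qed.

Lemma torus_eval_laurent j i (a : affine k n) : exists N (L : {poly k}), forall s, s != 0 ->
  s ^+ N * (tnth (phm (tcoord j s)) i).@[a] = L.[s].
Proof.
apply: (locally_rational_laurent (R := fun s => (tnth (phm (tcoord j s)) i).@[a])) => s0 s00.
have [p [q [e [q0 e0 E]]]] := torus_eval_rational a i (tunit_coord j s00).
exists (restrict_line j p), (restrict_line j q), (restrict_line j e).
split; rewrite ?restrict_lineE // => s s1; rewrite !restrict_lineE => es.
by apply: E => //; exact: tunit_coord.
Qed.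

(** At each fixed point of affine space the coordinate is a Laurent polynomial in [s]. Where the
    degree is bounded, values at grid points determine the whole polynomial by interpolation; the
    resulting identity extends to every [s != 0] because at each integral point both sides are
    Laurent polynomials. *)
Lemma torus_laurent j i : laurent phi j 'X_i.
Proof.
have [D [e [e1 eD]]] := torus_degree.
pose el := restrict_line j e.
have el0 : el != 0.
  apply: contraNneq e1 => el0; have := restrict_lineE j e 1.
  rewrite -/el el0 horner0 => ->; apply/eqP; congr (e.@[_]).
  by apply/funext => l; rewrite /tcoord if_same.
have cE s : cochar phi j s 'X_i = tnth (phm (tcoord j s)) i.
  by rewrite /cochar /act comp_mpolyXU -tnth_nth.
have /choice[N0 /choice[L0 L0P]] := torus_eval_laurent j i.
have [B BP] := mpoly_interp char0 n D.
pose pt (g : {ffun 'I_n -> 'I_D}) : affine k n := fun l => (g l : nat)%:R.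
pose N := (\sum_g N0 (pt g))%N.
pose L g := 'X^(N - N0 (pt g)) * L0 (pt g).
have LP g s : s != 0 -> s ^+ N * (tnth (phm (tcoord j s)) i).@[pt g] = (L g).[s].
  move=> s0; rewrite hornerM hornerXn -L0P // mulrA -exprD subnK //.
  by rewrite /N (bigD1 g) //= leq_addr.
pose P : {poly {mpoly k[n]}} := \sum_g map_poly (@mpolyC n k) (L g) * (B g)%:P.
have PE s : P.[s%:MP] = \sum_g (L g).[s] *: B g.
  rewrite horner_sum; apply: eq_bigr => g _.
  by rewrite hornerM hornerC (horner_map (@mpolyC n k)) mul_mpolyC.
have good s : s != 0 -> el.[s] != 0 -> s ^+ N *: cochar phi j s 'X_i = P.[s%:MP].
  move=> s0 es; rewrite restrict_lineE in es.
  rewrite PE cE {1}(BP _ (eD _ (tunit_coord j s0) es i)) scaler_sumr.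
  by apply: eq_bigr => g _; rewrite scalerA LP.
exists N, P => s s0; apply/eqP; rewrite -subr_eq0; apply/eqP/(mpoly_eval0 char0) => b.
pose b' : affine k n := fun l => (b l)%:R; rewrite -/b'.
pose Eb : {poly k} := \sum_g (B g).@[b'] *: L g.
have EbE u : Eb.[u] = (P.[u%:MP]).@[b'].
  rewrite PE raddf_sum horner_sum; apply: eq_bigr => g _ /=.
  by rewrite hornerZ mevalZ mulrC.
have E : 'X^(N0 b') * Eb = 'X^N * L0 b'.
  apply: (poly_cofinite_eq el0) => u u0 eu.
  rewrite !hornerM !hornerXn EbE -good // mevalZ -L0P // cE.
  by rewrite mulrCA.
have := congr1 (fun Q => Q.[s]) E; rewrite /= !hornerM !hornerXn EbE -L0P // mulrCA.
move/(mulfI (expf_neq0 _ s0)) => Es.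
by rewrite mevalB mevalZ Es cE subrr.
Qed.

Lemma torus_hom_dec p : sum_of (fun q => exists c, hom phm c q) p.
Proof. exact: (laurent_hom_dec char0 torus_autM torus_laurent). Qed.

End TorusMap.

(** * Dimension and components *)

Section PrimeChain.
Context {k : fieldType} (char0 : [pchar k] =i pred0) {n : nat}.
Local Notation A := {mpoly k[n]}.
Context (d : nat) (I : nat -> A -> Prop).
Hypothesis I_ideal : forall i, (i <= d)%N -> is_ideal (I i).
Hypothesis I_proper : forall i, (i <= d)%N -> ~ I i 1.
Hypothesis I_prime : forall i, (i <= d)%N -> forall p q, I i (p * q) -> I i p \/ I i q.
Hypothesis I_decr : forall i p, (i < d)%N -> I i.+1 p -> I i p.
Hypothesis I_strict : forall i, (i < d)%N -> exists2 p, I i p & ~ I i.+1 p.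

Let ideal_add i p q : (i <= d)%N -> I i p -> I i q -> I i (p + q).
Proof. by move=> /I_ideal[_ h] Ip Iq; rewrite -[p]mul1r; exact: h. Qed.

Let ideal_mull i a p : (i <= d)%N -> I i p -> I i (a * p).
Proof. by move=> /I_ideal[h0 h] Ip; rewrite -[a * p]addr0; exact: h. Qed.

Let ideal_sum i (T : Type) (s : seq T) (P : pred T) (F : T -> A) : (i <= d)%N ->
  (forall j, P j -> I i (F j)) -> I i (\sum_(j <- s | P j) F j).
Proof.
move=> id h; elim/big_ind: _ => //; first by case: (I_ideal id).
by move=> x y; exact: ideal_add.
Qed.

(* The polynomials [f i] in [I i] but not in [I i.+1] are algebraically
   independent modulo [I d]: in a relation one divides by the largest power of
   the last one, and then reduces modulo the preceding ideal. *)
Lemma chain_independent (f : nat -> A) :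
  (forall i, (i < d)%N -> I i (f i) /\ ~ I i.+1 (f i)) ->
  forall m, (m <= d)%N -> forall (T : finType) (J : {set T}) (e : T -> nat -> nat) (c : T -> k),
  J != finset.set0 -> (forall j, j \in J -> c j != 0) ->
  (forall i j, i \in J -> j \in J -> (forall l, (l < m)%N -> e i l = e j l) -> i = j) ->
  ~ I m (\sum_(j in J) c j *: \prod_(l < m) f l ^+ e j l).
Proof.
move=> fP; elim=> [|m IH] md T J e c /set0Pn[j0 Jj0] cJ inj.
  have rest : \sum_(j | (j \in J) && (j != j0)) c j *: \prod_(l < 0) f l ^+ e j l = 0.
    by apply: big1 => j /andP[Jj jj]; case/eqP: jj; apply: inj.
  rewrite (bigD1 j0) //= rest addr0 big_ord0 => h; apply: (I_proper (i := 0)) => //.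
  have := @ideal_mull 0%N (c j0)^-1%:MP _ isT h.
  by rewrite mul_mpolyC scalerA mulVf ?scale1r // cJ.
have [Im nIm] := fP m md; have md' := ltnW md.
case: (@arg_minnP _ j0 (mem J) (fun j => e j m) Jj0) => j1 Jj1 jmin.
set e0 := e j1 m in jmin; pose g j := c j *: \prod_(l < m) f l ^+ e j l.
have -> : \sum_(j in J) c j *: \prod_(l < m.+1) f l ^+ e j l =
    f m ^+ e0 * \sum_(j in J) g j * f m ^+ (e j m - e0).
  rewrite mulr_sumr; apply: eq_bigr => j Jj.
  rewrite big_ord_recr /= /g mulrCA -exprD subnKC; last exact: jmin.
  by rewrite scalerAl.
case/(I_prime md) => [|h].
  elim: e0 {jmin} => [|x IHx]; first by rewrite expr0; exact: I_proper.
  by rewrite exprS => /(I_prime md)[].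
apply: (IH md' T [set j in J | e j m == e0]%SET e c).
- by apply/set0Pn; exists j1; rewrite inE eqxx andbT; exact: Jj1.
- by move=> j; rewrite inE => /andP[Jj _]; exact: cJ.
- move=> i j; rewrite !inE => /andP[Ji /eqP ei] /andP[Jj /eqP ej] eij; apply: inj => // l.
  by rewrite ltnS leq_eqVlt => /predU1P[->|/eij//]; rewrite ei.
have := I_decr md h; rewrite (bigID (fun j => e j m == e0)) /=.
set S1 := \sum_(j in J | _) _ => hS.
have E : S1 = \sum_(j in [set j in J | e j m == e0]%SET) g j.
  rewrite /S1; apply: eq_big => [j|j /andP[_ /eqP ->]]; first by rewrite inE.
  by rewrite subnn expr0 mulr1.
rewrite -/g -E; move: hS; set S2 := \sum_(j in J | _) _ => hS.
rewrite -[S1](addrK S2) -[- S2]mulN1r; apply: ideal_add => //; apply: ideal_mull => //.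
apply: ideal_sum => // j /andP[Jj je].
have lt : (e0 < e j m)%N by rewrite ltn_neqAle eq_sym je; exact: jmin.
by rewrite -(prednK (n := (e j m - e0)%N)) ?subn_gt0 // exprSr mulrA; exact: ideal_mull.
Qed.

Lemma prime_chain_leq : (d <= n)%N.
Proof.
rewrite leqNgt; apply/negP => nd.
have /choice[f fP] : forall i, exists p, (i < d)%N -> I i p /\ ~ I i.+1 p.
  move=> i; case: (ltnP i d) => [id|_]; last by exists 0.
  by have [p h1 h2] := I_strict id; exists p.
have [M [c [[al0 c0] cE]]] := monomials_dep char0 (fun i : 'I_d => f i) nd.
pose J : {set {ffun 'I_d -> 'I_M}} := [set al | c al != 0]%SET.
pose e (al : {ffun 'I_d -> 'I_M}) l : nat := if insub l is Some i then al i else 0%N.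
apply: (@chain_independent f fP d (leqnn d) _ J e c).
- by apply/set0Pn; exists al0; rewrite inE.
- by move=> j; rewrite inE.
- move=> i j _ _ eij; apply/ffunP => l; apply/val_inj.
  by have := eij l (ltn_ord l); rewrite /e valK.
suff -> : \sum_(al in J) c al *: \prod_(l < d) f l ^+ e al l = 0 by case: (I_ideal (leqnn d)).
rewrite -[RHS]cE [RHS](bigID (mem J)) /= [X in _ + X]big1 ?addr0 => [|al].
  by apply: eq_bigr => al _; congr (_ *: _); apply: eq_bigr => l _; rewrite /e valK.
by rewrite inE negbK => /eqP ->; rewrite scale0r.
Qed.

End PrimeChain.

Lemma connected_image (X Y : topologicalType) (f : X -> Y) (C : set X) :
  continuous f -> connected C -> connected (f @` C).
Proof. by move=> fc Cc; apply: connected_continuous_connected Cc _; exact: continuous_subspaceT. Qed.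

Lemma closed_preimage (X Y : topologicalType) (f : X -> Y) (D : set Y) :
  continuous f -> closed D -> closed (f @^-1` D).
Proof. by move=> fc; apply: preimage_closed => x _; exact: fc. Qed.

Lemma irreducible_connected (X : topologicalType) (C : set X) : irreducible C -> connected C.
Proof.
case=> _ irr B [b Bb] [U Uo BU] [D Dc BD].
have [|CD|CU] := irr D (~` U) Dc (open_closedC Uo).
- move=> x Cx; have [Ux|nUx] := pselect (U x); last by right.
  by left; have : B x by [rewrite BU]; rewrite BD => -[].
- by rewrite BD; apply/seteqP; split=> x; [case|move=> Cx; split=> //; exact: CD].
by exfalso; move: Bb; rewrite BU => -[/CU].
Qed.

Inductive finitely_connected (X : topologicalType) : set X -> Prop :=
| finitely_connected1 C : connected C -> finitely_connected C
| finitely_connectedU C D :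
    finitely_connected C -> finitely_connected D -> finitely_connected (C `|` D).

(** A closed set that is not connected is the union of two proper closed subsets; if it is not a
    finite union of connected sets, neither is one of these. Iteration violates the chain
    condition. *)
Lemma noetherian_finitely_connected (X : topologicalType) :
  (forall Z : nat -> set X, (forall i, closed (Z i)) -> (forall i, Z i.+1 `<=` Z i) ->
     exists i, Z i `<=` Z i.+1) ->
  forall C : set X, closed C -> finitely_connected C.
Proof.
move=> dcc C Cc; apply: contrapT => nC.
pose bad (D : set X) := closed D /\ ~ finitely_connected D.
have /choice[F FP] : forall D, exists E, bad D -> bad E /\ (E `<=` D /\ ~ D `<=` E).
  move=> D; have [[Dc nD]|] := pselect (bad D); last by exists D.
  have : ~ connected D by move=> /finitely_connected1.
  move=> /existsNP[B /not_implyP[[b Bb] /not_implyP[[U Uo BU] /not_implyP[[V Vc BV] BD]]]].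
  have Bc : closed B by rewrite BV; exact: closedI.
  have Ec : closed (D `&` ~` U) by apply: closedI => //; exact: open_closedC.
  have [fB|nB] := pselect (finitely_connected B); last first.
    exists B => _; do !split=> //; first by rewrite BV => x [].
    by move=> DB; apply: BD; apply/seteqP; split=> //; rewrite BV => x [].
  exists (D `&` ~` U) => _; do !split=> //.
  - move=> fE; apply: nD; rewrite (_ : D = B `|` (D `&` ~` U)).
      exact: finitely_connectedU.
    by rewrite {1}BU -setIUr setUv setIT.
  - by move: Bb; rewrite BU => -[Db Ub] /(_ b Db)[_]; apply.
pose Z i := iter i F C.
have badZ i : bad (Z i) by elim: i => [|i IH] //=; case: (FP _ IH).
have [i ZF] : exists i, Z i `<=` Z i.+1.
  by apply: dcc => i; [case: (badZ i)|case: (FP _ (badZ i)) => _ []].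
by have [_ [_]] := FP _ (badZ i).
Qed.

Lemma sub_affine_closed (k : fieldType) n (A : set (affine k n)) (D : set A) (x : A) :
  closed D -> ~ D x -> exists p, p.@[val x] != 0 /\ forall y, D y -> p.@[val y] = 0.
Proof.
move=> Dc nDx; have : nbhs x (~` D) by apply: open_nbhs_nbhs; split=> //; exact: closed_openC.
case/sub_affine_nbhsP => p [px h]; exists p; split=> // y Dy.
by apply: contrapT => /eqP py; exact: (h y py).
Qed.

Lemma sub_affine_noetherian (k : fieldType) n (A : set (affine k n)) (Z : nat -> set A) :
  (forall i, closed (Z i)) -> (forall i, Z i.+1 `<=` Z i) -> exists i, Z i `<=` Z i.+1.
Proof.
move=> Zc Zdec; pose I i (p : {mpoly k[n]}) := forall y, Z i y -> p.@[val y] = 0.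
have [||i Ii] := @mpoly_acc _ _ I.
- move=> i; split=> [y _|a p q Ip Iq y Zy]; first by rewrite meval0.
  by rewrite mevalD mevalM Ip // Iq // mulr0 addr0.
- by move=> i p Ip y /Zdec; exact: Ip.
exists i => x Zx; apply: contrapT => nZ.
have [p [px pZ]] := sub_affine_closed (Zc i.+1) nZ.
by case/eqP: px; apply: (Ii p pZ).
Qed.

(** * The identity component has finite index *)

Section Components.
Context {k : closedFieldType} (char0 : [pchar k] =i pred0) {n : nat} (G : algSubgroup k n).
Local Notation H := (alg_source G).
Local Notation pi := (@alg_proj k n G).

Lemma id_component1 : id_component G 1%g.
Proof. exact: connected_component_refl. Qed.

Lemma id_component_max (C : set (algpt G)) : C 1%g -> connected C -> C `<=` id_component G.
Proof. by move=> C1 Cc; apply: connected_component_max. Qed.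

Lemma id_component_conj (z x : algpt G) : id_component G x -> id_component G (z * x * z^-1)%g.
Proof.
move=> Tx; have cc : continuous (fun y : algpt G => (z * y * z^-1)%g).
  exact: (comp_continuous (@algpt_mull _ _ G z) (@algpt_mulr _ _ G z^-1%g)).
have C := connected_image cc (@component_connected _ setT (1%g : algpt G)).
apply: (id_component_max _ C).
  by exists 1%g; [exact: id_component1|rewrite mulg1 mulgV].
by exists x.
Qed.

(** The image of a connected piece, translated so as to contain 1, lies in the identity component;
    each piece thus meets a single coset. *)
Lemma finitely_connected_cosets (X : topologicalType) (psi : X -> algpt G) (C : set X) :
  continuous psi -> finitely_connected C ->
  exists s : seq (algpt G), forall x, C x -> exists2 z, z \in s & id_component G (psi x * z^-1)%g.
Proof.
move=> pc; elim=> [{}C Cc|C1 C2 _ [s1 h1] _ [s2 h2]]; last first.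
  exists (s1 ++ s2) => x [/h1|/h2][z zs hz]; exists z => //;
  by rewrite mem_cat zs ?orbT.
have [[x0 Cx0]|C0] := pselect (C !=set0); last by exists [::] => x Cx; case: C0; exists x.
exists [:: psi x0] => x Cx; exists (psi x0); first by rewrite inE.
have cc := comp_continuous pc (@algpt_mulr _ _ G (psi x0)^-1%g).
have D := connected_image cc Cc; apply: (id_component_max _ D); last by exists x.
by exists x0 => //=; rewrite mulgV.
Qed.

Lemma finite_cosets : exists s : seq (algpt G),
  forall x, exists2 z, z \in s & id_component G (x * z^-1)%g.
Proof.
have [[r [U [Uo Ucov Uaff]]] _] := @alg_group_variety k H.
have /choice[s sP] : forall i, exists s : seq (algpt G), forall x, U i x ->
    exists2 z, z \in s & id_component G (pi x * z^-1)%g.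
  move=> i; have [m [Z [_ [f [[fc _] [g [fK gK [gc _]]]]]]]] := Uaff i.
  pose psi (w : Z) : algpt G := pi (val (g w)).
  have pc : continuous psi.
    have vc : continuous (val : U i -> H) by exact: initial_continuous.
    exact: (comp_continuous gc (comp_continuous vc (@alg_proj_continuous _ _ G))).
  have fZ := noetherian_finitely_connected (@sub_affine_noetherian _ _ Z) closedT.
  have [s sP] := finitely_connected_cosets pc fZ; exists s => x Ux.
  have [z zs hz] := sP (f (SigSub (mem_set Ux))) I; exists z => //.
  by move: hz; rewrite /psi fK.
exists (flatten [seq s i | i <- enum 'I_r]) => y; have [x <-] := proj_surj y.
have [i _ Ux] : (\bigcup_i U i) x by rewrite Ucov.
have [z zs hz] := sP i x Ux; exists z => //.
by apply/flattenP; exists (s i) => //; apply: map_f; rewrite mem_enum.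
Qed.

Lemma image_mul x y : alg_image G x -> alg_image G y -> alg_image G (x * y)%g.
Proof. by case=> a _ <- [b _ <-]; exists (a * b)%g; rewrite ?gmulfM. Qed.

Lemma image_inv x : alg_image G x -> alg_image G x^-1%g.
Proof.
move=> Gx; pose z : algpt G := AlgPt (mem_set Gx).
by have := set_mem (valP z^-1%g).
Qed.

End Components.

Section TorusComponent.
Context {k : closedFieldType} (char0 : [pchar k] =i pred0) {n r : nat} (G : algSubgroup k n).
Context (f : Gm_set k r -> id_component G).
Hypothesis fiso : is_isomorphism f.
Hypothesis fM : forall s t u : Gm_set k r, (forall i, val u i = val s i * val t i) ->
  val (f u) = (val (f s) * val (f t))%g.
Local Notation phi := (torus_aut f).

Lemma torus_in_image t : tunit t -> alg_image G (phi t).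
Proof. by move=> ut; rewrite (torus_aut_pt f ut); exact: set_mem (valP _). Qed.

Lemma torus_normal g t : alg_image G g -> tunit t ->
  exists t', tunit t' /\ (g * phi t = phi t' * g)%g.
Proof.
move=> Gg ut; pose z : algpt G := AlgPt (mem_set Gg).
have Tt : id_component G (val (f (torus_pt ut))) by exact: set_mem (valP _).
have [|t' ut' E] := torus_image_surj fiso (x := val (z * val (f (torus_pt ut)) * z^-1)%g).
  by exists (z * val (f (torus_pt ut)) * z^-1)%g => //; exact: id_component_conj.
by exists t'; split=> //; rewrite -E (torus_aut_pt f ut) /= mulgVK.
Qed.

Lemma torus_cosets : exists s : seq (polyaut k n), {in s, forall x, alg_image G x} /\
  forall g, alg_image G g -> exists t x, [/\ tunit t, x \in s & g = (phi t * x)%g].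
Proof.
have [s sP] := finite_cosets G; exists [seq val z | z <- s]; split.
  by move=> _ /mapP[z _ ->]; exact: set_mem (valP z).
move=> g Gg; have [z zs hz] := sP (AlgPt (mem_set Gg)).
have [|t ut E] := torus_image_surj fiso (x := val (AlgPt (mem_set Gg) * z^-1)%g).
  by exists (AlgPt (mem_set Gg) * z^-1)%g.
by exists t, (val z); split=> //; [exact: map_f|rewrite -E /= mulgVK].
Qed.

(** An irreducible set is connected, so a point [z0] of the smallest member translates the whole
    chain into the identity component. The vanishing ideals on the torus are prime and strictly
    decreasing. *)
Lemma chain_leq_rank d : has_chain (algpt G) d -> (d <= r)%N.
Proof.
case=> Z [Zirr Zlt]; have [[fc _] [g [fK gK [gc _]]]] := fiso.
have Zsub i : (i < d)%N -> Z i `<=` Z i.+1 by move=> /Zlt/properW.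
have Z0sub i : (i <= d)%N -> Z 0%N `<=` Z i.
  elim: i => [|i IH] id z Zz //; apply: (Zsub i id); exact: (IH (ltnW id)).
have [_ [[z0 Zz0] _]] := Zirr 0%N (leq0n d).
have ZT i z : (i <= d)%N -> Z i z -> id_component G (z0^-1 * z)%g.
  move=> id Ziz; have [_ irr] := Zirr i id.
  have C := connected_image (@algpt_mull _ _ G z0^-1%g) (irreducible_connected irr).
  apply: (id_component_max _ C); last by exists z.
  by exists z0; [exact: Z0sub|rewrite mulVg].
pose I i (p : {mpoly k[r]}) := forall u : Gm_set k r, Z i (z0 * val (f u))%g -> p.@[val u] = 0.
have lift i z : (i <= d)%N -> Z i z -> exists u, z = (z0 * val (f u))%g.
  move=> id Ziz; exists (g (SigSub (mem_set (ZT i z id Ziz)))).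
  by rewrite gK /= mulVKg.
(* Irreducibility is tested against closed sets of the whole group, so the zero set of [p] is
   realized as the trace on the translated component of such a set. *)
have vanish p : exists2 D : set (algpt G), closed D &
    forall u, D (z0 * val (f u))%g <-> p.@[val u] = 0.
  pose B : set (id_component G) := g @^-1` [set u | p.@[val u] = 0].
  have Bc : closed B.
    apply: closed_preimage => //; rewrite -openC openE => u /= /eqP pu.
    by apply/sub_affine_nbhsP; exists p; split=> // y /eqP.
  have : open (~` B) by exact: closed_openC.
  case=> V Vo VB.
  exists ((fun z => (z0^-1 * z)%g) @^-1` (~` V)).
    by apply: closed_preimage; [exact: algpt_mull|exact: open_closedC].
  move=> u /=; rewrite mulKg.
  have -> : (~ V (val (f u))) <-> ~ (~` B) (f u) by rewrite -VB.
  by rewrite /B /= fK; split=> [/contrapT//|-> h]; exact: h.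
apply: (@prime_chain_leq _ char0 _ d I) => [i id|i id|i id p q Ipq|i p id Ip|i id].
- split=> [u _|a p q Ip Iq u Zu]; first by rewrite meval0.
  by rewrite mevalD mevalM Ip // Iq // mulr0 addr0.
- move=> /(_ (torus_pt (fun _ => oner_neq0 k))); rewrite rmorph1 (torus_one fM) mulg1.
  by move=> h; have /eqP := h (Z0sub i id z0 Zz0); rewrite oner_eq0.
- have [D Dc DP] := vanish p; have [E Ec EP] := vanish q.
  have [_ irr] := Zirr i id.
  have [|h|h] := irr.2 D E Dc Ec; [|left|right].
  + move=> z Ziz; have [u zE] := lift i z id Ziz; rewrite zE in Ziz *.
    have /eqP := Ipq u Ziz; rewrite mevalM mulf_eq0 => /orP[]/eqP ?; [left; exact/DP|right; exact/EP].
  + by move=> u /h /DP.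
  + by move=> u /h /EP.
- by move=> u Zu; apply: Ip; exact: Zsub.
have [_ /existsNP[z /not_implyP[Zz nZz]]] := Zlt i id.
have [u zE] := lift i.+1 z id Zz.
pose Y : set (Gm_set k r) := (fun u => (z0 * val (f u))%g) @^-1` Z i.
have Yc : closed Y.
  apply: closed_preimage; last by case: (Zirr i (ltnW id)).
  have vc : continuous (val : id_component G -> algpt G) by exact: initial_continuous.
  exact: (comp_continuous fc (comp_continuous vc (@algpt_mull _ _ G z0))).
have [|p [pu pY]] := sub_affine_closed (x := u) Yc; first by rewrite /Y /= -zE.
exists p; first exact: pY.
by move=> Ip; case/eqP: pu; apply: Ip; rewrite -zE.
Qed.

Lemma torus_linearize : (n <= r.+1)%N -> exists y, linearized phi (alg_image G) y.
Proof.
move=> nr; apply: (linearize char0 (torus_hom_dec char0 fiso fM) (torus_faithful fiso fM) nr).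
- exact: image_mul.
- exact: image_inv.
- exact: torus_autM.
- exact: torus_in_image.
- exact: torus_normal.
- exact: torus_cosets.
Qed.

End TorusComponent.

(** * Linear automorphisms and the theorem *)

Section Linear.
Context {k : closedFieldType} (char0 : [pchar k] =i pred0) {n : nat}.
Local Notation A := {mpoly k[n]}.
Local Notation coord y := (tnth (polyaut_map y)).

Definition linear_of (M : 'M[k]_n) (g : polyaut k n) :=
  forall i, coord g i = \sum_j M i j *: 'X_j.

Lemma coordM (g h : polyaut k n) i : coord (g * h)%g i = act h (coord g i).
Proof. by rewrite /polyaut_map /= tnth_mktuple. Qed.

Lemma coord1 i : coord (1%g : polyaut k n) i = 'X_i.
Proof. by rewrite /polyaut_map /= tnth_mktuple. Qed.

Lemma actX (g : polyaut k n) i : act g 'X_i = coord g i.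
Proof. by rewrite /act comp_mpolyXU -tnth_nth. Qed.

Lemma polyautP (g h : polyaut k n) : (forall i, coord g i = coord h i) -> g = h.
Proof. by move=> E; apply: polyaut_map_inj; exact: eq_from_tnth. Qed.

Lemma act_lincomb (g : polyaut k n) (c : 'I_n -> k) (p : 'I_n -> A) :
  act g (\sum_j c j *: p j) = \sum_j c j *: act g (p j).
Proof. by rewrite /act raddf_sum; apply: eq_bigr => j _ /=; rewrite comp_mpolyZ. Qed.

Lemma linear_ofM M N g h : linear_of M g -> linear_of N h -> linear_of (M *m N) (g * h)%g.
Proof.
move=> gM hN i; rewrite coordM gM act_lincomb.
rewrite (eq_bigr (fun j => \sum_l (M i j * N j l) *: 'X_l)) => [|j _]; last first.
  by rewrite actX hN scaler_sumr; apply: eq_bigr => l _; rewrite scalerA.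
by rewrite exchange_big; apply: eq_bigr => l _; rewrite mxE scaler_suml.
Qed.

Lemma linear_of_inj (M : 'M[k]_n) (g : polyaut k n) : linear_of M g -> g = 1%g -> M = 1%:M.
Proof.
move=> gM g1; apply/matrixP => i j; have := gM i; rewrite g1 coord1.
move/(congr1 (fun p : A => p@_(U_(j)%MM))); rewrite mcoeffXU raddf_sum /=.
rewrite (bigD1 j) //= big1 => [|l lj]; rewrite mcoeffZ mcoeffXU; last first.
  by rewrite (negbTE lj) mulr0.
by rewrite eqxx mulr1 addr0 mxE => <-.
Qed.

Lemma conj_lin (y h : polyaut k n) (M : 'M[k]_n) :
  (forall i, act h (coord y i) = \sum_j M i j *: coord y j) -> linear_of M (y * h * y^-1)%g.
Proof.
move=> E i; rewrite !coordM E act_lincomb; apply: eq_bigr => j _.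
by rewrite -coordM mulgV coord1.
Qed.

Lemma polyaut_jacM (g h : polyaut k n) : polyaut_jac (g * h)%g = act h (polyaut_jac g) * polyaut_jac h.
Proof.
rewrite /polyaut_jac -[act h _](det_map_mx (comp_mpoly (polyaut_map h))) -det_mulmx.
congr (\det _); apply/matrixP => i j; rewrite !mxE coordM /act mderiv_comp.
by apply: eq_bigr => l _; rewrite !mxE.
Qed.

Lemma polyaut_jac_linear (M : 'M[k]_n) (g : polyaut k n) : linear_of M g -> polyaut_jac g = (\det M)%:MP.
Proof.
move=> gM; rewrite -[(\det M)%:MP](det_map_mx (@mpolyC n k)); congr (\det _).
apply/matrixP => i j; rewrite !mxE gM raddf_sum (bigD1 j) //= big1 => [|l lj].
  by rewrite mderivZ mderivXU eqxx mpolyC1 addr0 alg_mpolyC.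
by rewrite mderivZ mderivXU (negbTE lj) mpolyC0 scaler0.
Qed.

Lemma linear_of1 : linear_of 1%:M (1%g : polyaut k n).
Proof.
move=> i; rewrite coord1 (bigD1 i) //= big1 ?addr0 => [|j ji]; rewrite mxE.
  by rewrite eqxx scale1r.
by rewrite eq_sym (negbTE ji) scale0r.
Qed.

Lemma polyaut_jac1 : polyaut_jac (1%g : polyaut k n) = 1.
Proof. by rewrite (polyaut_jac_linear linear_of1) det1 mpolyC1. Qed.

Lemma polyaut_jac_cst (g : polyaut k n) : exists2 c, c != 0 & polyaut_jac g = c%:MP.
Proof.
have : polyaut_jac g \is a GRing.unit.
  have := polyaut_jacM g^-1%g g; rewrite mulVg polyaut_jac1 => E.
  have := unitr1 A; rewrite E unitrM => /andP[_ h].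
  exact: h.
by rewrite mpoly_unit_msize => /msize_poly1P[c c0 ->]; exists c.
Qed.

Lemma star_mul (g h : polyaut k n) : polyaut_star g -> polyaut_star h -> polyaut_star (g * h)%g.
Proof. by rewrite /polyaut_star /= => gS hS; rewrite polyaut_jacM gS hS mulr1 -mpolyC1 act_cst. Qed.

Lemma star_inv (g : polyaut k n) : polyaut_star g -> polyaut_star g^-1%g.
Proof.
rewrite /polyaut_star /= => gS; have := polyaut_jacM g g^-1%g.
by rewrite mulgV polyaut_jac1 gS -mpolyC1 act_cst mpolyC1 mul1r => <-.
Qed.

Lemma diag_aut_exists (t : 'I_n -> k) : (forall i, t i != 0) ->
  exists g : polyaut k n, forall i, coord g i = t i *: 'X_i.
Proof.
move=> t0; have [|g gE] := @polyaut_of_generators k char0 n [tuple t i *: 'X_i | i < n].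
  move=> i; exists ((t i)^-1 *: 'X_i).
  by rewrite comp_mpolyZ comp_mpolyXU -tnth_nth tnth_mktuple scalerA mulVf // scale1r.
by exists g => i; rewrite gE tnth_mktuple.
Qed.

Lemma diag_linear (t : 'I_n -> k) (g : polyaut k n) :
  (forall i, coord g i = t i *: 'X_i) -> linear_of (diag_mx (\row_i t i)) g.
Proof.
move=> gt i; rewrite gt (bigD1 i) //= big1 ?addr0 => [|j ji]; rewrite !mxE.
  by rewrite eqxx mulr1n.
by rewrite eq_sym (negbTE ji) mulr0n scale0r.
Qed.

Lemma diag_jac (t : 'I_n -> k) (g : polyaut k n) :
  (forall i, coord g i = t i *: 'X_i) -> polyaut_jac g = (\prod_i t i)%:MP.
Proof.
move=> /diag_linear/polyaut_jac_linear ->; rewrite det_diag.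
by congr (_%:MP); apply: eq_bigr => i _; rewrite mxE.
Qed.

End Linear.

(** * Systems of characters of a torus *)

Section Lattice.
Context {k : closedFieldType} (char0 : [pchar k] =i pred0).

Lemma zroot (t : k) (d : int) : t != 0 -> d != 0 -> exists2 u, u != 0 & u ^ d = t.
Proof.
have natroot (s : k) (m : nat) : s != 0 -> (0 < m)%N -> exists2 u, u != 0 & u ^+ m = s.
  move=> s0 m0; have /closed_rootP[u] : size ('X^m - s%:P : {poly k}) != 1 by rewrite size_XnsubC //; lia.
  rewrite rootE hornerD hornerN hornerXn hornerC subr_eq0 => /eqP E; exists u => //.
  by case: m m0 E => // m _ E; apply: contraNneq s0 => u0; rewrite -E u0 expr0n.
move=> t0; case: d => m m0; first by have [|u u0 E] := natroot t m t0; [lia|exists u].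
have ti0 : t^-1 != 0 by rewrite invr_eq0.
have [u u0 E] := natroot t^-1 m.+1 ti0 (ltn0Sn m); exists u => //.
by rewrite NegzE -exprnN E invrK.
Qed.

Lemma expz_prod (I : Type) (l : seq I) (u : k) (e : I -> int) : u != 0 ->
  \prod_(i <- l) u ^ e i = u ^ (\sum_(i <- l) e i).
Proof.
move=> u0; elim: l => [|i l IH]; first by rewrite !big_nil expr0z.
by rewrite !big_cons IH expfzDr.
Qed.

(* A faithful system of [d] characters of a torus of rank [r >= d] is an isogeny;
   its inverse up to a power is the adjugate matrix. *)
Lemma tpow_surj d r (c : 'I_d -> 'rV[int]_r) : (d <= r)%N ->
  (forall s : 'I_r -> k, tunit s -> (forall i, tpow s (c i) = 1) -> forall j, s j = 1) ->
  forall t : 'I_d -> k, (forall i, t i != 0) ->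
  exists2 s, tunit s & forall i, tpow s (c i) = t i.
Proof.
move=> dr inj t t0; pose Q : 'M[rat]_(r, d) := \matrix_(j, i) (c i 0 j)%:~R.
(* An integral relation [z] between the rows would yield a point with coordinates [2 ^ z j 0] killed
   by all the characters. *)
have Qfree : row_free Q.
  apply: inj_row_free => v vQ; have [D [z [D0 zE]]] := rat_clear_denominators v^T.
  have two0 : (2%:R : k) != 0 by rewrite ((pcharf0P _).1 char0).
  have us : tunit (fun j => (2%:R : k) ^ z j 0) by move=> j; rewrite expfz_neq0.
  have z0 j : z j 0 = 0.
    apply: (char0_expz2 char0); apply: (inj _ us) => i.
    rewrite /tpow (eq_bigr (fun j => (2%:R : k) ^ (z j 0 * c i 0 j))) => [|l _]; last by rewrite exprz_exp.
    rewrite expz_prod //; suff -> : \sum_j z j 0 * c i 0 j = 0 by rewrite expr0z.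
    apply/eqP; rewrite -(intr_eq0 rat) rmorph_sum /=; apply/eqP.
    have /matrixP/(_ 0 i) := vQ; rewrite !mxE => /(congr1 (fun x => D%:R * x)).
    rewrite mulr0 mulr_sumr => E; rewrite -[RHS]E; apply: eq_bigr => l _.
    by rewrite rmorphM /= -zE !mxE mulrA.
  apply/rowP => j; have := zE j; rewrite z0 !mxE => /eqP.
  by rewrite mulf_eq0 pnatr_eq0 (negbTE D0) => /eqP.
have rd : (r <= d)%N by rewrite -(eqP Qfree); exact: rank_leq_col.
have E : d = r by apply/eqP; rewrite eqn_leq dr.
move: c inj t t0 @Q Qfree {dr rd}; rewrite E => {d E} c inj t t0 Q Qfree.
pose C : 'M[int]_r := \matrix_(j, i) c i 0 j.
have QC : Q = map_mx intr C by apply/matrixP => i j; rewrite !mxE.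
have dC : \det C != 0.
  by move: Qfree; rewrite row_free_unit QC unitmxE det_map_mx unitfE intr_eq0.
(* Since [\adj C *m C] is the scalar [\det C], roots of order [\det C] turn the adjugate into an
   exact preimage. *)
have /choice[u uP] : forall i, exists u, u != 0 /\ u ^ (\det C) = t i.
  by move=> i; have [u u0 uE] := zroot (t0 i) dC; exists u.
pose s j := \prod_i u i ^ (\adj C i j).
have us : tunit s by move=> j; apply/prodf_neq0 => i _; rewrite expfz_neq0 //; case: (uP i).
exists s => // l; rewrite /tpow.
have -> : \prod_j s j ^ c l 0 j = \prod_i \prod_j u i ^ (\adj C i j * C j l).
  rewrite exchange_big; apply: eq_bigr => j _ /=.
  rewrite /s mxE; elim/big_rec2: _ => [|i x y _ IH]; first by rewrite exp1rz.
  by rewrite expfzMl IH exprz_exp.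
have key i : \prod_j u i ^ (\adj C i j * C j l) = u i ^ ((\det C) *+ (i == l)).
  rewrite expz_prod; last by case: (uP i).
  by have /matrixP/(_ i l) := mul_adj_mx C; rewrite !mxE => ->.
rewrite (eq_bigr _ (fun i _ => key i)) (bigD1 l) //= big1 => [|i il].
  by rewrite eqxx mulr1n mulr1; case: (uP l).
by rewrite (negbTE il) mulr0n expr0z.
Qed.

End Lattice.

Section Main.
Context {k : closedFieldType} (char0 : [pchar k] =i pred0) {n r : nat} (G : algSubgroup k n).
Context (f : Gm_set k r -> id_component G).
Hypothesis fiso : is_isomorphism f.
Hypothesis fM : forall s t u : Gm_set k r, (forall i, val u i = val s i * val t i) ->
  val (f u) = (val (f s) * val (f t))%g.
Local Notation phi := (torus_aut f).
Local Notation coord y := (tnth (polyaut_map y)).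

Lemma linearized_scale y (t : 'I_n -> k) (d : polyaut k n) : (forall i, t i != 0) ->
  (forall i, coord d i = t i *: 'X_i) -> linearized phi (alg_image G) y ->
  linearized phi (alg_image G) (d * y)%g.
Proof.
move=> t0 dE [yh yM].
have E i : coord (d * y)%g i = t i *: coord y i by rewrite coordM dE act_scale actX.
split=> [i|g Gg]; first by rewrite E; have [c hc] := yh i; exists c; exact: homZ.
have [M MP] := yM g Gg; exists (\matrix_(i, j) (t i * M i j / t j)) => i.
rewrite E act_scale MP scaler_sumr; apply: eq_bigr => j _.
by rewrite E mxE !scalerA divfK.
Qed.

Lemma conj_GL y : linearized phi (alg_image G) y -> conj_by y (alg_image G) `<=` GL_aut.
Proof.
case=> _ yM _ [g Gg <-]; have [M /conj_lin MP] := yM g Gg; exists M => //.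
have [N /conj_lin NP] := yM _ (image_inv Gg).
have E : ((y * g * y^-1) * (y * g^-1 * y^-1) = 1)%g.
  by rewrite -!mulgA mulKg mulVKg mulgV.
by have /mulmx1_unit[] := linear_of_inj (linear_ofM MP NP) E.
Qed.

Lemma conj_torus y : linearized phi (alg_image G) y -> exists c : 'I_n -> 'rV[int]_r,
  forall t, tunit t -> forall i, coord (y * phi t * y^-1)%g i = tpow t (c i) *: 'X_i.
Proof.
case=> /choice[c cP] _; exists c => t ut i.
rewrite !coordM [act (phi t) _](cP i t ut) act_scale; congr (_ *: _).
by rewrite -coordM mulgV coord1.
Qed.

Lemma conj_diag y : linearized phi (alg_image G) y ->
  conj_by y (id_component_image G) `<=` diag_aut.
Proof.
move=> /conj_torus[c cP] _ [g Tg <-]; have [t ut ->] := torus_image_surj fiso Tg.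
by exists (fun i => tpow t (c i)); [move=> i; exact: tpow_neq0|exact: cP].
Qed.

Lemma id_component_image_sub : id_component_image G `<=` alg_image G.
Proof. by move=> _ [z _ <-]; exact: set_mem (valP z). Qed.

End Main.

Lemma mpolyC_injective (k : fieldType) n (a b : k) : a%:MP_[n] = b%:MP_[n] -> a = b.
Proof. by move/(congr1 (mcoeff 0%MM)); rewrite !mcoeffC eqxx !mulr1. Qed.

(** * Unimodular groups of dimension [n - 1] *)

Section Star.
Context {k : closedFieldType} (char0 : [pchar k] =i pred0) {d r : nat} (G : algSubgroup k d.+1).
Context (f : Gm_set k r -> id_component G).
Hypothesis fiso : is_isomorphism f.
Hypothesis fM : forall s t u : Gm_set k r, (forall i, val u i = val s i * val t i) ->
  val (f u) = (val (f s) * val (f t))%g.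
Local Notation phi := (torus_aut f).
Hypothesis dr : (d <= r)%N.
Hypothesis GS : alg_image G `<=` polyaut_star.

(** The Jacobian is a non-zero constant, and dividing the first coordinate by it preserves both
    homogeneity and the stable span. *)
Lemma star_linearized y : linearized phi (alg_image G) y ->
  exists2 z, polyaut_star z & linearized phi (alg_image G) z.
Proof.
move=> yl; have [c c0 yc] := polyaut_jac_cst y.
pose t (i : 'I_d.+1) := if i == ord0 then c^-1 else 1.
have t0 i : t i != 0 by rewrite /t; case: ifP; rewrite ?invr_eq0 ?oner_neq0.
have [g gE] := diag_aut_exists char0 t0.
exists (g * y)%g; last exact: (linearized_scale t0 gE yl).
rewrite /polyaut_star /= polyaut_jacM (diag_jac gE) act_cst yc -mpolyCM.
rewrite (bigD1 ord0) //= big1 => [|i /negbTE i0]; last by rewrite /t i0.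
by rewrite mulr1 /t eqxx mulVf // mpolyC1.
Qed.

(** The diagonal characters have product 1, so the character at [ord0] is determined by the others.
    These are therefore still faithful, [tpow_surj] prescribes their values, and the product
    condition supplies the remaining one. *)
Lemma conj_torus_surj y : polyaut_star y -> linearized phi (alg_image G) y ->
  diag_aut_star `<=` conj_by y (id_component_image G).
Proof.
move=> yS yl g [[t t0 gt] gS]; have [c cP] := conj_torus yl.
have tprod : \prod_i t i = 1.
  by apply: (@mpolyC_injective _ d.+1); rewrite -(diag_jac gt) mpolyC1.
have cprod (s : 'I_r -> k) : tunit s -> \prod_i tpow s (c i) = 1.
  move=> us; apply: (@mpolyC_injective _ d.+1); rewrite -(diag_jac (cP s us)) mpolyC1.
  have phiS : polyaut_star (phi s) := GS (torus_in_image f us).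
  exact: (star_mul (star_mul yS phiS) (star_inv yS)).
pose c' i := c (lift ord0 i).
have [s us E|s us sE] := tpow_surj char0 (c := c') dr _ (fun i => t0 (lift ord0 i)).
  apply: (torus_faithful fiso fM us).
  suff E1 : (y * phi s * y^-1 = 1)%g.
    have -> : phi s = 1%g by rewrite -(mulKg y (phi s)) -[(y * _)%g](mulgVK y) E1 mul1g mulVg.
    by [].
  apply: polyautP => i; rewrite cP // coord1.
  have [j ->|->] := unliftP ord0 i; first by rewrite [tpow _ _]E scale1r.
  have := cprod s us; rewrite big_ord_recl big1 => [|j _]; last exact: E.
  by rewrite mulr1 => ->; rewrite scale1r.
exists (phi s); first exact: torus_image.
apply: polyautP => i; rewrite cP // gt; congr (_ *: _).
have [j ->|->] := unliftP ord0 i; first exact: sE.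
have E1 := cprod s us; rewrite big_ord_recl (eq_bigr _ (fun j _ => sE j)) in E1.
have E2 := tprod; rewrite big_ord_recl in E2.
have p0 : \prod_j t (lift ord0 j) != 0 by apply/prodf_neq0 => j _.
by apply: (mulIf p0); rewrite E2.
Qed.

End Star.

Theorem theorem10 (k : closedFieldType) (char0 : [pchar k] =i pred0) (n : nat)
    (G : algSubgroup k n) (torusG0 : is_torus (id_component G)) :
  (has_krull_dim (algpt G) n \/ (exists2 d, d.+1 = n & has_krull_dim (algpt G) d) ->
     exists g : polyaut k n,
       conj_by g (alg_image G) `<=` GL_aut /\
       conj_by g (id_component_image G) `<=` diag_aut) /\
  (alg_image G `<=` polyaut_star ->
     (exists2 d, d.+1 = n & has_krull_dim (algpt G) d) ->
     exists2 g : polyaut k n, polyaut_star g &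
       conj_by g (alg_image G) `<=` SL_aut /\
       conj_by g (id_component_image G) = diag_aut_star).
Proof.
have [r [f [fiso fM]]] := torusG0.
split=> [dimG|GS [d dn [chain _]]].
  have nr : (n <= r.+1)%N.
    case: dimG => [[chain _]|[d dn [chain _]]].
      exact: leqW (chain_leq_rank char0 fiso fM chain).
    rewrite -dn; exact: (chain_leq_rank char0 fiso fM chain).
  have [y yl] := torus_linearize char0 fiso fM nr.
  by exists y; split; [exact: conj_GL yl|exact: (conj_diag fiso yl)].
subst n; have dr := chain_leq_rank char0 fiso fM chain.
have [y yl] := torus_linearize char0 fiso fM (dr : (d.+1 <= r.+1)%N).
have [z zS zl] := star_linearized char0 yl; exists z => //.
have zstar : conj_by z (alg_image G) `<=` polyaut_star.
  by move=> _ [g /GS gS <-]; apply: star_mul (star_inv zS); exact: star_mul.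
split; first by move=> x hx; split; [exact: (conj_GL zl)|exact: zstar].
apply/seteqP; split; last exact: (conj_torus_surj char0 fiso fM dr GS zS zl).
move=> x hx; split; first exact: (conj_diag fiso zl).
by apply: zstar; case: hx => g /id_component_image_sub Gg <-; exists g.
Qed.
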